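(* Let $a, b, c \in \mathbb{C}$ with $a \neq 0$, and let $\Psi(z) = a\bar{z} + b + cz$ for $z\in\mathbb{D}$. The Toeplitz operator $T_{\Psi}$ is hypercyclic on the Bergman space $L_A^2(\mathbb{D})$ if and only if both of the following hold: (i) $|a| > |c|$; (ii) $\mathbb{D}\cap \Psi(\mathbb{D}) \neq \emptyset$ and $\hat{\mathbb{D}} \cap \Psi(\mathbb{D})\neq \emptyset$, where $\hat{\mathbb{D}} = \{z \in \mathbb{C} : |z| \geq 1\}$.
   Context: $\mathbb{D} = \{z \in \mathbb{C} : |z| < 1\}$. $\hat{\mathbb{D}} = \mathbb{C}\setminus\mathbb{D}$ is the closed exterior of the disc. The Bergman space $L_A^2(\mathbb{D}) = L^2(\mathbb{D}, dA) \cap \mathcal{H}(\mathbb{D})$ consists of the analytic functions on $\mathbb{D}$ that are square-integrable with respect to the normalized area measure $dA(z) = \frac{1}{\pi}\,dx\,dy$; $P : L^2(\mathbb{D}, dA) \to L_A^2(\mathbb{D})$ is the orthogonal (Bergman) projection, $Pf(z)= \int_{\mathbb{D}} \frac{f(\omega)}{(1-\bar{\omega}z)^{2}} \, dA(\omega)$. For $\phi \in L^\infty(\mathbb{D})$, the Toeplitz operator $T_\phi$ on $L_A^2(\mathbb{D})$ is $T_{\phi}f = P(\phi f)$. A bounded operator $T$ is hypercyclic if there is a vector $x$ whose orbit $\{T^n x : n \geq 0\}$ is dense. *)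

(* Defs.v *)
From HB Require Import structures.
From mathcomp Require Import all_boot all_order all_algebra.
From mathcomp Require Import complex.
From mathcomp Require Import all_classical all_reals all_analysis.

Set Implicit Arguments.
Unset Strict Implicit.
Unset Printing Implicit Defensive.

Import Order.TTheory GRing.Theory Num.Theory.
Import numFieldNormedType.Exports.

Local Open Scope classical_set_scope.
Local Open Scope ring_scope.

(* Functions on the unit disc are represented by total functions
   [R[i] -> R[i]] whose values off the disc are irrelevant: [bergman], [L2_norm]
   and [toeplitz] only look at values on the disc. *)

Section Disc.
Context {R : realType}.

(* The norm and the order on [R[i]] are those of [numDomainType]: [`|z|] is the
   modulus, as a complex number with zero imaginary part. *)
Definition disc : set R[i] := [set z | `|z| < 1].

Definition exterior_disc : set R[i] := [set z | 1 <= `|z|].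

Definition cplx (p : measurableTypeR R * measurableTypeR R) : R[i] := Complex p.1 p.2.

Definition disc2 : set (measurableTypeR R * measurableTypeR R) := cplx @^-1` disc.

Lemma invpi_ge0 : 0 <= (pi : R)^-1.
Proof. by rewrite invr_ge0 pi_ge0. Qed.

(* dA = dx dy / pi, on all of R^2; integrals are taken over [disc2]. *)
Definition dA :
    {measure set (measurableTypeR R * measurableTypeR R) -> \bar R} :=
  mscale (NngNum invpi_ge0) (lebesgue_measure \x lebesgue_measure)%E.

Definition disc_integral (f : R[i] -> R[i]) : R[i] :=
  Complex (\int[dA]_(p in disc2) complex.Re (f (cplx p)))
          (\int[dA]_(p in disc2) complex.Im (f (cplx p))).

Definition sqr_integral (f : R[i] -> R[i]) : \bar R :=
  (\int[dA]_(p in disc2) ((Normc.normc (f (cplx p))) ^+ 2)%:E)%E.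

Definition L2_disc : set (R[i] -> R[i]) :=
  [set f : R[i] -> R[i] |
    [/\ measurable_fun disc2 (fun p => complex.Re (f (cplx p)) : R),
        measurable_fun disc2 (fun p => complex.Im (f (cplx p)) : R)
      & (sqr_integral f < +oo)%E]].

(* [derivable] over the field [R[i]], i.e. complex differentiability. *)
Definition holomorphic_disc : set (R[i] -> R[i]) :=
  [set f : R[i] -> R[i] | forall z, disc z -> derivable (f : R[i]^o -> R[i]^o) z 1].

Definition bergman : set (R[i] -> R[i]) := L2_disc `&` holomorphic_disc.

Definition L2_norm (f : R[i] -> R[i]) : R := Num.sqrt (fine (sqr_integral f)).

Definition bergman_proj (f : R[i] -> R[i]) (z : R[i]) : R[i] :=
  disc_integral (fun w => f w / (1 - conjc w * z) ^+ 2).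

Definition toeplitz (phi f : R[i] -> R[i]) : R[i] -> R[i] :=
  bergman_proj (fun w => phi w * f w).

Definition bergman_bounded_operator (T : (R[i] -> R[i]) -> (R[i] -> R[i])) :=
  [/\ forall f, bergman f -> bergman (T f),
      forall (k : R[i]) f g, bergman f -> bergman g ->
        forall z, disc z ->
          T (fun w => k * f w + g w) z = k * T f z + T g z
    & exists M : R, forall f, bergman f -> L2_norm (T f) <= M * L2_norm f].

Definition hypercyclic (T : (R[i] -> R[i]) -> (R[i] -> R[i])) :=
  bergman_bounded_operator T /\
  exists2 f, bergman f &
    forall g, bergman g -> forall e : R, 0 < e ->
      exists n : nat, L2_norm (fun w => iter n T f w - g w) < e.

End Disc.

(* Main.v *)
(* In the orthonormal basis [sqrt (n + 1) z ^ n] the operator is the tridiagonal matrix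
   [jac a b c] acting on square-summable sequences.
   If [|c| < |a|], put [gam = c / a].  For [|om| < 1] and [s = om + gam * conj om], this
   matrix has a square-summable eigenvector [ev gam s] with eigenvalue
   [b + a * s = Psi (conj om)].  It depends analytically on [s], so the closed span of the
   [ev gam s] is the same for [s] in any ball of the region; Gauss quadrature for
   truncated Jacobi matrices puts the first basis vector, hence everything, in that
   span.  The eigenvalues of modulus less than 1 and those of modulus greater than 1 thus
   both give dense spans, and the classical Godefroy-Shapiro argument yields a
   hypercyclic vector.
   Conversely, [|a| <= |c|] makes the operator [T] hyponormal, so that the norms
   [|T^n f|] are log-convex in [n]; [|Psi| <= 1] makes [T] a contraction; and if
   [|Psi| >= 1] on the disc, a supporting line of the convex set [Psi @` disc] gives
   [|f| <= |T f|].  In each case orbits of [T] cannot be both arbitrarily small and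
   arbitrarily large. *)

Require Import Defs.
From mathcomp Require Import all_boot all_order all_algebra.
From mathcomp Require Import complex.
From mathcomp Require Import all_classical all_reals all_analysis.
From mathcomp Require Import measurable_realfun ring lra.
Import Order.TTheory GRing.Theory Num.Theory.
Import numFieldNormedType.Exports.
Local Open Scope classical_set_scope.
Local Open Scope ring_scope.
Set Implicit Arguments.
Unset Strict Implicit.
Unset Printing Implicit Defensive.

(** The recurrence behind [ev] tends to a constant one with characteristic polynomial X^2 - s X +
    gam. For |gam| < 1, writing s = om + gam * conj om with |om| < 1 puts both roots inside the
    disc, with a margin uniform for |om| <= eta. This gives square-summability, and Taylor
    expansions in s whose radius does not shrink along a segment of the region. The quadrature comes
    from gam = 1: there the matrix is self-adjoint, and its eigenvectors integrated against the
    spectral measure of the first basis vector return that vector. Truncation makes the integral a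
    finite sum, exact up to index N; dilation by a square root of gam carries the real nodes |t| <=
    2 into the region and makes the error decay geometrically. Translating between functions and
    sequences takes two facts about the disc: holomorphic functions are sums of their Taylor series
    (Goursat on polar rectangles, whose sides include circles), and the moments of area measure are
    explicit (Green's formula on chords). Expanding the kernel of [bergman_proj] then yields the
    matrix entries. *)

Notation nm := Normc.normc.

(** * Arithmetic of the modulus and of conjugation on [R[i]] *)

Section Modulus.
Context {R : realType}.
Implicit Types (z w : R[i]) (x : R).

Lemma nmE z : `|z| = (nm z)%:C%C.
Proof. by []. Qed.
Lemma nm_ge0 z : 0 <= nm z.
Proof. by case: z => a b /=; rewrite sqrtr_ge0. Qed.
Lemma nm_sqr z : nm z ^+ 2 = complex.Re z ^+ 2 + complex.Im z ^+ 2.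
Proof. by case: z => a b /=; rewrite sqr_sqrtr// addr_ge0// sqr_ge0. Qed.
Lemma nmM z w : nm (z * w) = nm z * nm w.
Proof. exact: Normc.normcM. Qed.
Lemma nmD z w : nm (z + w) <= nm z + nm w.
Proof. exact: le_normcD. Qed.
Lemma nmN z : nm (- z) = nm z.
Proof. exact: normcN. Qed.
Lemma nmB z w : nm (z - w) <= nm z + nm w.
Proof. by rewrite (le_trans (nmD _ _))// nmN. Qed.
Lemma nm_dist z w : nm (z - w) = nm (w - z).
Proof. by rewrite -nmN opprB. Qed.
Lemma nm0 : nm (0 : R[i]) = 0.
Proof. exact: Normc.normc0. Qed.
Lemma nm1 : nm (1 : R[i]) = 1.
Proof. exact: Normc.normc1. Qed.
Lemma nm_eq0 z : (nm z == 0) = (z == 0).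
Proof.
apply/eqP/eqP => [|->]; last exact: nm0.
exact: Normc.eq0_normc.
Qed.
Lemma nm_gt0 z : (0 < nm z) = (z != 0).
Proof. by rewrite lt_neqAle nm_ge0 andbT eq_sym nm_eq0. Qed.
Lemma nmV z : nm z^-1 = (nm z)^-1.
Proof. exact: Normc.normcV. Qed.
Lemma nmX z n : nm (z ^+ n) = nm z ^+ n.
Proof. by elim: n => [|n IH]; rewrite ?expr0 ?nm1// !exprS nmM IH. Qed.
Lemma nm_conj z : nm (conjc z) = nm z.
Proof. by case: z => a b /=; rewrite sqrrN. Qed.
Lemma nmR x : nm (x%:C%C : R[i]) = `|x|.
Proof. by rewrite /= expr0n addr0 sqrtr_sqr. Qed.
Lemma nm_pos x : 0 <= x -> nm (x%:C%C : R[i]) = x.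
Proof. by move=> x0; rewrite nmR ger0_norm. Qed.
Lemma nm_nat n : nm (n%:R : R[i]) = n%:R.
Proof.
have -> : (n%:R : R[i]) = (n%:R : R)%:C%C by rewrite rmorph_nat.
by rewrite nm_pos// ler0n.
Qed.
Lemma Re_le_nm z : `|complex.Re z| <= nm z.
Proof.
by case: z => a b /=; rewrite -sqrtr_sqr ler_wsqrtr// lerDl sqr_ge0.
Qed.
Lemma Im_le_nm z : `|complex.Im z| <= nm z.
Proof.
by case: z => a b /=; rewrite -sqrtr_sqr ler_wsqrtr// lerDr sqr_ge0.
Qed.
Lemma nm_le_ReIm z : nm z <= `|complex.Re z| + `|complex.Im z|.
Proof.
rewrite -(@ler_pXn2r _ 2)// ?nnegrE ?addr_ge0// ?nm_ge0//.
rewrite nm_sqr sqrrD !real_normK ?num_real// -addrA lerD2l lerDr.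
by rewrite mulrn_wge0// mulr_ge0.
Qed.
Lemma nm_sum (I : Type) (r : seq I) (P : pred I) (F : I -> R[i]) :
  nm (\sum_(i <- r | P i) F i) <= \sum_(i <- r | P i) nm (F i).
Proof.
elim/big_ind2 : _ => [|x y z w h1 h2|//]; first by rewrite nm0.
exact: (le_trans (nmD _ _) (lerD h1 h2)).
Qed.
Lemma nm_sub_ge z w : nm z - nm w <= nm (z - w).
Proof. by rewrite lerBlDr (le_trans _ (nmD _ _))// subrK. Qed.
Lemma mul_conj z : z * conjc z = (nm z ^+ 2)%:C%C.
Proof.
rewrite nm_sqr; case: z => a b /=; apply/eqP; rewrite eq_complex /=.
by apply/andP; split; apply/eqP; ring.
Qed.
Lemma complex_eq z w : complex.Re z = complex.Re w -> complex.Im z = complex.Im w -> z = w.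
Proof. by case: z => a b; case: w => c d /= -> ->. Qed.
Lemma cReD z w : complex.Re (z + w) = complex.Re z + complex.Re w.
Proof. by case: z; case: w. Qed.
Lemma cImD z w : complex.Im (z + w) = complex.Im z + complex.Im w.
Proof. by case: z; case: w. Qed.
Lemma cReN z : complex.Re (- z) = - complex.Re z.
Proof. by case: z. Qed.
Lemma cImN z : complex.Im (- z) = - complex.Im z.
Proof. by case: z. Qed.
Lemma cReM z w : complex.Re (z * w) =
  complex.Re z * complex.Re w - complex.Im z * complex.Im w.
Proof. by case: z; case: w. Qed.
Lemma cImM z w : complex.Im (z * w) =
  complex.Re z * complex.Im w + complex.Im z * complex.Re w.
Proof. by case: z; case: w. Qed.
Lemma cReC z : complex.Re (conjc z) = complex.Re z.
Proof. by case: z. Qed.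
Lemma cImC z : complex.Im (conjc z) = - complex.Im z.
Proof. by case: z. Qed.
Lemma discE z : disc z <-> nm z < 1.
Proof. by rewrite /disc /= nmE -(ltcR (nm z) 1). Qed.
Lemma cjD z w : conjc (z + w) = conjc z + conjc w.
Proof. exact: rmorphD. Qed.
Lemma cjN z : conjc (- z) = - conjc z.
Proof. exact: rmorphN. Qed.
Lemma cjB z w : conjc (z - w) = conjc z - conjc w.
Proof. exact: rmorphB. Qed.
Lemma cjM z w : conjc (z * w) = conjc z * conjc w.
Proof. exact: rmorphM. Qed.
Lemma cjX z n : conjc (z ^+ n) = conjc z ^+ n.
Proof. exact: rmorphXn. Qed.
Lemma cjV z : conjc z^-1 = (conjc z)^-1.
Proof. exact: fmorphV. Qed.
Lemma cj1 : conjc 1 = 1 :> R[i].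
Proof. exact: rmorph1. Qed.
Lemma cj0 : conjc 0 = 0 :> R[i].
Proof. exact: rmorph0. Qed.
Lemma cj_sum (I : Type) (r : seq I) (P : pred I) (F : I -> R[i]) :
  conjc (\sum_(i <- r | P i) F i) = \sum_(i <- r | P i) conjc (F i).
Proof. exact: rmorph_sum. Qed.
Lemma rcD (x y : R) : (x + y)%:C%C = x%:C%C + y%:C%C :> R[i].
Proof. exact: rmorphD. Qed.
Lemma rcB (x y : R) : (x - y)%:C%C = x%:C%C - y%:C%C :> R[i].
Proof. exact: rmorphB. Qed.
Lemma rcM (x y : R) : (x * y)%:C%C = x%:C%C * y%:C%C :> R[i].
Proof. exact: rmorphM. Qed.
Lemma rcV (x : R) : (x^-1)%:C%C = (x%:C%C)^-1 :> R[i].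
Proof. exact: fmorphV. Qed.
Lemma rcX (x : R) n : (x ^+ n)%:C%C = x%:C%C ^+ n :> R[i].
Proof. exact: rmorphXn. Qed.
Lemma rc_nat n : (n%:R : R)%:C%C = n%:R :> R[i].
Proof. exact: rmorph_nat. Qed.
Lemma rc_sum (I : Type) (r : seq I) (P : pred I) (F : I -> R) :
  (\sum_(i <- r | P i) F i)%:C%C = \sum_(i <- r | P i) (F i)%:C%C :> R[i].
Proof. exact: rmorph_sum. Qed.
Lemma rc_eq0 (x : R) : (x%:C%C == 0 :> R[i]) = (x == 0).
Proof. by rewrite eq_complex /= eqxx andbT. Qed.
End Modulus.
#[global] Arguments Normc.normc {R} x : simpl never.

(** * Square-summable sequences *)

Section Ell.
Context {R : realType}.
Implicit Types (x y : nat -> R[i]) (r s e : R).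

(** The norm is at most [r], expressed by partial sums alone, so that no convergence question arises
    and coordinatewise limits keep the bound. *)
Definition ell x r := 0 <= r /\ forall N, \sum_(n < N) nm (x n) ^+ 2 <= r ^+ 2.

(** Minkowski's inequality. Termwise (p + q)^2 <= (1 + s/r) p^2 + (1 + r/s) q^2, and these weights
    turn the bounds r^2 and s^2 into exactly (r + s)^2. The cases r = 0 and s = 0 are treated
    apart. *)
Lemma sqr_sum_add (N : nat) (p q : nat -> R) r s : 0 <= r -> 0 <= s ->
  \sum_(n < N) p n ^+ 2 <= r ^+ 2 -> \sum_(n < N) q n ^+ 2 <= s ^+ 2 ->
  \sum_(n < N) (p n + q n) ^+ 2 <= (r + s) ^+ 2.
Proof.
move=> r0 s0 hp hq.
have zero (f : nat -> R) : \sum_(n < N) f n ^+ 2 <= 0 -> forall n : 'I_N, f n = 0.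
  move=> hf n; have h0 : \sum_(n < N) f n ^+ 2 = 0.
    by apply/eqP; rewrite eq_le hf sumr_ge0// => i _; exact: sqr_ge0.
  move/eqP: h0; rewrite psumr_eq0 => [/allP/(_ n)|i _]; last exact: sqr_ge0.
  by rewrite mem_index_enum => /(_ isT); rewrite sqrf_eq0 => /eqP.
have [r00|rN] := eqVneq r 0.
  rewrite r00 expr0n/= in hp; rewrite r00 add0r (le_trans _ hq)// ler_sum// => i _.
  by rewrite (zero _ hp) add0r.
have [s00|sN] := eqVneq s 0.
  rewrite s00 expr0n/= in hq; rewrite s00 addr0 (le_trans _ hp)// ler_sum// => i _.
  by rewrite (zero _ hq) addr0.
have rp : 0 < r by rewrite lt_neqAle eq_sym rN.
have sp : 0 < s by rewrite lt_neqAle eq_sym sN.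
apply: (@le_trans _ _ (\sum_(n < N) ((1 + s / r) * p n ^+ 2 + (1 + r / s) * q n ^+ 2))).
  apply: ler_sum => i _; rewrite -subr_ge0.
  have -> : (1 + s / r) * p i ^+ 2 + (1 + r / s) * q i ^+ 2 - (p i + q i) ^+ 2 =
    (s * p i - r * q i) ^+ 2 / (r * s) by field; rewrite rN sN.
  by rewrite divr_ge0 ?sqr_ge0// mulr_ge0.
rewrite big_split/= -!mulr_sumr.
have -> : (r + s) ^+ 2 = (1 + s / r) * r ^+ 2 + (1 + r / s) * s ^+ 2 by field; rewrite rN sN.
by rewrite lerD// ler_wpM2l// addr_ge0// divr_ge0.
Qed.

Lemma ell_ge0 x r : ell x r -> 0 <= r. Proof. by case. Qed.

Lemma ell_le x r s : r <= s -> ell x r -> ell x s.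
Proof.
move=> rs [r0 h]; split; first exact: le_trans rs.
by move=> N; rewrite (le_trans (h N))// ler_pXn2r// ?nnegrE// (le_trans r0).
Qed.

Lemma ell_mono x y r : (forall n, nm (x n) <= nm (y n)) -> ell y r -> ell x r.
Proof.
move=> xy [r0 h]; split=> // N; rewrite (le_trans _ (h N))// ler_sum// => i _.
by rewrite ler_pXn2r// ?nnegrE ?nm_ge0.
Qed.

Lemma ell_add x y r s : ell x r -> ell y s -> ell (fun n => x n + y n) (r + s).
Proof.
move=> [r0 hx] [s0 hy]; split; first exact: addr_ge0.
move=> N; refine (le_trans _ (sqr_sum_add (p := fun n => nm (x n)) (q := fun n => nm (y n)) r0 s0 (hx N) (hy N))).
apply: ler_sum => i _; rewrite ler_pXn2r// ?nnegrE ?addr_ge0 ?nm_ge0//.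
exact: nmD.
Qed.

Lemma ell_scale x r (k : R[i]) : ell x r -> ell (fun n => k * x n) (nm k * r).
Proof.
move=> [r0 hx]; split; first by rewrite mulr_ge0// nm_ge0.
move=> N; rewrite exprMn; under eq_bigr do rewrite nmM exprMn.
by rewrite -mulr_sumr ler_wpM2l// sqr_ge0.
Qed.

Lemma ell_opp x r : ell x r -> ell (fun n => - x n) r.
Proof. by apply: ell_mono => n; rewrite nmN. Qed.

Lemma ell_sub x y r s : ell x r -> ell y s -> ell (fun n => x n - y n) (r + s).
Proof. by move=> hx hy; exact: ell_add hx (ell_opp hy). Qed.

Lemma ell0 r : 0 <= r -> ell (fun=> 0) r.
Proof.
move=> r0; split=> // N; rewrite big1 ?sqr_ge0// => i _.
by rewrite nm0 expr0n.
Qed.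

Lemma ell_pt x r n : ell x r -> nm (x n) <= r.
Proof.
move=> [r0 h]; rewrite -(@ler_pXn2r _ 2)// ?nnegrE ?nm_ge0//.
rewrite (le_trans _ (h n.+1))// big_ord_recr/= lerDr.
by rewrite sumr_ge0// => i _; exact: sqr_ge0.
Qed.

Lemma ell_shift x r : ell x r -> ell (fun n => x n.+1) r.
Proof.
move=> [r0 h]; split=> // N; rewrite (le_trans _ (h N.+1))// big_ord_recl/=.
by rewrite lerDr sqr_ge0.
Qed.

Lemma ell_unshift x r : ell x r -> ell (fun n => if n is m.+1 then x m else 0) r.
Proof.
move=> [r0 h]; split=> // -[|N]; first by rewrite big_ord0 sqr_ge0.
by rewrite big_ord_recl/= nm0 expr0n add0r; exact: h.
Qed.

(** A form of Fatou's lemma: balls are closed under coordinatewise approximation, where [y] may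
    depend on the finite window [N] and on the precision [e]. *)
Lemma ell_lim x r :
  (forall N e, 0 < e -> exists2 y, ell y r & forall n, (n < N)%N -> nm (x n - y n) <= e) ->
  0 <= r -> ell x r.
Proof.
move=> h r0; split=> // N; apply/ler_addgt0Pr => e e0.
pose del := e / ((2 * r + 1) * (N%:R + 1)).
have d0 : 0 < del by rewrite divr_gt0// mulr_gt0// ?ltr_wpDl// ?mulr_ge0.
pose d1 := Num.min del 1.
have d10 : 0 < d1 by rewrite lt_min d0 ltr01.
have [y [_ hy] hxy] := h N (d1 / (N%:R + 1)) (divr_gt0 d10 (ltr_wpDl (ler0n _ _) ltr01)).
have d1N : \sum_(n < N) (nm (x n - y n)) ^+ 2 <= d1 ^+ 2.
  have N1 : 1 <= N%:R + 1 :> R by rewrite lerDr ler0n.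
  apply: (@le_trans _ _ (\sum_(n < N) (d1 / (N%:R + 1)) ^+ 2)).
    by apply: ler_sum => i _; rewrite ler_pXn2r// ?nnegrE ?nm_ge0 ?divr_ge0 ?(le_trans ler01 N1) ?(ltW d10)// hxy.
  rewrite sumr_const card_ord -[leLHS]mulr_natr expr_div_n [leLHS]mulrAC.
  rewrite ler_pdivrMr ?exprn_gt0 ?(lt_le_trans ltr01 N1)// ler_wpM2l ?sqr_ge0//.
  have N0 : 0 <= N%:R :> R by rewrite ler0n.
  nra.
apply: (@le_trans _ _ ((r + d1) ^+ 2)).
  refine (le_trans _ (sqr_sum_add (p := fun n => nm (y n)) (q := fun n => nm (x n - y n)) r0 (ltW d10) (hy N) d1N)).
  apply: ler_sum => i _; rewrite ler_pXn2r// ?nnegrE ?addr_ge0 ?nm_ge0//.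
  by rewrite (le_trans _ (nmD _ _))// addrC subrK.
rewrite sqrrD -addrA lerD2l.
have d11 : d1 <= 1 by rewrite ge_min lexx orbT.
apply: (@le_trans _ _ (d1 * (2 * r + 1))); first by nra.
apply: (@le_trans _ _ (del * (2 * r + 1))).
  by rewrite ler_wpM2r ?addr_ge0 ?mulr_ge0// ge_min lexx.
have r1 : 0 < 2 * r + 1 by rewrite ltr_wpDl// mulr_ge0.
have N1 : 0 < N%:R + 1 :> R by rewrite ltr_wpDl.
have -> : del * (2 * r + 1) = e / (N%:R + 1).
  by rewrite /del; field; rewrite !gt_eqF.
by rewrite ler_pdivrMr// ler_peMr ?(ltW e0)// lerDr.
Qed.

(** A sum of squares of nonnegative terms is at most the square of their sum, here a geometric
    series. *)
Lemma ell_geom x (B q : R) : 0 <= B -> 0 <= q -> q < 1 ->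
  (forall n, nm (x n) <= B * q ^+ n) -> ell x (B / (1 - q)).
Proof.
move=> B0 q0 q1 h; have q10 : 0 < 1 - q by rewrite subr_gt0.
split=> [|N]; first by rewrite divr_ge0// ltW.
have hs : \sum_(n < N) q ^+ n <= (1 - q)^-1.
  rewrite -[leRHS]mul1r ler_pdivlMr// -[q in 1 - q]/q mulrC -opprB mulNr -subrX1 opprB.
  by rewrite gerBl exprn_ge0.
have sq (n : nat) (f : nat -> R) : (forall i, 0 <= f i) ->
    \sum_(i < n) f i ^+ 2 <= (\sum_(i < n) f i) ^+ 2.
  move=> f0; elim: n => [|n IH]; first by rewrite !big_ord0 expr0n.
  rewrite !big_ord_recr/= sqrrD lerD2r (le_trans IH)// lerDl mulrn_wge0// mulr_ge0//.
  exact: sumr_ge0.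
apply: (@le_trans _ _ (\sum_(n < N) (B * q ^+ n) ^+ 2)).
  by apply: ler_sum => i _; rewrite ler_pXn2r// ?nnegrE ?nm_ge0// mulr_ge0// exprn_ge0.
rewrite (le_trans (sq N (fun n => B * q ^+ n) _))//.
  by move=> i; rewrite mulr_ge0// exprn_ge0.
rewrite -mulr_sumr ler_pXn2r ?nnegrE ?mulr_ge0 ?invr_ge0 ?(ltW q10)//.
  by rewrite ler_wpM2l.
by rewrite sumr_ge0// => i _; exact: exprn_ge0.
Qed.

(* Trading a factor [n + 1] for a slightly larger ratio. *)
Lemma succ_geom (q : R) n : 0 <= q -> q < 1 -> n.+1%:R * q ^+ n <= (1 - q)^-1.
Proof.
move=> q0 q1; have q10 : 0 < 1 - q by rewrite subr_gt0.
apply: (@le_trans _ _ (\sum_(i < n.+1) q ^+ i)).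
  have -> : n.+1%:R * q ^+ n = \sum_(i < n.+1) q ^+ n.
    by rewrite sumr_const card_ord mulr_natl.
  apply: ler_sum => i _; apply: ler_wiXn2l => //; first exact: ltW.
  by rewrite -ltnS.
rewrite -[leRHS]mul1r ler_pdivlMr// mulrC -opprB mulNr -subrX1 opprB.
by rewrite gerBl exprn_ge0.
Qed.

Lemma pow_small (q e : R) : 0 <= q -> q < 1 -> 0 < e ->
  exists N, forall n, (N <= n)%N -> q ^+ n < e.
Proof.
move=> q0 q1 e0.
have : (fun n => q ^+ n) @ \oo --> (0 : R) by apply: cvg_expr; rewrite ger0_norm.
move/cvgrPdist_lt => /(_ e e0) [N _ hN]; exists N => n Nn.
by have := hN n Nn; rewrite /= sub0r normrN ger0_norm// exprn_ge0.
Qed.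

Lemma ell_tail x r e : ell x r -> 0 < e ->
  exists N, ell (fun n => if (n < N)%N then 0 else x n) e.
Proof.
move=> [r0 h] e0.
pose u N : R := \sum_(n < N) nm (x n) ^+ 2.
have und : nondecreasing_seq u.
  apply/nondecreasing_seqP => n; rewrite /u big_ord_recr/= lerDl sqr_ge0//.
have ucv : cvgn u.
  apply: nondecreasing_is_cvgn => //; exists (r ^+ 2) => _ [N _ <-]; exact: h.
have /cvgrPdist_lt/(_ (e ^+ 2)) [|N _ hN] := ucv; first by rewrite exprn_gt0.
exists N; split; first exact: ltW.
move=> M; have uM : u M <= limn u by exact: nondecreasing_cvgn_le.
have := hN N (leqnn _); rewrite /= ltr_norml => /andP[_ huN].
have [MN|NM] := leqP M N.
  rewrite big1 ?sqr_ge0// => i _; rewrite (leq_trans (ltn_ord i) MN) nm0 expr0n//.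
have -> : \sum_(n < M) nm (if (n < N)%N then 0 else x n) ^+ 2 = u M - u N.
  have -> : u N = \sum_(n < M) (if (n < N)%N then nm (x n) ^+ 2 else 0).
    by rewrite /u (big_ord_widen M (fun n => nm (x n) ^+ 2)) ?(ltnW NM)// big_mkcond.
  rewrite /u -sumrB; apply: eq_bigr => i _.
  by case: ifP; rewrite ?nm0 ?expr0n/= ?subrr ?subr0.
by rewrite lerBlDr (le_trans uM)// -lerBlDr ltW.
Qed.

End Ell.

(** * Complex differentiability and curve integrals *)

Section GapLimit.
Context {R : realType}.

(* [g] bounds the tails of the increments [d]. *)
Lemma gap_limit (u g d : nat -> R) : (forall k, 0 <= g k) ->
  (forall k, g k.+1 + d k <= g k) -> (forall k, `|u k.+1 - u k| <= d k) ->
  exists s, forall k, `|s - u k| <= g k.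
Proof.
move=> g0 gd hu.
(* The intervals [v k, w k] are nested; the supremum of the left ends lies in all of them. *)
pose v k := u k - g k; pose w k := u k + g k.
have vw k : v k <= w k by rewrite /v /w; have := g0 k; lra.
have vS k : v k <= v k.+1.
  by rewrite /v; have := hu k; rewrite ler_norml => /andP[]; have := gd k; lra.
have wS k : w k.+1 <= w k.
  by rewrite /w; have := hu k; rewrite ler_norml => /andP[]; have := gd k; lra.
have vd k j : v k <= v (k + j)%N by elim: j => [|j]; rewrite ?addn0 ?addnS// => /le_trans; apply.
have wd k j : w (k + j)%N <= w k by elim: j => [|j]; rewrite ?addn0 ?addnS// => /(le_trans _); apply.
have vwj k j : v j <= w k.
  rewrite (le_trans (vd j k))// (le_trans (vw _))// addnC; exact: wd.
have hs : has_sup (range v).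
  by split; [exists (v 0); exists 0|exists (w 0) => _ [j _ <-]].
exists (sup (range v)) => k; rewrite ler_norml; apply/andP; split.
  have : v k <= sup (range v) by apply: ub_le_sup; [exact: (proj2 hs)|exists k].
  by rewrite /v; lra.
have : sup (range v) <= w k by apply: ge_sup; [exact: (proj1 hs)|move=> _ [j _ <-]].
by rewrite /w; lra.
Qed.

Lemma gap_limitC (u : nat -> R[i]) (g d : nat -> R) : (forall k, 0 <= g k) ->
  (forall k, g k.+1 + d k <= g k) -> (forall k, nm (u k.+1 - u k) <= d k) ->
  exists s, forall k, nm (s - u k) <= 2 * g k.
Proof.
move=> g0 gd hu.
have [x hx] : exists s, forall k, `|s - complex.Re (u k)| <= g k.
  apply: (@gap_limit (fun k => complex.Re (u k)) g d g0 gd) => k.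
  by rewrite -cReN -cReD (le_trans (Re_le_nm _)).
have [y hy] : exists s, forall k, `|s - complex.Im (u k)| <= g k.
  apply: (@gap_limit (fun k => complex.Im (u k)) g d g0 gd) => k.
  by rewrite -cImN -cImD (le_trans (Im_le_nm _)).
exists (Complex x y) => k.
rewrite (le_trans (nm_le_ReIm _))// cReD cImD cReN cImN /= mulr_natl mulr2n.
exact: lerD.
Qed.

End GapLimit.

(** * Complex differentiability and continuity with real epsilons *)

Section Differentiable.
Context {R : realType}.
Local Notation C := R[i].

(** Radii of balls in [C^o] are themselves complex numbers, positive exactly when real and positive.
    They are traded here for real radii. *)
Lemma nearC (z : C^o) (P : set C^o) :
  (\forall y \near z, P y) <-> exists2 d : R, 0 < d & forall y, nm (y - z) < d -> P y.
Proof.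
split=> [/nbhs_ballP[e /= e0 he]|[d d0 hd]].
  move: e0; rewrite ltcE /= => /andP[/eqP eI eR].
  exists (complex.Re e) => // y hy; apply: he.
  rewrite -ball_normE /= distrC nmE ltcE /= eI eqxx//.
apply/nbhs_ballP; exists d%:C%C; first by rewrite /= ltcE /= eqxx.
move=> y; rewrite -ball_normE /= distrC nmE ltcR; exact: hd.
Qed.

Definition lin_approx (F : C -> C) (z d : C) := forall e : R, 0 < e ->
  exists2 del : R, 0 < del & forall y, nm (y - z) < del ->
    nm (F y - F z - d * (y - z)) <= e * nm (y - z).

Definition zcont (F : C -> C) (z : C) := forall e : R, 0 < e ->
  exists2 del : R, 0 < del & forall y, nm (y - z) < del -> nm (F y - F z) <= e.

Local Notation cder F z := (derivable (F : C^o -> C^o) z 1).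

Lemma derivable_lin F z : cder F z <-> exists d, lin_approx F z d.
Proof.
split.
  move=> /cvg_ex[/= d /cvgrPdist_le hd]; exists d => e e0.
  have e0' : 0 < e%:C%C :> C by rewrite ltcR.
  have := hd _ e0'; rewrite near_withinE => /nearC[del del0 hdel].
  exists del => // y hy.
  have [->|yz] := eqVneq y z; first by rewrite !subrr mulr0 subrr nm0 mulr0.
  have yz0 : y - z != 0 by rewrite subr_eq0.
  have := hdel (y - z); rewrite subr0 => /(_ hy yz0) /=.
  rewrite /shift /= /GRing.scale /= mulr1 subrK nmE lecR => h.
  have -> : F y - F z - d * (y - z) = - (d - (y - z)^-1 * (F y - F z)) * (y - z).
    by field.
  by rewrite nmM nmN ler_wpM2r// nm_ge0.
move=> [d hd]; apply/cvg_ex; exists d; apply/cvgrPdist_le => e.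
rewrite ltcE /= => /andP[/eqP eI eR].
have [del del0 hdel] := hd _ eR.
rewrite near_withinE; apply/nearC; exists del => // h; rewrite subr0 => hh h0.
have := hdel (h + z); rewrite addrK => /(_ hh).
rewrite /shift /= /GRing.scale /= mulr1 nmE lecE /= -eI eqxx /= => H.
have -> : d - h^-1 * (F (h + z) - F z) = - (F (h + z) - F z - d * h) / h by field.
by rewrite nmM nmN nmV ler_pdivrMr ?nm_gt0.
Qed.

Lemma derivable_zcont F z : cder F z -> zcont F z.
Proof.
move=> /derivable_lin[d hd] e e0.
have [del del0 hdel] := hd 1 ltr01.
have D0 : 0 < nm d + 1 by rewrite ltr_wpDl// nm_ge0.
exists (Num.min del (e / (nm d + 1))); first by rewrite lt_min del0 divr_gt0.
move=> y; rewrite lt_min => /andP[h1 h2].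
have := hdel y h1; rewrite mul1r => h.
have -> : F y - F z = (F y - F z - d * (y - z)) + d * (y - z) by rewrite subrK.
rewrite (le_trans (nmD _ _))// nmM.
move: h2; rewrite ltr_pdivlMr// => h2; nra.
Qed.

Definition ccont (h : R -> C) (x : R) := forall e : R, 0 < e ->
  exists2 del : R, 0 < del & forall y, `|y - x| < del -> nm (h y - h x) <= e.

Lemma zcont_comp F (h : R -> C) x : ccont h x -> zcont F (h x) -> ccont (fun y => F (h y)) x.
Proof.
move=> hh hF e e0; have [d1 d10 h1] := hF e e0.
have d12 : 0 < d1 / 2 by rewrite divr_gt0.
have [d2 d20 h2] := hh _ d12; exists d2 => // y /h2 hy; apply: h1; lra.
Qed.

Lemma ccontD h k x : ccont h x -> ccont k x -> ccont (fun y => h y + k y) x.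
Proof.
move=> hh hk e e0; have e2 : 0 < e / 2 by rewrite divr_gt0.
have [d1 d10 h1] := hh _ e2; have [d2 d20 h2] := hk _ e2.
exists (Num.min d1 d2); first by rewrite lt_min d10.
move=> y; rewrite lt_min => /andP[/h1 hy1 /h2 hy2].
rewrite opprD addrACA (le_trans (nmD _ _))//; lra.
Qed.

Lemma ccont_cst (k : C) x : ccont (fun=> k) x.
Proof. by move=> e e0; exists 1 => // y _; rewrite subrr nm0 ltW. Qed.

Lemma ccontM h k x : ccont h x -> ccont k x -> ccont (fun y => h y * k y) x.
Proof.
move=> hh hk e e0.
pose A := nm (h x) + nm (k x) + 1.
have hx := nm_ge0 (h x); have kx := nm_ge0 (k x).
have A1 : 1 <= A by rewrite /A; lra.
have A0 : 0 < A by lra.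
pose e1 := Num.min 1 (e / (2 * A)).
have e10 : 0 < e1 by rewrite lt_min ltr01 divr_gt0// mulr_gt0.
have e11 : e1 <= 1 by rewrite ge_min lexx.
have e1A : e1 * (2 * A) <= e by rewrite -ler_pdivlMr ?mulr_gt0// ge_min lexx orbT.
have [d1 d10 h1] := hh _ e10; have [d2 d20 h2] := hk _ e10.
exists (Num.min d1 d2); first by rewrite lt_min d10.
move=> y; rewrite lt_min => /andP[/h1 hy1 /h2 hy2].
have -> : h y * k y - h x * k x = (h y - h x) * (k y - k x) +
  ((h y - h x) * k x + h x * (k y - k x)) by ring.
rewrite (le_trans (nmD _ _))//.
have h3 : nm ((h y - h x) * (k y - k x)) <= e1 * A.
  rewrite nmM; have := nm_ge0 (h y - h x); have := nm_ge0 (k y - k x); nra.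
have h4 : nm ((h y - h x) * k x + h x * (k y - k x)) <= e1 * A.
  rewrite (le_trans (nmD _ _))// !nmM /A.
  have := nm_ge0 (h y - h x); have := nm_ge0 (k y - k x); nra.
by lra.
Qed.

Lemma ccont_lip h x (L : R) : (forall y, nm (h y - h x) <= L * `|y - x|) -> ccont h x.
Proof.
move=> hL e e0; pose L' := `|L| + 1.
have L0 : 0 < L' by rewrite ltr_wpDl.
exists (e / L'); first by rewrite divr_gt0.
move=> y; rewrite ltr_pdivlMr// => hy; rewrite (le_trans (hL y))//.
rewrite (le_trans _ (ltW hy))// mulrC ler_wpM2l// /L' (le_trans (ler_norm _))// lerDl//.
Qed.

Lemma ccont_Re h x : ccont h x -> {for x, continuous (fun y => complex.Re (h y))}.
Proof.
move=> hh; apply/cvgrPdist_le => e e0.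
have [d d0 hd] := hh e e0.
apply/nbhs_ballP; exists d => // y /=; rewrite distrC => /hd hy.
by rewrite distrC -cReN -cReD (le_trans (Re_le_nm _)).
Qed.

Lemma ccont_Im h x : ccont h x -> {for x, continuous (fun y => complex.Im (h y))}.
Proof.
move=> hh; apply/cvgrPdist_le => e e0.
have [d d0 hd] := hh e e0.
apply/nbhs_ballP; exists d => // y /=; rewrite distrC => /hd hy.
by rewrite distrC -cImN -cImD (le_trans (Im_le_nm _)).
Qed.

End Differentiable.

Notation cder F z := (derivable (F : _^o -> _^o) z 1).

(** * Integrals and derivatives of complex-valued functions of a real variable *)

Section CurveIntegral.
Context {R : realType}.
Local Notation C := R[i].
Local Notation mu := (@lebesgue_measure R).

Definition cint (a b : R) (h : R -> C) : C :=
  Complex (\int[mu]_(x in `[a, b]) complex.Re (h x)) (\int[mu]_(x in `[a, b]) complex.Im (h x)).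

Definition contab (a b : R) (h : R -> C) := forall x, a <= x <= b -> ccont h x.

Lemma contab_Re a b h : contab a b h ->
  {within `[a, b], continuous (fun y => complex.Re (h y))}.
Proof.
move=> hh; apply: continuous_in_subspaceT => x /set_mem /=; rewrite in_itv /= => xab.
by apply: ccont_Re; exact: hh.
Qed.

Lemma contab_Im a b h : contab a b h ->
  {within `[a, b], continuous (fun y => complex.Im (h y))}.
Proof.
move=> hh; apply: continuous_in_subspaceT => x /set_mem /=; rewrite in_itv /= => xab.
by apply: ccont_Im; exact: hh.
Qed.

Lemma int_Re a b h : contab a b h -> mu.-integrable `[a, b] (EFin \o (fun y => complex.Re (h y))).
Proof.
move=> hh; apply: continuous_compact_integrable; first exact: segment_compact.
exact: contab_Re.
Qed.

Lemma int_Im a b h : contab a b h -> mu.-integrable `[a, b] (EFin \o (fun y => complex.Im (h y))).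
Proof.
move=> hh; apply: continuous_compact_integrable; first exact: segment_compact.
exact: contab_Im.
Qed.

Lemma cint_eq a b h k : (forall x, a <= x <= b -> h x = k x) -> cint a b h = cint a b k.
Proof.
move=> hk; rewrite /cint; congr Complex; apply: eq_Rintegral => x /set_mem /=;
  by rewrite in_itv/= => /hk ->.
Qed.

Lemma cintD a b h k : contab a b h -> contab a b k ->
  cint a b (fun x => h x + k x) = cint a b h + cint a b k.
Proof.
move=> hh hk; apply: complex_eq; rewrite ?cReD ?cImD /cint /=.
  rewrite -RintegralD//; [|exact: int_Re|exact: int_Re].
  by apply: eq_Rintegral => x _; rewrite cReD.
rewrite -RintegralD//; [|exact: int_Im|exact: int_Im].
by apply: eq_Rintegral => x _; rewrite cImD.
Qed.

Lemma cintZ a b (k : C) h : contab a b h -> cint a b (fun x => k * h x) = k * cint a b h.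
Proof.
move=> hh; have iR := int_Re hh; have iI := int_Im hh.
have sc (r : R) (f : R -> R) : mu.-integrable `[a, b] (EFin \o f) ->
    mu.-integrable `[a, b] (EFin \o (fun x => r * f x)).
  move=> hf; have mD : measurable (`[a, b] : set (measurableTypeR R)) by exact: measurable_itv.
  have h1 := integrableZl mD r hf.
  by apply: eq_integrable h1 => // x _; rewrite /= EFinM.
apply: complex_eq; [rewrite [in RHS]cReM|rewrite [in RHS]cImM]; rewrite /cint /=.
  rewrite -!RintegralZl// -RintegralB//; [|exact: sc|exact: sc].
  by apply: eq_Rintegral => x _; rewrite cReM.
rewrite -!RintegralZl// -RintegralD//; [|exact: sc|exact: sc].
by apply: eq_Rintegral => x _; rewrite cImM.
Qed.

Lemma cint_split a b m h : a <= m <= b -> contab a b h ->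
  cint a b h = cint a m h + cint m b h.
Proof.
move=> /andP[am mb] hh.
have main (f : R -> R) : mu.-integrable `[a, b] (EFin \o f) ->
    \int[mu]_(x in `[a, b]) f x = \int[mu]_(x in `[a, m]) f x + \int[mu]_(x in `[m, b]) f x.
  move=> hf; have := @Rintegral_itvB _ f (BLeft a) (BRight b) m hf.
  rewrite !bnd_simp => /(_ am mb) h0; rewrite -(Rintegral_itv_obnd_cbnd (r := m)).
    by rewrite -h0 addrC subrK.
  apply: integrableS hf => //; apply: subset_itvr; by rewrite bnd_simp.
apply: complex_eq; rewrite ?cReD ?cImD /cint /=; apply: main; [exact: int_Re|exact: int_Im].
Qed.

(** The factor 2 comes from estimating real and imaginary parts separately; later uses only ask for
    the order of magnitude. *)
Lemma cint_bound a b h (M : R) : a <= b -> contab a b h ->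
  (forall x, a <= x <= b -> nm (h x) <= M) -> nm (cint a b h) <= 2 * M * (b - a).
Proof.
move=> ab hh hM.
have main (f : R -> R) : mu.-integrable `[a, b] (EFin \o f) ->
    (forall x, a <= x <= b -> `|f x| <= M) -> `|\int[mu]_(x in `[a, b]) f x| <= M * (b - a).
  move=> hf fM; rewrite (le_trans (le_normr_Rintegral _ hf))//.
  have -> : M * (b - a) = \int[mu]_(x in `[a, b]) M.
    by rewrite Rintegral_cst//= lebesgue_measure_itv/= lte_fin; case: ltgtP ab => // ->; rewrite subrr.
  apply: le_Rintegral => //=.
  - exact: integrable_norm.
  - apply: continuous_compact_integrable; first exact: segment_compact.
    by apply: continuous_subspaceT => x; exact: cst_continuous.
rewrite (le_trans (nm_le_ReIm _))// /cint /= -mulrA mulr_natl mulr2n lerD//.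
  by apply: main => [|x /hM]; [exact: int_Re|apply: le_trans; exact: Re_le_nm].
by apply: main => [|x /hM]; [exact: int_Im|apply: le_trans; exact: Im_le_nm].
Qed.

Definition cd (h : R -> C) (x : R) (d : C) :=
  is_derive x 1 (fun y => complex.Re (h y)) (complex.Re d) /\
  is_derive x 1 (fun y => complex.Im (h y)) (complex.Im d).

Lemma cdM h k x dh dk : cd h x dh -> cd k x dk ->
  cd (fun y => h y * k y) x (dh * k x + h x * dk).
Proof.
move=> [hr hi] [kr ki]; split.
  rewrite (_ : (fun y => complex.Re (h y * k y)) =
    (fun y => complex.Re (h y)) * (fun y => complex.Re (k y)) -
    (fun y => complex.Im (h y)) * (fun y => complex.Im (k y))); last first.
    by apply/funext => y; rewrite cReM.
  apply: is_derive_eq; rewrite cReD !cReM /GRing.scale /=; ring.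
rewrite (_ : (fun y => complex.Im (h y * k y)) =
  (fun y => complex.Re (h y)) * (fun y => complex.Im (k y)) +
  (fun y => complex.Im (h y)) * (fun y => complex.Re (k y))); last first.
  by apply/funext => y; rewrite cImM.
have d := is_deriveD (is_deriveM hr ki) (is_deriveM hi kr).
apply: (is_derive_eq d); rewrite cImD !cImM /GRing.scale /=; ring.
Qed.

Lemma cd_cst (k : C) x : cd (fun=> k) x 0.
Proof. by split; exact: is_derive_cst. Qed.

Lemma cint_FTC a b W w : a < b -> (forall x, a <= x <= b -> cd W x (w x)) ->
  contab a b w -> cint a b w = W b - W a.
Proof.
move=> ab hW hw.
have main (F f : R -> R) : (forall x, a <= x <= b -> is_derive x 1 F (f x)) ->
    {within `[a, b], continuous f} -> \int[mu]_(x in `[a, b]) f x = F b - F a.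
  move=> hF cf; have cF x : a <= x <= b -> {for x, continuous F}.
    by move=> /hF hx; apply: differentiable_continuous; apply/derivable1_diffP; case: hx.
  have Faa : a <= a <= b by rewrite lexx ltW.
  have Fbb : a <= b <= b by rewrite lexx ltW.
  rewrite /Rintegral (@continuous_FTC2 _ f F a b)//.
    split.
    - by move=> x; rewrite in_itv/= => /andP[/ltW ax /ltW xb]; have [] := hF x; rewrite ?ax.
    - by apply: cvg_at_right_filter; exact: cF.
    - by apply: cvg_at_left_filter; exact: cF.
  move=> x; rewrite in_itv/= => /andP[/ltW ax /ltW xb]; rewrite derive1E.
  by have hx := hF x; rewrite ax xb in hx; have [_ ->] := hx isT.
apply: complex_eq; rewrite ?cReD ?cImD ?cReN ?cImN /cint /=.
  apply: (main (fun x => complex.Re (W x)) (fun x => complex.Re (w x))); last exact: contab_Re.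
  by move=> x /hW [].
apply: (main (fun x => complex.Im (W x)) (fun x => complex.Im (w x))); last exact: contab_Im.
by move=> x /hW [].
Qed.

End CurveIntegral.

(** * Powers of one half *)

Section Halving.
Context {R : realType}.
Local Notation h2 := (2^-1 : R).

Lemma h2_gt0 k : 0 < h2 ^+ k. Proof. by rewrite exprn_gt0. Qed.

Lemma h2S k : h2 ^+ k = 2 * h2 ^+ k.+1.
Proof. by rewrite exprS mulrA divff// mul1r. Qed.

Lemma small_h2 (e : R) : 0 < e -> exists N, forall n, (N <= n)%N -> h2 ^+ n < e.
Proof. by move=> e0; apply: pow_small => //; lra. Qed.

Lemma le_small_h2 (x y K : R) : (forall k, x <= y + K * h2 ^+ k) -> x <= y.
Proof.
move=> h; apply/ler_addgt0Pr => e e0.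
have K1 : 0 < `|K| + 1 by rewrite ltr_wpDl.
have [N hN] := small_h2 (divr_gt0 e0 K1).
rewrite (le_trans (h N))// lerD2l.
have := ltW (hN N (leqnn N)); rewrite ler_pdivlMr// mulrC; apply: le_trans.
by rewrite ler_wpM2r ?(ltW (h2_gt0 _))// (le_trans (ler_norm K))// lerDl.
Qed.

End Halving.

(** * Eigenvectors of the Jacobi matrix *)

Section Recurrence.
Context {R : realType}.

(** The pair holds the current and the previous term of a three-term recurrence. The ring is
    arbitrary because the recurrence is run over numbers and, for Taylor expansions in [s], over
    polynomials. *)
Fixpoint rec_pair (K : pzRingType) (kap : nat -> K) (s : K) (n : nat) : K * K :=
  if n is m.+1 then
    let p := rec_pair kap s m in (s * p.1 - kap m * p.2, p.1)
  else (1, 0).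

Definition rec_seq (K : pzRingType) (kap : nat -> K) (s : K) n := (rec_pair kap s n).1.

Lemma rec_seq0 (K : pzRingType) (kap : nat -> K) s : rec_seq kap s 0 = 1.
Proof. by []. Qed.

Lemma rec_seq1 (K : pzRingType) (kap : nat -> K) s : rec_seq kap s 1 = s.
Proof. by rewrite /rec_seq /= mulr1 mulr0 subr0. Qed.

Lemma rec_seqSS (K : pzRingType) (kap : nat -> K) s n :
  rec_seq kap s n.+2 = s * rec_seq kap s n.+1 - kap n.+1 * rec_seq kap s n.
Proof. by []. Qed.

Lemma rec_ind2 (P : nat -> Prop) :
  P 0 -> P 1 -> (forall n, P n -> P n.+1 -> P n.+2) -> forall n, P n.
Proof.
move=> h0 h1 h n; suff: P n /\ P n.+1 by case.
by elim: n => [//|n [hn hn1]]; split=> //; exact: h.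
Qed.

Lemma rec_seq_morph (K L : pzRingType) (f : {rmorphism K -> L}) kap s n :
  f (rec_seq kap s n) = rec_seq (fun k => f (kap k)) (f s) n.
Proof.
elim/rec_ind2 : n => [||n h0 h1]; rewrite ?rec_seq0 ?rec_seq1 ?rmorph1//.
by rewrite !rec_seqSS rmorphB !rmorphM h0 h1.
Qed.

(** The ratio is at most [B] for the first [n0] steps and at most [th] afterwards; the factor (B /
    th)^n0 pays for the early steps. *)
Lemma geo_eventually (N : nat -> R) (th B : R) n0 : 0 < th -> th <= B -> 0 <= N 0 ->
  (forall n, N n.+1 <= B * N n) -> (forall n, (n0 <= n)%N -> N n.+1 <= th * N n) ->
  forall n, N n <= (B / th) ^+ n0 * N 0 * th ^+ n.
Proof.
move=> th0 thB N0 hB hth n.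
have Bth : 1 <= B / th by rewrite ler_pdivlMr// mul1r.
suff h : N n <= (B / th) ^+ (minn n n0) * N 0 * th ^+ n.
  rewrite (le_trans h)// ler_wpM2r ?exprn_ge0 ?(ltW th0)// ler_wpM2r//.
  by apply: ler_weXn2l => //; exact: geq_minr.
elim: n => [|n IH]; first by rewrite min0n !expr0 mul1r mulr1.
have [nn0|nn0] := leqP n0 n.
  move: IH; rewrite (minn_idPr nn0) (minn_idPr (leqW nn0)) => IH.
  rewrite (le_trans (hth _ nn0))// exprS [leRHS]mulrCA -mulrA mulrCA.
  by rewrite -[leRHS]mulrCA ler_wpM2l ?(ltW th0)// mulrA.
move: IH; rewrite (minn_idPl (ltnW nn0)) (minn_idPl nn0) => IH.
rewrite (le_trans (hB _))//.
have B0 : 0 <= B by rewrite (le_trans (ltW th0)).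
rewrite (le_trans (ler_wpM2l B0 IH))//.
have -> // : B * ((B / th) ^+ n * N 0 * th ^+ n) = (B / th) ^+ n.+1 * N 0 * th ^+ n.+1.
by rewrite !exprS; field; rewrite gt_eqF.
Qed.

(** The combination q + kp * p is followed, where th = t + 2 kp and kp^2 = (th - t)^2 / 4 is the
    weight of the last term. The influence of [q] on [p] costs one kp, and the remaining terms fit
    into the second one as soon as g / (n + 2) <= kp^2. The rate is then [th]; the finitely many
    earlier steps only enlarge the constant. *)
Lemma growth (t th g : R) : 0 <= t -> t < th -> th <= 1 -> 0 <= g ->
  exists2 C, 0 <= C & forall p q : nat -> R,
    (forall n, 0 <= p n) -> (forall n, 0 <= q n) -> p 0 <= 1 -> q 0 <= 2 ->
    (forall n, p n.+1 <= t * p n + q n) ->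
    (forall n, q n.+1 <= t * q n + g / n.+2%:R * p n + (th - t) ^+ 2 / 4 * p n.+1) ->
    forall n, p n <= C * th ^+ n.
Proof.
move=> t0 tth th1 g0.
pose kp := (th - t) / 2; pose rho := (th - t) ^+ 2 / 4.
have kp0 : 0 < kp by rewrite divr_gt0// subr_gt0.
have rho0 : 0 < rho by rewrite divr_gt0// exprn_gt0// subr_gt0.
have rhokp : rho = kp ^+ 2 by rewrite /rho /kp; field.
have kp1 : kp <= 1 / 2 by rewrite /kp; lra.
have rhole : rho <= kp / 2 by rewrite rhokp; nra.
have thE : th = t + kp + kp by rewrite /kp; field.
(* A crude ratio valid at every step: kp * B = 3 * kp + g + 1 dominates the coefficient of [p]. *)
pose B := 3 + (g + 1) / kp.
have kB : kp * B = 3 * kp + g + 1 by rewrite /B; field; rewrite gt_eqF.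
have B3 : 3 <= B by rewrite lerDl divr_ge0 ?addr_ge0// ltW.
have [n0 hn0] : exists n0, forall n, (n0 <= n)%N -> g / n.+2%:R <= rho.
  exists (Num.bound (g / rho)) => n hn.
  rewrite ler_pdivrMr// mulrC -ler_pdivrMr//.
  have grho : 0 <= g / rho by rewrite divr_ge0// ltW.
  rewrite (le_trans (ltW (archi_boundP grho)))// ler_nat (leq_trans hn)//.
  by rewrite -addn2 leq_addr.
exists ((B / th) ^+ n0 * 3 / kp).
  rewrite divr_ge0 ?(ltW kp0)// mulr_ge0// exprn_ge0// divr_ge0; lra.
move=> p q p0 q0 p01 q02 hp hq n.
pose N n := q n + kp * p n.
have N0 : 0 <= N 0 by rewrite addr_ge0// mulr_ge0// ltW.
have N3 : N 0 <= 3 by rewrite /N; nra.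
have th0 : 0 < th by lra.
have NE m : N m = q m + kp * p m by [].
have step m : N m.+1 <= (t + rho + kp) * q m + (g / m.+2%:R + rho * t + kp * t) * p m.
  rewrite /N (le_trans (lerD (hq m) (ler_wpM2l (ltW kp0) (hp m))))//.
  rewrite -/rho; have := ler_wpM2l (ltW rho0) (hp m).
  by set e := g / _; lra.
have hN : N n <= (B / th) ^+ n0 * N 0 * th ^+ n.
  apply: geo_eventually => // [||m hm]; first lra.
  - move=> m; rewrite (le_trans (step m))// [in leRHS](NE m) mulrDr mulrA [B * kp]mulrC kB.
    have gm : g / m.+2%:R <= g by rewrite ler_pdivrMr// ler_peMr// ler1n.
    apply: lerD; first by rewrite ler_wpM2r// (le_trans _ B3)//; lra.
    rewrite ler_wpM2r//.
    have rt : rho * t <= rho by rewrite ler_piMr ?(ltW rho0)//; lra.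
    have kt : kp * t <= kp by rewrite ler_piMr ?(ltW kp0)//; lra.
    move: gm; set e := g / _ => gm; clearbody e rho kp; lra.
  - rewrite (le_trans (step m))// [in leRHS](NE m) mulrDr.
    apply: lerD; first by rewrite ler_wpM2r//; clearbody rho kp; lra.
    rewrite mulrA ler_wpM2r//; have := hn0 m hm.
    have -> : th * kp = kp * t + 2 * kp ^+ 2 by rewrite thE; ring.
    have rt : rho * t <= rho by rewrite ler_piMr ?(ltW rho0)//; lra.
    rewrite -rhokp; set e := g / _ => he; clearbody e rho kp; lra.
have kpN : kp * p n <= N n by rewrite lerDr.
have : kp * p n <= (B / th) ^+ n0 * 3 * th ^+ n.
  rewrite (le_trans kpN)// (le_trans hN)// ler_wpM2r ?exprn_ge0 ?(ltW th0)//.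
  by rewrite ler_wpM2l// exprn_ge0// divr_ge0; lra.
rewrite mulrC -ler_pdivlMr// => h; rewrite (le_trans h)//.
by rewrite mulrAC.
Qed.

End Recurrence.

(** * Roots of the characteristic polynomial of the limiting recurrence *)

Section Schur.
Context {R : realType}.

(* If [s = om + gam * conj om], the roots [w], [v] of [X^2 - s X + gam] satisfy
   [w (1 - |v|^2) + v (1 - |w|^2) = (1 - |gam|^2) om]. *)
Lemma root_bound (om gam w v : R[i]) (eta : R) :
  nm gam < 1 -> eta < 1 -> nm om <= eta -> nm v <= nm w ->
  w + v = om + gam * conjc om -> w * v = gam ->
  nm w <= 1 - (1 - nm gam) * (1 - eta) / 2.
Proof.
move=> g1 eta1 ometa vw hs hp.
have xy : nm w * nm v = nm gam by rewrite -nmM hp.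
have x0 := nm_ge0 w; have y0 := nm_ge0 v; have g0 := nm_ge0 gam.
have key : w * (1 - nm v ^+ 2)%:C%C + v * (1 - nm w ^+ 2)%:C%C =
    (1 - nm gam ^+ 2)%:C%C * om.
  have hs' : conjc w + conjc v = conjc om + conjc gam * om.
    by rewrite -cjD hs cjD cjM conjcK.
  rewrite !rcB !rmorph1 -!mul_conj -hp cjM.
  have e1 : om = w + v - w * v * conjc om by rewrite hs hp; ring.
  have e2 : conjc om = conjc w + conjc v - conjc w * conjc v * om.
    by rewrite hs' -hp cjM; ring.
  rewrite mulrBl mul1r [X in _ = X - _]e1.
  by rewrite e2; ring.
have v1 : 0 <= 1 - nm v ^+ 2 by nra.
have R1 : nm ((1 - nm gam ^+ 2)%:C%C * om) <= (1 - nm gam ^+ 2) * eta.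
  by rewrite nmM nm_pos ?ler_wpM2l//; nra.
have L1 : nm w * (1 - nm v ^+ 2) - nm v * `|1 - nm w ^+ 2| <=
    nm ((1 - nm gam ^+ 2)%:C%C * om).
  rewrite -key -[X in _ <= nm (_ + X)]opprK (le_trans _ (nm_sub_ge _ _))//.
  by rewrite nmN !nmM (nm_pos v1) nmR.
(* If |w| >= 1, the left side of [L1] is (|w| + |v|)(1 - |gam|). Hence |w| + |v| < 1 + |w||v|, that
   is (1 - |w|)(1 - |v|) > 0, against |v| < 1 <= |w|. *)
have [w1|w1] := leP 1 (nm w).
  move: L1; rewrite ler0_norm ?subr_le0; last by nra.
  move=> L1; exfalso.
  have y1 : nm v < 1 by nra.
  have : (nm w + nm v) * (1 - nm gam) <= (1 - nm gam) * ((1 + nm gam) * eta).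
    by rewrite -xy in R1 L1 *; nra.
  rewrite mulrC ler_pM2l ?subr_gt0// => h.
  have : nm w + nm v < 1 + nm gam by nra.
  by rewrite -xy; nra.
move: L1; rewrite ger0_norm ?subr_ge0; last by nra.
move=> L1.
(* Now the left side of [L1] is (|w| - |v|)(1 + |gam|), so |w| - |v| <= (1 - |gam|) eta. This gives
   (1 - |w|)(1 + |v|) >= (1 - |gam|)(1 - eta), and 1 + |v| <= 2. *)
have : (1 + nm gam) * (nm w - nm v) <= (1 + nm gam) * ((1 - nm gam) * eta).
  by rewrite -xy in R1 L1 *; nra.
rewrite ler_pM2l; last by lra.
move=> h.
have y1 : nm v <= 1 by lra.
have : (1 - nm w) * (1 + nm v) >= (1 - nm gam) * (1 - eta) by rewrite -xy in h *; nra.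
by nra.
Qed.

Lemma quad_roots (s gam : R[i]) : exists w v : R[i], [/\ w + v = s, w * v = gam & nm v <= nm w].
Proof.
pose d := sqrtc (s ^+ 2 - 4 * gam).
have dd : d ^+ 2 = s ^+ 2 - 4 * gam by rewrite sqr_sqrtc.
have e1 : (s + d) / 2 + (s - d) / 2 = s by field.
have e2 : (s + d) / 2 * ((s - d) / 2) = gam.
  have -> : (s + d) / 2 * ((s - d) / 2) = (s ^+ 2 - d ^+ 2) / 4 by field.
  by rewrite dd; field.
have [h|/ltW h] := leP (nm ((s - d) / 2)) (nm ((s + d) / 2)).
  by exists ((s + d) / 2), ((s - d) / 2).
exists ((s - d) / 2), ((s + d) / 2); split=> //; first by rewrite addrC.
by rewrite mulrC.
Qed.

End Schur.

(** * The tridiagonal matrix and the Taylor expansion of its eigenvectors *)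

Section BergmanMatrix.
Context {R : realType}.
Implicit Types (x y : nat -> R[i]) (r e : R).

Definition sqn (n : nat) : R := Num.sqrt n.+1%:R.

Definition wt (n : nat) : R := sqn n / sqn n.+1.

(* The matrix of the Toeplitz operator with symbol [a conj z + b + c z] in the
   orthonormal basis [sqrt (n + 1) z ^ n]. *)
Definition jac (a b c : R[i]) x (n : nat) : R[i] :=
  a * (wt n)%:C%C * x n.+1 + b * x n + c * (if n is m.+1 then (wt m)%:C%C * x m else 0).

(** For n > 0 this is gam * wt (n - 1)^2. Putting x n = sqn n * p n in the eigenvalue equation
    removes the square roots and leaves p (n + 1) = s p n - kap n p (n - 1). *)
Definition kap (gam : R[i]) (n : nat) : R[i] := gam * (n%:R / n.+1%:R).

Definition ev (gam s : R[i]) (n : nat) : R[i] := (sqn n)%:C%C * rec_seq (kap gam) s n.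

Lemma sqn_gt0 n : 0 < sqn n. Proof. by rewrite sqrtr_gt0 ltr0n. Qed.

Lemma sqn_neq0 n : (sqn n)%:C%C != 0 :> R[i].
Proof. by rewrite rc_eq0 gt_eqF// sqn_gt0. Qed.

Lemma sqn_sqr n : sqn n ^+ 2 = n.+1%:R. Proof. by rewrite sqr_sqrtr. Qed.

Lemma sqn_sqrC n : (sqn n)%:C%C ^+ 2 = n.+1%:R :> R[i].
Proof. by rewrite -rcX sqn_sqr rc_nat. Qed.

Lemma sqn_le n : sqn n <= n.+1%:R.
Proof.
rewrite -(@ler_pXn2r _ 2)// ?nnegrE ?(ltW (sqn_gt0 _))// sqn_sqr expr2.
by rewrite ler_peMr// ler1n.
Qed.

Lemma wt_ge0 n : 0 <= wt n. Proof. by rewrite divr_ge0// ltW// sqn_gt0. Qed.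

Lemma wt_le1 n : wt n <= 1.
Proof.
rewrite ler_pdivrMr ?sqn_gt0// mul1r ler_sqrt ?ltr0n//.
by rewrite ler_nat.
Qed.

Lemma wt_sqnS n : (wt n)%:C%C * (sqn n.+1)%:C%C = (sqn n)%:C%C :> R[i].
Proof. by rewrite -rcM /wt divfK// gt_eqF// sqn_gt0. Qed.

Lemma wt_sqn n : (wt n)%:C%C * (sqn n)%:C%C =
  (sqn n.+1)%:C%C * (n.+1%:R / n.+2%:R) :> R[i].
Proof.
rewrite /wt rcM rcV -(sqn_sqrC n) -(sqn_sqrC n.+1).
by field; exact: sqn_neq0.
Qed.

Lemma ev0 gam s : ev gam s 0 = 1.
Proof. by rewrite /ev rec_seq0 mulr1 /sqn sqrtr1. Qed.

Lemma jac_ev a b c s n : a != 0 ->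
  jac a b c (ev (c / a) s) n = (b + a * s) * ev (c / a) s n.
Proof.
move=> a0; case: n => [|n]; rewrite /jac.
  rewrite /ev rec_seq0 rec_seq1 mulr0 addr0 -[X in X + _]mulrA mulrA.
  rewrite -[X in X + _]mulrA [X in a * X]mulrA wt_sqnS.
  ring.
rewrite /ev -[a * _ * _]mulrA [(wt n.+1)%:C%C * (_ * _)]mulrA wt_sqnS.
rewrite [(wt n)%:C%C * (_ * _)]mulrA wt_sqn rec_seqSS.
have n2 : 2 + n%:R != 0 :> R[i] by rewrite -natrD pnatr_eq0.
by rewrite /kap; field; rewrite a0 n2.
Qed.

Lemma ell_jac a b c x r : ell x r -> ell (jac a b c x) ((nm a + nm b + nm c) * r).
Proof.
move=> hx; rewrite !mulrDl; apply: ell_add; first apply: ell_add.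
- apply: ell_mono (ell_scale a (ell_shift hx)) => n.
  rewrite !nmM (nm_pos (wt_ge0 _)) ler_wpM2r ?nm_ge0// ler_piMr ?nm_ge0//.
  exact: wt_le1.
- exact: ell_scale.
- apply: ell_mono (ell_scale c (ell_unshift hx)) => -[|n]//.
  rewrite !nmM ler_wpM2l ?nm_ge0// (nm_pos (wt_ge0 _)) ler_piMl ?nm_ge0//.
  exact: wt_le1.
Qed.

Lemma jac_add a b c x y n : jac a b c (fun k => x k + y k) n = jac a b c x n + jac a b c y n.
Proof. by rewrite /jac; case: n => [|n]; ring. Qed.

Lemma jac_scale a b c k x n : jac a b c (fun m => k * x m) n = k * jac a b c x n.
Proof. by rewrite /jac; case: n => [|n]; ring. Qed.

Lemma jac_sub a b c x y n : jac a b c (fun k => x k - y k) n = jac a b c x n - jac a b c y n.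
Proof. by rewrite /jac; case: n => [|n]; ring. Qed.

(** Running the recurrence at s0 + X over polynomials makes the coefficients of the result the
    Taylor coefficients at [s0] of the [n]-th entry, up to the factor [sqn n]. *)
Definition tpol (gam s0 : R[i]) : nat -> {poly R[i]} :=
  rec_seq (fun n => (kap gam n)%:P) (s0%:P + 'X).

Definition tcoef gam s0 (k n : nat) : R[i] := (sqn n)%:C%C * (tpol gam s0 n)`_k.

Lemma tpol_horner gam s0 h n : (tpol gam s0 n).[h] = rec_seq (kap gam) (s0 + h) n.
Proof.
rewrite -/(horner_eval h _) (rec_seq_morph (horner_eval h)).
rewrite /= /horner_eval hornerD hornerC hornerX; congr (rec_seq _ _ _).
by apply/funext => k; rewrite hornerC.
Qed.

Lemma tpol_size gam s0 n : (size (tpol gam s0 n) <= n.+1)%N.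
Proof.
have sz1 : (size (s0%:P + 'X)%R <= 2)%N by rewrite addrC size_XaddC.
elim/rec_ind2 : n => [||n h0 h1]; rewrite /tpol ?rec_seq0 ?rec_seq1 ?size_poly1//.
rewrite rec_seqSS (leq_trans (size_polyD _ _))// size_polyN geq_max.
apply/andP; split.
  rewrite (leq_trans (size_polyMleq _ _))//.
  by move: (leq_add sz1 h1); rewrite /tpol; case: (_ + _)%N.
rewrite (leq_trans (size_polyMleq _ _))//.
have sk : (size (kap gam n.+1)%:P <= 1)%N by rewrite size_polyC leq_b1.
by move: (leq_add sk h0); rewrite /tpol; case: (_ + _)%N => //= k hk; rewrite ltnW// ltnW// ltnW.
Qed.

(** A weighted l^1 norm for which constants act by their modulus and a factor X costs rho. *)
Definition pnorm (rho : R) (K : nat) (p : {poly R[i]}) : R :=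
  \sum_(k < K) nm p`_k * rho ^+ k.

Lemma pnorm_ge0 rho K p : 0 <= rho -> 0 <= pnorm rho K p.
Proof. by move=> r0; rewrite sumr_ge0// => i _; rewrite mulr_ge0 ?nm_ge0// exprn_ge0. Qed.

Lemma pnormD rho K p q : 0 <= rho -> pnorm rho K (p + q) <= pnorm rho K p + pnorm rho K q.
Proof.
move=> r0; rewrite -big_split/=; apply: ler_sum => i _.
by rewrite -mulrDl ler_wpM2r ?exprn_ge0// coefD nmD.
Qed.

Lemma pnormC rho K c p : pnorm rho K (c%:P * p) = nm c * pnorm rho K p.
Proof. by rewrite mulr_sumr; apply: eq_bigr => i _; rewrite coefCM nmM mulrA. Qed.

Lemma pnormX rho K p : 0 <= rho -> pnorm rho K ('X * p) <= rho * pnorm rho K p.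
Proof.
move=> r0; case: K => [|K]; first by rewrite /pnorm !big_ord0 mulr0.
rewrite /pnorm big_ord_recl coefXM/= nm0 mul0r add0r mulr_sumr big_ord_recr/=.
rewrite -[leLHS]addr0; apply: lerD; last by rewrite !mulr_ge0 ?nm_ge0// exprn_ge0.
by apply: ler_sum => i _; rewrite coefXM/= exprS mulrCA.
Qed.

Lemma pnorm1 rho K : 0 <= rho -> pnorm rho K 1 <= 1.
Proof.
move=> r0; case: K => [|K]; first by rewrite /pnorm big_ord0.
rewrite /pnorm big_ord_recl coef1 nm1 expr0 mul1r big1 ?addr0// => i _.
by rewrite coef1/= nm0 mul0r.
Qed.

(** The roots split the recurrence into two of first order: u n = p (n + 1) - v p n satisfies u (n +
    1) = w u n + gam / (n + 2) p n + X p (n + 1), where gam / (n + 2) is the gap between [kap] and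
    its limit. Then [growth] applies, with a constant that depends on [gam], [t] and [th] alone. *)
Lemma tpol_growth gam (t th : R) : 0 <= t -> t < th -> th <= 1 ->
  exists2 C, 0 <= C & forall s0 w v : R[i], w + v = s0 -> w * v = gam ->
    nm w <= t -> nm v <= t ->
    forall K n, pnorm ((th - t) ^+ 2 / 4) K (tpol gam s0 n) <= C * th ^+ n.
Proof.
move=> t0 tth th1; have [C C0 hC] := growth t0 tth th1 (nm_ge0 gam).
exists C => // s0 w v hs hp wt vt K n.
set rho := (th - t) ^+ 2 / 4.
have rho0 : 0 <= rho by rewrite divr_ge0// sqr_ge0.
have rho1 : rho <= 1 by rewrite /rho; nra.
pose u n := tpol gam s0 n.+1 - v%:P * tpol gam s0 n.
have pD := @pnormD rho K; have pC := pnormC rho K; have pX := @pnormX rho K.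
apply: (hC (fun n => pnorm rho K (tpol gam s0 n)) (fun n => pnorm rho K (u n))).
- by move=> m; exact: pnorm_ge0.
- by move=> m; exact: pnorm_ge0.
- by rewrite /tpol rec_seq0 pnorm1.
- have -> : u 0 = w%:P * 1 + 'X * 1.
    by rewrite /u /tpol rec_seq0 rec_seq1 -hs rmorphD/=; ring.
  rewrite (le_trans (pD _ _ rho0))// pC.
  have h1 := pX 1 rho0; have h2 := pnorm1 K rho0; have h3 := nm_ge0 w.
  by have := pnorm_ge0 K 1 rho0; nra.
- move=> m; have -> : tpol gam s0 m.+1 = v%:P * tpol gam s0 m + u m by rewrite /u; ring.
  rewrite (le_trans (pD _ _ rho0))// lerD2r pC ler_wpM2r//.
  exact: pnorm_ge0.
- move=> m.
  have -> : u m.+1 = w%:P * u m + (gam / m.+2%:R)%:P * tpol gam s0 m + 'X * tpol gam s0 m.+1.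
    have kE : kap gam m.+1 = w * v - gam / m.+2%:R.
      have n2 : 2 + m%:R != 0 :> R[i] by rewrite -natrD pnatr_eq0.
      by rewrite /kap hp; field.
    rewrite /u /tpol rec_seqSS kE -hs !rmorphB !rmorphM/= rmorphD/= .
    ring.
  rewrite (le_trans (pD _ _ rho0))// lerD//; last exact: pX.
  rewrite (le_trans (pD _ _ rho0))// !pC lerD//.
    by rewrite ler_wpM2r// pnorm_ge0.
  by rewrite nmM nmV nm_nat.
Qed.

(** Coefficients of index at least K are multiplied by at most (|h| / rho)^K relative to [pnorm].
    Both [B] and the radius are uniform in [s0], which later permits steps of fixed length. Writing
    th = q^2 spends one q^n on the factor [sqn n] and keeps the other for summability. *)
Lemma taylor_tail gam (t th : R) : 0 <= t -> t < th -> th < 1 ->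
  exists2 B, 0 <= B & forall s0 w v : R[i], w + v = s0 -> w * v = gam ->
    nm w <= t -> nm v <= t ->
    forall K h, nm h <= (th - t) ^+ 2 / 4 ->
      ell (fun n => ev gam (s0 + h) n - \sum_(k < K) tcoef gam s0 k n * h ^+ k)
          (B * (nm h / ((th - t) ^+ 2 / 4)) ^+ K).
Proof.
move=> t0 tth th1; have [C C0 hC] := tpol_growth gam t0 tth (ltW th1).
have th0 : 0 <= th by lra.
pose q := Num.sqrt th.
have q0 : 0 <= q by rewrite sqrtr_ge0.
have qq : q ^+ 2 = th by rewrite sqr_sqrtr.
have q1 : q < 1 by nra.
have q10 : 0 < 1 - q by lra.
exists (C / (1 - q) / (1 - q)); first by rewrite !divr_ge0// ltW.
move=> s0 w v hs hp wt vt K h.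
set rho := (th - t) ^+ 2 / 4 => hrho.
have rho0 : 0 < rho by rewrite divr_gt0// exprn_gt0// subr_gt0.
have -> : C / (1 - q) / (1 - q) * (nm h / rho) ^+ K =
  (C / (1 - q) * (nm h / rho) ^+ K) / (1 - q) by rewrite mulrAC.
have hr0 : 0 <= nm h / rho by rewrite divr_ge0 ?nm_ge0// ltW.
have hr1 : nm h / rho <= 1 by rewrite ler_pdivrMr// mul1r.
apply: ell_geom => //; first by rewrite mulr_ge0 ?exprn_ge0// divr_ge0// ltW.
move=> n.
have -> : ev gam (s0 + h) n - \sum_(k < K) tcoef gam s0 k n * h ^+ k =
   (sqn n)%:C%C * \sum_(k < n.+1) (tpol gam s0 n)`_(K + k) * h ^+ (K + k).
  rewrite /ev -tpol_horner (@horner_coef_wide _ (K + n.+1)); last first.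
    by rewrite (leq_trans (tpol_size _ _ _))// leq_addl.
  rewrite big_split_ord/= mulrDr addrAC -[RHS]add0r; congr (_ + _).
  by apply/eqP; rewrite subr_eq0 mulr_sumr; apply/eqP/eq_bigr => k _; rewrite mulrA.
rewrite nmM nm_pos ?(ltW (sqn_gt0 _))//.
have hsum : nm (\sum_(k < n.+1) (tpol gam s0 n)`_(K + k) * h ^+ (K + k)) <=
    (nm h / rho) ^+ K * (C * th ^+ n).
  rewrite (le_trans (nm_sum _ _ _))//.
  apply: (@le_trans _ _ ((nm h / rho) ^+ K * pnorm rho (K + n.+1) (tpol gam s0 n))).
    rewrite /pnorm big_split_ord/= mulrDr -[leLHS]add0r lerD//.
      rewrite mulr_ge0 ?exprn_ge0// sumr_ge0// => i _.
      by rewrite mulr_ge0 ?nm_ge0// exprn_ge0// ltW.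
    rewrite mulr_sumr; apply: ler_sum => k _.
    rewrite nmM nmX mulrCA ler_wpM2l ?nm_ge0//.
    have -> : nm h ^+ (K + k) = (nm h / rho) ^+ (K + k) * rho ^+ (K + k).
      by rewrite -exprMn divfK// gt_eqF.
    rewrite ler_wpM2r ?exprn_ge0// ?(ltW rho0)// exprD ler_piMr ?exprn_ge0//.
    by rewrite exprn_ile1.
  by rewrite ler_wpM2l ?exprn_ge0// (hC _ w v).
apply: (@le_trans _ _ (n.+1%:R * ((nm h / rho) ^+ K * (C * th ^+ n)))).
  by rewrite ler_pM ?nm_ge0// ?(ltW (sqn_gt0 _))// sqn_le.
rewrite -qq -exprM mulnC exprM expr2.
have -> : n.+1%:R * ((nm h / rho) ^+ K * (C * (q ^+ n * q ^+ n))) =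
  C * (nm h / rho) ^+ K * q ^+ n * (n.+1%:R * q ^+ n) by ring.
have -> : C / (1 - q) * (nm h / rho) ^+ K * q ^+ n =
  C * (nm h / rho) ^+ K * q ^+ n * (1 - q)^-1 by ring.
by rewrite ler_wpM2l ?succ_geom// !mulr_ge0// exprn_ge0.
Qed.

End BergmanMatrix.

(** * The closed span of the eigenvectors, and its propagation through the region *)

Section Closure.
Context {R : realType}.
Context (gam : R[i]).
Implicit Types (x y : nat -> R[i]) (r e : R) (U V : R[i] -> Prop) (l : seq (R[i] * R[i])).

Definition lin l (n : nat) : R[i] := \sum_(p <- l) p.1 * ev gam p.2 n.

Definition supp U l := forall p, p \in l -> U p.2.

(* [x] lies in the closed linear span of the eigenvectors [ev gam s], [s] in [U]. *)
Definition clos U x :=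
  forall e, 0 < e -> exists2 l, supp U l & ell (fun n => x n - lin l n) e.

Lemma lin_cat l1 l2 n : lin (l1 ++ l2) n = lin l1 n + lin l2 n.
Proof. by rewrite /lin big_cat. Qed.

Lemma lin_map (f : R[i] -> R[i]) l n :
  lin [seq (f p.2 * p.1, p.2) | p <- l] n = \sum_(p <- l) f p.2 * (p.1 * ev gam p.2 n).
Proof. by rewrite /lin big_map; apply: eq_bigr => p _; rewrite /= mulrA. Qed.

Lemma lin_scale k l n : lin [seq (k * p.1, p.2) | p <- l] n = k * lin l n.
Proof. by rewrite (lin_map (fun=> k)) -mulr_sumr. Qed.

Lemma supp_cat U l1 l2 : supp U l1 -> supp U l2 -> supp U (l1 ++ l2).
Proof. by move=> h1 h2 p; rewrite mem_cat => /orP[/h1|/h2]. Qed.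

Lemma supp_map U f l : supp U l -> supp U [seq (f p.2 * p.1, p.2) | p <- l].
Proof. by move=> h p /mapP[q /h hq ->]. Qed.

Lemma clos_lin U l : supp U l -> clos U (lin l).
Proof.
move=> hl e e0; exists l => //; apply: ell_mono (ell0 (ltW e0)) => n.
by rewrite subrr.
Qed.

Lemma clos_ev U s : U s -> clos U (ev gam s).
Proof.
move=> Us; have -> : ev gam s = lin [:: (1, s)].
  by apply/funext => n; rewrite /lin big_seq1 mul1r.
by apply: clos_lin => p; rewrite inE => /eqP ->.
Qed.

Lemma clos_add U x y : clos U x -> clos U y -> clos U (fun n => x n + y n).
Proof.
move=> hx hy e e0; have e2 : 0 < e / 2 by rewrite divr_gt0.
have [l1 s1 h1] := hx _ e2; have [l2 s2 h2] := hy _ e2.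
exists (l1 ++ l2); first exact: supp_cat.
rewrite [e]splitr; apply: ell_mono (ell_add h1 h2) => n.
by rewrite lin_cat opprD addrACA.
Qed.

Lemma clos_scale U k x : clos U x -> clos U (fun n => k * x n).
Proof.
move=> hx e e0; have k1 : 0 < nm k + 1 by rewrite ltr_wpDl ?nm_ge0.
have [l sl hl] := hx _ (divr_gt0 e0 k1).
exists [seq (k * p.1, p.2) | p <- l]; first exact: (@supp_map U (fun=> k) l sl).
apply: (@ell_le _ _ (nm k * (e / (nm k + 1)))).
  rewrite mulrA ler_pdivrMr// mulrC ler_wpM2l ?(ltW e0)//.
  by rewrite lerDl.
by apply: ell_mono (ell_scale k hl) => n; rewrite lin_scale mulrBr.
Qed.

Lemma clos_sub U x y : clos U x -> clos U y -> clos U (fun n => x n - y n).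
Proof.
move=> hx hy; have := clos_add hx (clos_scale (-1) hy).
by congr clos; apply/funext => n; rewrite mulN1r.
Qed.

Lemma clos_lim U x :
  (forall e, 0 < e -> exists2 y, clos U y & ell (fun n => x n - y n) e) -> clos U x.
Proof.
move=> h e e0; have e2 : 0 < e / 2 by rewrite divr_gt0.
have [y hy hxy] := h _ e2; have [l sl hl] := hy _ e2.
exists l => //; rewrite [e]splitr; apply: ell_mono (ell_add hxy hl) => n.
by rewrite addrA subrK.
Qed.

Lemma clos0 U : clos U (fun=> 0).
Proof.
move=> e e0; exists [::] => //; apply: ell_mono (ell0 (ltW e0)) => n.
by rewrite /lin big_nil subrr.
Qed.

Lemma clos_sum U (K : nat) (x : nat -> nat -> R[i]) :
  (forall k, (k < K)%N -> clos U (x k)) -> clos U (fun n => \sum_(k < K) x k n).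
Proof.
elim: K => [_|K IH h].
  by under eq_fun do rewrite big_ord0; exact: clos0.
under eq_fun do rewrite big_ord_recr/=.
by apply: clos_add; [apply: IH => k kK; apply: h; exact: ltnW|exact: h].
Qed.

Lemma clos_trans U V x : (forall s, V s -> clos U (ev gam s)) -> clos V x -> clos U x.
Proof.
move=> h hx; apply: clos_lim => e /hx[l sl hl]; exists (lin l) => //.
elim: l sl {hl} => [_|p l IH sl].
  rewrite (_ : lin [::] = fun=> 0); first exact: clos0.
  by apply/funext => n; rewrite /lin big_nil.
have -> : lin (p :: l) = (fun n => p.1 * ev gam p.2 n + lin l n).
  by apply/funext => n; rewrite /lin big_cons.
apply: clos_add; first by apply: clos_scale; apply: h; apply: sl; exact: mem_head.
by apply: IH => q ql; apply: sl; rewrite inE ql orbT.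
Qed.

(** By induction on k, the k-th Taylor coefficient is the limit of the k-th remainder divided by h^k
    as the real number h tends to 0, so it lies in the closed span. The Taylor series then recovers
    [ev] on the whole ball of radius [rho], however small [delta] is. *)
Lemma taylor_clos U s0 (B rho delta : R) : 0 <= B -> 0 < rho -> 0 < delta ->
  (forall K h, nm h <= rho ->
    ell (fun n => ev gam (s0 + h) n - \sum_(k < K) tcoef gam s0 k n * h ^+ k)
        (B * (nm h / rho) ^+ K)) ->
  (forall s, nm (s - s0) < delta -> clos U (ev gam s)) ->
  (forall k, clos U (tcoef gam s0 k)) /\
  (forall h, nm h < rho -> clos U (ev gam (s0 + h))).
Proof.
move=> B0 rho0 delta0 htail hU.
have B1 : 0 < B + 1 by lra.
have hk k : clos U (tcoef gam s0 k).
  elim/ltn_ind : k => k IH; apply: clos_lim => e e0.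
  (* Small enough to stay in both balls, and to make the error B h / rho^(k+1) of the divided
     remainder at most [e]. *)
  pose h : R := Num.min (delta / 2) (Num.min rho (e * rho ^+ k.+1 / (B + 1))).
  have h0 : 0 < h.
    by rewrite !lt_min rho0 !divr_gt0// mulr_gt0// exprn_gt0.
  have hd : h < delta by rewrite (@le_lt_trans _ _ (delta / 2)) ?ge_min ?lexx//; lra.
  have hr : h <= rho by rewrite /h !ge_min lexx orbT.
  have he : h <= e * rho ^+ k.+1 / (B + 1) by rewrite /h !ge_min lexx !orbT.
  have nh : nm h%:C%C = h by rewrite nm_pos// ltW.
  have hn0 : h%:C%C != 0 :> R[i] by rewrite rc_eq0 gt_eqF.
  exists (fun n => (h%:C%C ^+ k)^-1 *
    (ev gam (s0 + h%:C%C) n - \sum_(j < k) h%:C%C ^+ j * tcoef gam s0 j n)).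
    apply: clos_scale; apply: clos_sub.
      by apply: hU; rewrite addrAC subrr add0r nh.
    apply: (@clos_sum _ k (fun j n => h%:C%C ^+ j * tcoef gam s0 j n)) => j jk.
    by apply: clos_scale; exact: IH.
  have htl := htail k.+1 h%:C%C; rewrite nh in htl.
  apply: (@ell_le _ _ (nm (h%:C%C ^+ k)^-1 * (B * (h / rho) ^+ k.+1))).
    rewrite nmV nmX nh expr_div_n exprS.
    have -> : (h ^+ k)^-1 * (B * (h * h ^+ k / rho ^+ k.+1)) = h * B / rho ^+ k.+1.
      by field; rewrite !expf_neq0// gt_eqF.
    rewrite ler_pdivrMr ?exprn_gt0//.
    rewrite ler_pdivlMr// in he; rewrite (le_trans _ he)// ler_wpM2l ?(ltW h0)//.
    by rewrite lerDl.
  apply: ell_mono (ell_scale (h%:C%C ^+ k)^-1 (htl hr)) => n.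
  rewrite big_ord_recr/= [X in nm X <= _](_ : _ = - ((h%:C%C ^+ k)^-1 *
    (ev gam (s0 + h%:C%C) n - (\sum_(i < k) tcoef gam s0 i n * h%:C%C ^+ i + tcoef gam s0 k n * h%:C%C ^+ k)))).
    by rewrite nmN.
  set S := \sum_(i < k) tcoef gam s0 i n * h%:C%C ^+ i.
  have -> : \sum_(j < k) h%:C%C ^+ j * tcoef gam s0 j n = S.
    by apply: eq_bigr => j _; rewrite mulrC.
  by field; rewrite expf_neq0.
split=> // h hrho; apply: clos_lim => e e0.
have hr0 : 0 <= nm h / rho by rewrite divr_ge0 ?nm_ge0// ltW.
have hr1 : nm h / rho < 1 by rewrite ltr_pdivrMr// mul1r.
have [K hK] := pow_small hr0 hr1 (divr_gt0 e0 B1).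
exists (fun n => \sum_(k < K) h ^+ k * tcoef gam s0 k n).
  by apply: (@clos_sum _ K (fun k n => h ^+ k * tcoef gam s0 k n)) => k _; exact: clos_scale.
apply: (@ell_le _ _ (B * (nm h / rho) ^+ K)).
  have := ltW (hK _ (leqnn K)); rewrite ler_pdivlMr// => hh.
  rewrite (le_trans _ hh)// mulrC ler_wpM2l ?exprn_ge0// lerDl//.
apply: ell_mono (htail K h (ltW hrho)) => n.
by under eq_bigr do rewrite mulrC.
Qed.

(** An open ellipse when |gam| < 1; b + a * s runs through the conjectural eigenvalues, the values
    of the symbol on the disc, when gam = c / a. *)
Definition region (s : R[i]) := exists2 om, nm om < 1 & s = om + gam * conjc om.

(** The segment from [s1] to [s2] is walked in [M] steps shorter than [rho]. At each node
    [taylor_clos] enlarges a small ball of known points to radius [rho], and this contains a ball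
    around the next node. One [rho] serves all nodes because |om| <= eta along the whole segment. *)
Lemma region_clos U s1 delta : nm gam < 1 -> region s1 -> 0 < delta ->
  (forall s, nm (s - s1) < delta -> U s) -> forall s, region s -> clos U (ev gam s).
Proof.
move=> g1 [om1 hom1 es1] delta0 hU s2 [om2 hom2 es2].
pose eta := Num.max (nm om1) (nm om2).
have eta1 : eta < 1 by rewrite gt_max hom1.
have eta0 : 0 <= eta by rewrite le_max nm_ge0.
have g0 := nm_ge0 gam.
pose t := 1 - (1 - nm gam) * (1 - eta) / 2; pose th := (1 + t) / 2.
have t0 : 0 <= t by rewrite /t; nra.
have t1 : t < 1 by rewrite /t; nra.
have tth : t < th by rewrite /th; lra.
have th1 : th < 1 by rewrite /th; lra.
have [B B0 hB] := taylor_tail gam t0 tth th1.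
set rho := (th - t) ^+ 2 / 4 in hB.
have rho0 : 0 < rho by rewrite divr_gt0// exprn_gt0// subr_gt0.
have dr0 : 0 <= nm (s2 - s1) / rho by rewrite divr_ge0 ?nm_ge0// ltW.
pose M := (Num.bound (nm (s2 - s1) / rho)).+1.
have M0 : 0 < M%:R :> R by rewrite ltr0n.
have hM : nm (s2 - s1) / M%:R < rho.
  rewrite ltr_pdivrMr// mulrC -ltr_pdivrMr// (lt_le_trans (archi_boundP dr0))//.
  by rewrite ler_nat.
have MC : (M%:R : R[i]) != 0 by rewrite pnatr_eq0.
pose si (i : nat) := s1 + (i%:R / M%:R) * (s2 - s1).
suff hi i : (i <= M)%N -> exists2 d : R, 0 < d & forall s, nm (s - si i) < d -> clos U (ev gam s).
  have [d d0 hd] := hi M (leqnn _); apply: hd.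
  have -> : s2 - si M = 0 by rewrite /si divff// mul1r; ring.
  by rewrite nm0.
elim: i => [_|i IH iM].
  exists delta => // s; rewrite /si mul0r mul0r addr0 => hs; apply: clos_ev; exact: hU.
have [d d0 hd] := IH (ltnW iM).
have htail : forall K h, nm h <= rho ->
    ell (fun n => ev gam (si i + h) n - \sum_(k < K) tcoef gam (si i) k n * h ^+ k)
        (B * (nm h / rho) ^+ K).
  have [w [v [hs hp vw]]] := quad_roots (si i) gam.
  pose lam : R := i%:R / M%:R.
  have lam0 : 0 <= lam by rewrite divr_ge0.
  have lam1 : lam <= 1 by rewrite ler_pdivrMr// mul1r ler_nat ltnW.
  (* The map om -> om + gam * conj om is real-linear, so the nodes come from the segment between
     [om1] and [om2]. *)
  pose om := om1 + lam%:C%C * (om2 - om1).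
  have omeq : om = (1 - lam)%:C%C * om1 + lam%:C%C * om2.
    by rewrite /om rcB rmorph1; ring.
  have omE : nm om <= eta.
    rewrite omeq (le_trans (nmD _ _))// !nmM !nm_pos ?subr_ge0//.
    have h1 : nm om1 <= eta by rewrite le_max lexx.
    have h2 : nm om2 <= eta by rewrite le_max lexx orbT.
    by nra.
  have sE : w + v = om + gam * conjc om.
    rewrite hs /si es1 es2 omeq cjD !cjM !conjc_real rcB rmorph1.
    have -> : (lam%:C%C : R[i]) = i%:R / M%:R by rewrite /lam rcM rcV !rc_nat.
    ring.
  have wt : nm w <= t := root_bound g1 eta1 omE vw sE hp.
  exact: (hB _ w v hs hp wt (le_trans vw wt)).
have [_ hball] := taylor_clos B0 rho0 d0 htail hd.
exists (rho - nm (s2 - s1) / M%:R); first by rewrite subr_gt0.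
move=> s hs; rewrite -[s](subrK (si i)) addrC; apply: hball.
have -> : s - si i = (s - si i.+1) + (M%:R)^-1 * (s2 - s1).
  by rewrite /si -natr1; field.
rewrite (le_lt_trans (nmD _ _))// nmM nmV nm_nat [X in _ + X]mulrC.
by rewrite -ltrBrDr.
Qed.

End Closure.

(** * Gauss quadrature for the eigenvectors with gam = 1 *)

Section Quadrature.
Context {R : realType}.
Local Notation C := R[i].

Lemma sum_delta (M k : nat) (f : nat -> C) :
  \sum_(i < M) (if (i : nat) == k then f i else 0) = if (k < M)%N then f k else 0.
Proof.
rewrite -big_mkcond/=; case: ifPn => [kM|].
  by rewrite (big_pred1 (Ordinal kM))//= => i; rewrite -val_eqE.
rewrite -leqNgt => Mk; rewrite big_pred0// => i; apply/negbTE.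
by rewrite neq_ltn (leq_trans (ltn_ord i)).
Qed.

(* Gauss quadrature: the nodes and weights come from the spectral decomposition of
   the truncated Jacobi matrix with off-diagonal entries [wt]. *)
Lemma quadrature N : exists om tt : 'I_N.+1 -> R,
  [/\ forall j, 0 <= om j, forall j, `|tt j| <= 2 &
   forall n, (n <= N)%N ->
     \sum_j (om j)%:C%C * ev 1 (tt j)%:C%C n = (n == 0)%:R].
Proof.
pose jm (i j : nat) : R := if j == i.+1 then wt i else if i == j.+1 then wt j else 0.
pose J : 'M[C]_N.+1 := \matrix_(i, j) (jm i j)%:C%C.
have jmC i j : jm i j = jm j i.
  rewrite /jm; case: eqP => [->|_]; last by case: eqP.
  by rewrite (ltn_eqF (leqW (leqnn _))).
have conjE (z : C) : z^* = conjc z by [].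
have Jherm : J \is hermsymmx.
  apply/is_hermitianmxP; rewrite expr0 scale1r; apply/matrixP => i j.
  by rewrite !mxE conjE conjc_real jmC.
pose P := spectralmx J; pose D := spectral_diag J.
have JE : P *m J = diag_mx D *m P.
  have /hermitian_normalmx/orthomx_spectralP {1}-> := Jherm.
  by rewrite !mulmxA mulmxV ?spectral_unit// mul1mx.
have Punit : P *m (map_mx Num.conj P^T) = 1%:M by apply/unitarymxP; exact: spectral_unitarymx.
have Punit' : (map_mx Num.conj P^T) *m P = 1%:M by exact: mulmx1C.
pose tt j := complex.Re (D 0 j).
have ttE j : D 0 j = (tt j)%:C%C.
  rewrite RRe_real//; have /mxOverP := hermitian_spectral_diag_real Jherm.
  by move=> /(_ 0 j).
(* The rows of [P], extended by 0. The value 0 at N + 1 makes the last row of the truncated matrix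
   agree with [jac 1 0 1]. *)
pose v (j : 'I_N.+1) (n : nat) : C := if (n < N.+1)%N then P j (inord n) else 0.
have vE j (i : 'I_N.+1) : v j i = P j i by rewrite /v ltn_ord inord_val.
have rec j n : (n <= N)%N -> jac 1 0 1 (v j) n = (tt j)%:C%C * v j n.
  move=> nN; have /matrixP/(_ j (inord n)) := JE.
  rewrite mul_diag_mx !mxE ttE.
  have -> : P j (inord n) = v j n by rewrite /v ltnS nN.
  move=> <-.
  under eq_bigr => i _.
    rewrite mxE -vE inordK// (_ : v j i * (jm i n)%:C%C =
      (if (i : nat) == n.+1 then v j i * (wt n)%:C%C else 0) +
      (if (i : nat) == n.-1 then (if (0 < n)%N then v j i * (wt i)%:C%C else 0) else 0)).
      over.
    rewrite /jm; case: n {nN} => [|n] /=.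
      by case: ifP => _; case: ifP => _; rewrite ?addr0 ?mulr0.
    rewrite eqSS [n == i]eq_sym; case: (eqVneq (i : nat) n) => [->|_].
      by rewrite (ltn_eqF (leqW (leqnn _))) add0r.
    by case: ifP => _; rewrite ?addr0 ?mulr0.
  rewrite big_split/= (sum_delta _ _ (fun i => v j i * (wt n)%:C%C)).
  rewrite (sum_delta _ _ (fun i => if (0 < n)%N then v j i * (wt i)%:C%C else 0)).
  rewrite /jac mul0r addr0 !mul1r mulrC; congr (_ + _).
    by case: ifPn => // /negbTE h; rewrite /v h mul0r.
  rewrite ltnS (leq_trans (leq_pred _) nN).
  by case: n nN => [//|n] nN /=; rewrite mulrC.
have wtn0 n : (wt n)%:C%C != 0 :> C.
  by rewrite rc_eq0 gt_eqF// divr_gt0// sqn_gt0.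
have rec2 (t : C) n : jac 1 0 1 (ev 1 t) n = t * ev 1 t n.
  by have := @jac_ev R 1 0 1 t n (oner_neq0 _); rewrite divr1 mul1r add0r.
(* Both sides satisfy the same three-term recurrence and agree at 0, where [ev] is 1: each row is a
   multiple of an eigenvector. *)
have vev j n : (n <= N)%N -> v j n = v j 0 * ev 1 (tt j)%:C%C n.
  elim/rec_ind2 : n => [_|N1|n IH0 IH1 nN]; first by rewrite ev0 mulr1.
    have h1 := rec j 0 isT; have h2 := rec2 (tt j)%:C%C 0.
    rewrite /jac !(mulr0, mul0r, addr0, mul1r) in h1 h2.
    apply: (mulfI (wtn0 0)); rewrite h1 mulrCA h2 ev0 mulr1 mulrC//.
  have h1 := rec j n.+1 (ltnW nN); have h2 := rec2 (tt j)%:C%C n.+1.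
  rewrite /jac !(mul0r, addr0, mul1r) in h1 h2.
  apply: (mulfI (wtn0 n.+1)).
  rewrite mulrCA -[LHS](addrK ((wt n)%:C%C * v j n)) h1.
  rewrite (IH1 (ltnW nN)) (IH0 (ltnW (ltnW nN))).
  rewrite (_ : (wt n.+1)%:C%C * ev 1 (tt j)%:C%C n.+2 =
    (tt j)%:C%C * ev 1 (tt j)%:C%C n.+1 - (wt n)%:C%C * ev 1 (tt j)%:C%C n).
    by ring.
  by rewrite -h2 addrK.
exists (fun j => nm (v j 0) ^+ 2), tt; split=> [j|j|n nN]; first exact: sqr_ge0.
(* Gershgorin's argument at an entry of largest modulus: its two neighbours carry weights at most
   1. *)
- case: (@Order.TotalTheory.arg_maxP _ R _ ord0 predT (fun i => nm (P j i)) isT) => i _ hi.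
  have vi n : nm (v j n) <= nm (P j i).
    by rewrite /v; case: ifP => _; [exact: hi|rewrite nm0 nm_ge0].
  have Pi0 : 0 < nm (P j i).
    rewrite lt_neqAle nm_ge0 andbT eq_sym; apply/eqP => Pi0.
    have /matrixP/(_ j j) := Punit; rewrite !mxE eqxx big1 => [|k _].
      by move/esym/eqP; rewrite oner_eq0.
    have : nm (P j k) <= 0 by rewrite -Pi0; exact: hi.
    by rewrite le_eqVlt ltNge nm_ge0 orbF nm_eq0 => /eqP ->; rewrite mul0r.
  rewrite -(ler_pM2r Pi0) -nmR -nmM -vE -rec ?leq_ord//.
  rewrite /jac mul0r addr0 !mul1r (le_trans (nmD _ _))//.
  rewrite mulr_natl mulr2n lerD//.
    rewrite nmM nm_pos ?wt_ge0// vE (le_trans (ler_wpM2l (wt_ge0 _) (vi _)))//.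
    by rewrite ler_piMl ?wt_le1 ?nm_ge0.
  rewrite vE; case: (nat_of_ord i) => [|k]; first by rewrite nm0 nm_ge0.
  rewrite nmM nm_pos ?wt_ge0// (le_trans (ler_wpM2l (wt_ge0 _) (vi _)))//.
  by rewrite ler_piMl ?wt_le1 ?nm_ge0.
(* Exactness is the orthonormality of the columns 0 and [n] of [P]. *)
- have /matrixP/(_ ord0 (inord n)) := Punit'; rewrite !mxE -val_eqE/= inordK// eq_sym.
  move=> <-; apply: eq_bigr => j _; rewrite !mxE conjE.
  have -> : P j (inord n) = v j n by rewrite /v ltnS nN.
  rewrite (vev j n nN) -mul_conj; have -> : P j ord0 = v j 0 by rewrite -vE.
  ring.
Qed.

End Quadrature.

(** * The eigenvectors over any ball of the region span all square-summable sequences *)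

Section Density.
Context {R : realType}.
Local Notation C := R[i].
Implicit Types (x y : nat -> R[i]) (r e : R) (U V : R[i] -> Prop).

Definition e_ (m n : nat) : C := (n == m)%:R.

(** Dilation by a square root of gam reduces to gam = 1, where the matrix is self-adjoint and the
    nodes are real. *)
Lemma rec_seq_dil (sg t : C) n :
  rec_seq (kap (sg ^+ 2)) (sg * t) n = sg ^+ n * rec_seq (kap 1) t n.
Proof.
elim/rec_ind2 : n => [||n h0 h1]; rewrite ?rec_seq0 ?rec_seq1 ?mulr1//.
rewrite !rec_seqSS h0 h1 /kap !exprS; ring.
Qed.

Lemma rec_seq_growth gam (t th : R) : 0 <= t -> t < th -> th <= 1 ->
  exists2 B, 0 <= B & forall s w v : C, w + v = s -> w * v = gam ->
    nm w <= t -> nm v <= t -> forall n, nm (rec_seq (kap gam) s n) <= B * th ^+ n.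
Proof.
move=> t0 tth th1; have [B B0 hB] := tpol_growth gam t0 tth th1.
exists B => // s w v hs hp hw hv n.
have := hB s w v hs hp hw hv 1 n.
rewrite /pnorm big_ord1 expr0 mulr1 -horner_coef0 tpol_horner addr0//.
Qed.

(* Both roots of [X^2 - sg t X + sg^2] have modulus [|sg|] when [t] is real, [|t| <= 2]. *)
Lemma real_node_roots (sg : C) (t : R) : `|t| <= 2 -> exists w v : C,
  [/\ w + v = sg * t%:C%C, w * v = sg ^+ 2, nm w = nm sg & nm v = nm sg].
Proof.
move=> t2; have t4 : t ^+ 2 <= 4.
  by rewrite -(real_normK (num_real t)) (_ : 4 = 2 ^+ 2); [rewrite ler_pXn2r ?nnegrE|ring].
pose d := Num.sqrt (4 - t ^+ 2).
have dd : d ^+ 2 = 4 - t ^+ 2 by rewrite sqr_sqrtr// subr_ge0.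
pose Y : C := Complex (t / 2) (d / 2).
have Y1 : nm Y = 1.
  apply/eqP; rewrite -(@eqrXn2 _ 2)// ?nm_ge0// expr1n nm_sqr /= !expr_div_n dd.
  by apply/eqP; field.
exists (sg * Y), (sg * conjc Y); split.
- rewrite -mulrDr; congr (_ * _); apply: complex_eq => /=; first by field.
  by rewrite subrr.
- have -> : sg * Y * (sg * conjc Y) = sg ^+ 2 * (Y * conjc Y) by ring.
  by rewrite mul_conj Y1 expr1n mulr1.
- by rewrite nmM Y1 mulr1.
- by rewrite nmM nm_conj Y1 mulr1.
Qed.

(** The approximant is the quadrature sum over the dilated nodes. It equals [e_ 0] up to index [N];
    beyond, every eigenvector involved is bounded by (n + 1) B th^n and the weights sum to 1, so the
    error tends to 0 with growing [N]. *)
Lemma clos_e0 gam : nm gam < 1 -> clos gam (region gam) (e_ 0).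
Proof.
move=> g1 e e0.
pose sg := sqrtc gam; have sg2 : sg ^+ 2 = gam by rewrite sqr_sqrtc.
have ng : nm sg ^+ 2 = nm gam by rewrite -nmX sg2.
have t0 := nm_ge0 sg; have t1 : nm sg < 1 by nra.
pose th := (1 + nm sg) / 2.
have tth : nm sg < th by rewrite /th; lra.
have th1 : th < 1 by rewrite /th; lra.
have th0 : 0 <= th by lra.
have [B B0 hB] := rec_seq_growth gam t0 tth (ltW th1).
(* Two square roots: one q^n absorbs the factor n + 1, and of the remaining q^n = r^n r^n one factor
   gives smallness, the other summability. *)
pose q := Num.sqrt th; pose r := Num.sqrt q.
have q0 : 0 <= q by rewrite sqrtr_ge0.
have r0 : 0 <= r by rewrite sqrtr_ge0.
have qq : q ^+ 2 = th by rewrite sqr_sqrtr.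
have rr : r ^+ 2 = q by rewrite sqr_sqrtr.
have q1 : q < 1 by nra.
have r1 : r < 1 by nra.
have q10 : 0 < 1 - q by lra.
have r10 : 0 < 1 - r by lra.
pose A := B / (1 - q).
have A0 : 0 <= A by rewrite divr_ge0// ltW.
have A1 : 0 < A + 1 by lra.
have [N hN] := pow_small r0 r1 (divr_gt0 (mulr_gt0 e0 r10) A1).
have [om [tt [om0 tt2 hom]]] := @quadrature R N.
have node j := real_node_roots sg (tt2 j).
exists [seq ((om j)%:C%C, sg * (tt j)%:C%C) | j <- index_enum 'I_N.+1].
  move=> p /mapP[j _ ->] /=.
  have g10 : 0 < 1 + nm gam by have := nm_ge0 gam; lra.
  have g1C : 1 + (nm gam)%:C%C != 0 :> C by rewrite -(rmorph1 (real_complex R)) -rcD rc_eq0 gt_eqF.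
  (* For this om, gam * conj om = |gam| om, so om + gam * conj om is the node; and |om| <= 2 |sg| /
     (1 + |sg|^2) < 1. *)
  exists (sg * (tt j / (1 + nm gam))%:C%C).
    rewrite nmM nmR normrM normfV (gtr0_norm g10) mulrA ltr_pdivrMr// mul1r.
    have := tt2 j; rewrite -ng; have := normr_ge0 (tt j); nra.
  rewrite cjM conjc_real.
  have -> : gam * (conjc sg * (tt j / (1 + nm gam))%:C%C) =
     sg * (sg * conjc sg) * (tt j / (1 + nm gam))%:C%C by rewrite -sg2; ring.
  rewrite mul_conj ng rcM rcV rcD rmorph1; field; exact: g1C.
have linE n : lin gam [seq ((om j)%:C%C, sg * (tt j)%:C%C) | j <- index_enum 'I_N.+1] n =
    sg ^+ n * \sum_j (om j)%:C%C * ev 1 (tt j)%:C%C n.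
  rewrite /lin big_map mulr_sumr; apply: eq_bigr => j _ /=.
  by rewrite /ev -{1}sg2 rec_seq_dil; ring.
have om1 : \sum_j om j = 1.
  apply: complexI; rewrite rc_sum.
  transitivity (\sum_j (om j)%:C%C * ev 1 (tt j)%:C%C 0); last by rewrite hom.
  by apply: eq_bigr => j _; rewrite ev0 mulr1.
apply: (@ell_le _ _ (A * r ^+ N / (1 - r))).
  rewrite ler_pdivrMr//; have := ltW (hN N (leqnn _)); rewrite ler_pdivlMr// => h.
  by rewrite (le_trans _ h)// mulrC ler_wpM2l ?exprn_ge0// lerDl.
apply: ell_geom => //; first by rewrite mulr_ge0// exprn_ge0.
have Ar m : 0 <= A * r ^+ N * r ^+ m.
  by apply: mulr_ge0; [apply: mulr_ge0 => //|]; exact: exprn_ge0.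
move=> n; have [nN|Nn] := leqP n N.
  rewrite linE hom// /e_; case: n nN => [|n] nN /=.
    by rewrite [sg ^+ 0]expr0 mul1r subrr nm0 Ar.
  by rewrite mulr0 subrr nm0 Ar.
rewrite /e_ gtn_eqF ?(leq_ltn_trans _ Nn)// sub0r nmN.
apply: (@le_trans _ _ (n.+1%:R * (B * th ^+ n))).
  rewrite /lin big_map (le_trans (nm_sum _ _ _))//.
  apply: (@le_trans _ _ (\sum_j om j * (n.+1%:R * (B * th ^+ n)))).
    apply: ler_sum => j _ /=; rewrite nmM nm_pos// ler_wpM2l//.
    have [w [v [hs hp nw nv]]] := node j.
    rewrite /ev nmM nm_pos ?(ltW (sqn_gt0 _))// ler_pM ?nm_ge0 ?(ltW (sqn_gt0 _)) ?sqn_le//.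
    by apply: (hB _ w v); rewrite ?nw ?nv// hp.
  by rewrite -mulr_suml om1 mul1r.
rewrite -qq -exprM mulnC exprM expr2.
have -> : n.+1%:R * (B * (q ^+ n * q ^+ n)) = B * (n.+1%:R * q ^+ n) * q ^+ n by ring.
apply: (@le_trans _ _ (A * q ^+ n)).
  by rewrite ler_wpM2r ?exprn_ge0// ler_wpM2l// succ_geom.
have -> : q ^+ n = r ^+ n * r ^+ n by rewrite -rr -exprM mulnC exprM expr2.
rewrite mulrA ler_wpM2r ?exprn_ge0// ler_wpM2l//.
by apply: ler_wiXn2l => //; [exact: ltW|exact: ltnW].
Qed.

Lemma clos_jac gam U a b c x : a != 0 -> gam = c / a -> clos gam U x ->
  clos gam U (jac a b c x).
Proof.
move=> a0 gE hx e e0.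
pose M := nm a + nm b + nm c.
have M0 : 0 <= M by rewrite !addr_ge0// nm_ge0.
have M1 : 0 < M + 1 by lra.
have [l sl hl] := hx _ (divr_gt0 e0 M1).
exists [seq ((b + a * p.2) * p.1, p.2) | p <- l].
  exact: (@supp_map _ U (fun s => b + a * s) l sl).
apply: (@ell_le _ _ (M * (e / (M + 1)))).
  by rewrite mulrA ler_pdivrMr// mulrC ler_wpM2l ?(ltW e0)// lerDl.
apply: ell_mono (ell_jac a b c hl) => n.
rewrite jac_sub (lin_map _ (fun s => b + a * s)).
suff -> : \sum_(p <- l) (b + a * p.2) * (p.1 * ev gam p.2 n) = jac a b c (lin gam l) n by [].
elim: l {sl hl} => [|p l IH].
  have -> : lin gam [::] = fun=> 0 * 0 by apply/funext => k; rewrite /lin big_nil mulr0.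
  by rewrite big_nil (jac_scale _ _ _ 0) mul0r.
rewrite big_cons IH.
have -> : lin gam (p :: l) = fun k => p.1 * ev gam p.2 k + lin gam l k.
  by apply/funext => k; rewrite /lin big_cons.
by rewrite jac_add jac_scale gE jac_ev//; ring.
Qed.

(** For gam nonzero, the matrix with a = 1, b = 0, c = gam leaves the span invariant and climbs from
    [e_ 0] to every [e_ m], its lower entries being nonzero. For gam = 0 it only shifts down; but
    then [ev] is sqn n * s^n, and the basis vectors are multiples of its Taylor coefficients at
    0. *)
Lemma clos_e gam m : nm gam < 1 -> clos gam (region gam) (e_ m).
Proof.
move=> g1; have [g0|gn0] := eqVneq gam 0.
  have t0 : (0 : R) <= 0 by [].
  have t1 : 0 < 1 / 2 :> R by lra.
  have t2 : 1 / 2 < 1 :> R by lra.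
  have [B B0 hB] := taylor_tail gam t0 t1 t2.
  set rho := _ / 4 in hB.
  have rho0 : 0 < rho by rewrite /rho subr0; lra.
  have hb := hB 0 0 0 (addr0 _).
  have [] := @taylor_clos R gam (region gam) 0 B rho 1 B0 rho0 ltr01.
  - by move=> K h; apply: hb; rewrite ?mul0r ?g0 ?nm0.
  - move=> s; rewrite subr0 => hs; apply: clos_ev; exists s => //.
    by rewrite g0 mul0r addr0.
  move=> /(_ m) hm _.
  have -> : e_ m = fun n => ((sqn m)%:C%C)^-1 * tcoef gam 0 m n.
    apply/funext => n; rewrite /tcoef /tpol.
    have -> : rec_seq (fun n0 => (kap gam n0)%:P) (0%:P + 'X) n = 'X^n :> {poly C}.
      rewrite g0 add0r; elim/rec_ind2 : n => [||n h0 h1]; rewrite ?rec_seq0 ?rec_seq1//.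
      by rewrite rec_seqSS h1 /kap mul0r polyC0 mul0r subr0 -exprS.
    rewrite coefXn eq_sym /e_; case: eqP => [->|_]; last by rewrite !mulr0.
    by rewrite mulr1 mulVf// sqn_neq0.
  exact: clos_scale.
elim/rec_ind2 : m => [||m h0 h1]; first exact: clos_e0.
  have -> : e_ 1 = fun n => (gam * (wt 0)%:C%C)^-1 * jac 1 0 gam (e_ 0) n :> C.
    apply/funext => n; rewrite /jac /e_.
    have wn0 : (wt 0)%:C%C != 0 :> C by rewrite rc_eq0 gt_eqF// divr_gt0// sqn_gt0.
    case: n => [|[|n]]; rewrite /= ?(mulr0, mul0r, addr0, mulr1, add0r)//.
    by rewrite mulVf// mulf_neq0.
  apply: clos_scale; apply: clos_jac; rewrite ?oner_neq0 ?divr1//; exact: clos_e0.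
have wn0 k : (wt k)%:C%C != 0 :> C by rewrite rc_eq0 gt_eqF// divr_gt0// sqn_gt0.
have -> : e_ m.+2 = fun n => (gam * (wt m.+1)%:C%C)^-1 *
    (jac 1 0 gam (e_ m.+1) n - (wt m)%:C%C * e_ m n) :> C.
  apply/funext => n; rewrite /jac /e_ mul0r addr0 mul1r eqSS.
  have -> : (wt n)%:C%C * (n == m)%:R = (wt m)%:C%C * (n == m)%:R :> C.
    by case: eqP => [->|_]; rewrite ?mulr0.
  rewrite addrAC subrr add0r; case: n => [|n]; first by rewrite !mulr0.
  rewrite eqSS; case: eqP => [->|_]; last by rewrite !mulr0.
  by rewrite !mulr1 mulVf// mulf_neq0.
apply: clos_scale; apply: clos_sub; last exact: clos_scale.
by apply: clos_jac; rewrite ?oner_neq0 ?divr1.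
Qed.

Lemma clos_ell gam U s1 delta x r : nm gam < 1 -> region gam s1 -> 0 < delta ->
  (forall s, nm (s - s1) < delta -> U s) -> ell x r -> clos gam U x.
Proof.
move=> g1 rs1 d0 hU hx; apply: clos_lim => e e0.
have [N hN] := ell_tail hx e0.
exists (fun n => \sum_(m < N) x m * e_ m n).
  apply: (@clos_sum _ _ _ N (fun m n => x m * e_ m n)) => m _; apply: clos_scale.
  apply: (@clos_trans _ _ _ (region gam)); last exact: clos_e.
  exact: region_clos hU.
apply: ell_mono hN => n.
have -> : \sum_(m < N) x m * e_ m n = if (n < N)%N then x n else 0.
  rewrite -(sum_delta N n x); apply: eq_bigr => m _; rewrite /e_ eq_sym.
  by case: eqP => _; rewrite ?mulr1 ?mulr0.
by case: ifP => _; rewrite ?subrr// subr0.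
Qed.

End Density.

(** * The Godefroy-Shapiro construction for sequences *)

Section HypercyclicVector.
Context {R : realType}.
Local Notation C := R[i].
Implicit Types (x y : nat -> C) (r e : R) (U : C -> Prop) (l z : seq (C * C)).

Local Notation h2 := (2^-1 : R).

Lemma ell_telescope (Y : nat -> nat -> C) k :
  (forall i, (k <= i)%N -> ell (fun n => Y i.+1 n - Y i n) (h2 ^+ i)) ->
  forall j, (k <= j)%N -> ell (fun n => Y j n - Y k n) (2 * h2 ^+ k).
Proof.
move=> hY j kj; rewrite -(subnKC kj); move: (j - k)%N => d.
apply: (@ell_le _ _ (2 * h2 ^+ k - 2 * h2 ^+ (k + d))).
  by rewrite lerBlDr lerDl; have := h2_gt0 (R := R) (k + d); lra.
elim: d => [|d IH].
  by rewrite addn0 subrr; apply: ell_mono (ell0 (lexx 0)) => n; rewrite subrr.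
have := ell_add IH (hY _ (leq_addr d k)); rewrite addnS.
have -> : 2 * h2 ^+ k - 2 * h2 ^+ (k + d) + h2 ^+ (k + d) =
   2 * h2 ^+ k - 2 * h2 ^+ (k + d).+1 by rewrite [h2 ^+ (k + d)]h2S; ring.
apply: ell_mono => n.
rewrite [X in nm X <= _](_ : _ = Y (k + d)%N n - Y k n + (Y (k + d).+1 n - Y (k + d)%N n))//.
by ring.
Qed.

Lemma ell_complete (X : nat -> nat -> C) :
  (forall k, ell (fun n => X k.+1 n - X k n) (h2 ^+ k)) ->
  exists x, forall k, ell (fun n => x n - X k n) (2 * h2 ^+ k).
Proof.
move=> hX.
have hpt n : exists s, forall j, nm (s - X j n) <= 4 * h2 ^+ j.
  have [||k|s hs] := @gap_limitC R (fun k => X k n) (fun k => 2 * h2 ^+ k) (fun k => h2 ^+ k).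
  - by move=> k; rewrite mulr_ge0// ltW// h2_gt0.
  - by move=> k; have := h2S (R := R) k; lra.
  - exact: ell_pt (hX k).
  by exists s => j; have := hs j; lra.
have [x hx] := choice hpt; exists x => k.
apply: ell_lim; last by rewrite mulr_ge0// ltW// h2_gt0.
move=> N e e0; have [J hJ] := small_h2 (divr_gt0 e0 (ltr0Sn R 3)).
exists (fun n => X (maxn J k) n - X k n).
  by apply: ell_telescope; [move=> i _; exact: hX|exact: leq_maxr].
move=> n _; rewrite opprB addrA subrK (le_trans (hx n _))//.
by have := hJ (maxn J k) (leq_maxl _ _); lra.
Qed.

Lemma ell_finite x N : (forall n, (N <= n)%N -> x n = 0) -> exists r, ell x r.
Proof.
move=> hx; pose S := \sum_(n < N) nm (x n) ^+ 2.
have S0 : 0 <= S by rewrite sumr_ge0// => i _; exact: sqr_ge0.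
exists (1 + S); split; first by rewrite addr_ge0.
move=> M; apply: (@le_trans _ _ S); last by nra.
have [MN|NM] := leqP M N.
  rewrite [leLHS](big_ord_widen N (fun n => nm (x n) ^+ 2))// [leLHS]big_mkcond.
  by apply: ler_sum => i _; case: ifP => // _; exact: sqr_ge0.
rewrite /S [leRHS](big_ord_widen M (fun n => nm (x n) ^+ 2)) ?(ltnW NM)// [leRHS]big_mkcond.
apply: ler_sum => i _; case: ltnP => // Ni.
by rewrite hx// nm0 expr0n.
Qed.

(** A countable dense family: finitely supported sequences with rational entries, the default value
    being 0. *)
Definition rseq (q : seq (rat * rat)) (n : nat) : C :=
  Complex (ratr (nth (0, 0) q n).1) (ratr (nth (0, 0) q n).2).

Lemma rseq_ell q : exists r, ell (rseq q) r.
Proof.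
by apply: (@ell_finite _ (size q)) => n hn; rewrite /rseq nth_default//= rmorph0.
Qed.

Lemma rseq_dense x r e : ell x r -> 0 < e -> exists q, ell (fun n => x n - rseq q n) e.
Proof.
move=> hx e0; have e2 : 0 < e / 2 by rewrite divr_gt0.
have [N hN] := ell_tail hx e2.
pose d : R := e / 4 / N.+1%:R.
have d0 : 0 < d by rewrite !divr_gt0.
have hq n : exists q : rat * rat,
   `|complex.Re (x n) - ratr q.1| <= d /\ `|complex.Im (x n) - ratr q.2| <= d.
  have ap (s : R) : exists q : rat, `|s - ratr q| <= d.
    have : s - d < s + d by lra.
    move=> /rat_in_itvoo[q]; rewrite in_itv/= => /andP[h1 h2'].
    by exists q; rewrite ler_norml; apply/andP; split; lra.
  by have [q1 h1] := ap (complex.Re (x n)); have [q2 hh] := ap (complex.Im (x n)); exists (q1, q2).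
have [f hf] := choice hq.
exists (mkseq f N).
have h1 : ell (fun n => if (n < N)%N then x n - rseq (mkseq f N) n else 0) (e / 2).
  split; first exact: ltW.
  move=> M; apply: (@le_trans _ _ (\sum_(n < N) (2 * d) ^+ 2)).
    have hb n : nm (if (n < N)%N then x n - rseq (mkseq f N) n else 0) <=
        if (n < N)%N then 2 * d else 0.
      case: ifPn => nN; last by rewrite nm0.
      rewrite (le_trans (nm_le_ReIm _))// cReD cImD cReN cImN /rseq /= nth_mkseq//.
      by have [] := hf n; lra.
    apply: (@le_trans _ _ (\sum_(n < M) if (n < N)%N then (2 * d) ^+ 2 else 0)).
      apply: ler_sum => i _; have := hb i; case: ifP => _ h.
        by rewrite ler_pXn2r// ?nnegrE ?nm_ge0 ?mulr_ge0// ltW.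
      by rewrite nm0 expr0n.
    have [MN|NM] := leqP M N.
      rewrite (big_ord_widen N (fun n => if (n < N)%N then (2 * d) ^+ 2 else 0))// big_mkcond.
      apply: ler_sum => i _; rewrite ltn_ord; case: ifP => // _; exact: sqr_ge0.
    rewrite [leRHS](big_ord_widen M (fun n => (2 * d) ^+ 2)) ?(ltnW NM)// [leRHS]big_mkcond.
    exact: ler_sum.
  rewrite sumr_const card_ord -[leLHS]mulr_natr.
  have N1 : N%:R <= N.+1%:R ^+ 2 :> R.
    by rewrite -natrX ler_nat (leq_trans (leqnSn N))// -{1}[N.+1]expn1 leq_pexp2l.
  have -> : e / 2 = 2 * d * N.+1%:R by rewrite /d; field; rewrite addrC natr1 pnatr_eq0.
  by rewrite [leRHS]exprMn ler_wpM2l// sqr_ge0.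
rewrite [e]splitr; apply: ell_mono (ell_add h1 hN) => n.
case: ifPn => nN; first by rewrite addr0.
by rewrite add0r {1}/rseq nth_default ?size_mkseq 1?leqNgt//= rmorph0 subr0.
Qed.

(** Pairing a target with a free index gives it arbitrarily large codes, so each target is
    approached at arbitrarily late, hence precise, steps. *)
Lemma pickle_large (T : countType) (q : T) K : exists j : nat, (K <= pickle (q, j))%N.
Proof.
apply: contrapT => /forallNP hK.
have hlt (j : 'I_K.+1) : (pickle (q, j : nat) < K)%N.
  by rewrite ltnNge; apply/negP; exact: hK.
pose f (j : 'I_K.+1) : 'I_K := Ordinal (hlt j).
have finj : injective f.
  move=> i j /(congr1 val) /= /(pcan_inj pickleK) [] ij; exact: val_inj.
by have := leq_card f finj; rewrite !card_ord ltnn.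
Qed.

Context (a b c : C) (a0 : a != 0).
Local Notation gam := (c / a).
Context (g1 : nm gam < 1).
Local Notation J := (jac a b c).
Local Notation lam := (fun s : C => b + a * s).
Local Notation M := (nm a + nm b + nm c + 1).

Lemma it_add n x y : iter n J (fun k => x k + y k) = fun k => iter n J x k + iter n J y k.
Proof.
elim: n => [//|n IH]; rewrite iterS IH; apply/funext => k.
by rewrite jac_add.
Qed.

Lemma it_sub n x y : iter n J (fun k => x k - y k) = fun k => iter n J x k - iter n J y k.
Proof.
elim: n => [//|n IH]; rewrite iterS IH; apply/funext => k.
by rewrite jac_sub.
Qed.

Lemma M_ge1 : 1 <= M.
Proof. by rewrite lerDr !addr_ge0// nm_ge0. Qed.

Lemma it_ell n x r : ell x r -> ell (iter n J x) (M ^+ n * r).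
Proof.
move=> hx; elim: n => [|n IH]; first by rewrite expr0 mul1r.
rewrite iterS; apply: ell_le (ell_jac a b c IH).
rewrite exprS -mulrA ler_wpM2r ?(ell_ge0 IH)// lerDl//.
Qed.

Lemma lin_cons p l : lin gam (p :: l) = fun n => p.1 * ev gam p.2 n + lin gam l n.
Proof. by apply/funext => n; rewrite /lin big_cons. Qed.

Lemma lin_nil : lin gam [::] = fun=> 0.
Proof. by apply/funext => n; rewrite /lin big_nil. Qed.

Lemma jac_lin l : J (lin gam l) = lin gam [seq (lam p.2 * p.1, p.2) | p <- l].
Proof.
apply/funext => n; elim: l => [|p l IH].
  by rewrite /= lin_nil /jac; case: n => [|n]; rewrite !mulr0 !addr0.
rewrite lin_cons [map _ _]/= lin_cons jac_add IH jac_scale jac_ev//=.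
by congr (_ + _); ring.
Qed.

Lemma it_lin n l : iter n J (lin gam l) = lin gam [seq (lam p.2 ^+ n * p.1, p.2) | p <- l].
Proof.
elim: n => [|n IH].
  by congr lin; elim: l => [//|[u v] l {1}->] /=; rewrite expr0 mul1r.
rewrite iterS IH jac_lin -map_comp; congr lin; apply: eq_map => p /=.
by rewrite exprS mulrA.
Qed.

Lemma ev_ell s : region gam s -> exists r, ell (ev gam s) r.
Proof.
move=> [om hom sE].
have g0 := nm_ge0 gam; have o0 := nm_ge0 om.
pose t := 1 - (1 - nm gam) * (1 - nm om) / 2.
have t0 : 0 <= t by rewrite /t; nra.
have t1 : t < 1.
  by rewrite /t gtrBl divr_gt0// mulr_gt0// subr_gt0.
have t2 : t < (1 + t) / 2 by lra.
have t3 : (1 + t) / 2 < 1 by lra.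
have [B B0 hB] := taylor_tail gam t0 t2 t3.
have [w [v [hs hp vw]]] := quad_roots s gam.
have wt : nm w <= t by apply: (root_bound g1 hom (lexx _) vw _ hp); rewrite hs.
have := hB s w v hs hp wt (le_trans vw wt) 0 0.
rewrite nm0 => /(_ _) h; exists (B * (0 / (((1 + t) / 2 - t) ^+ 2 / 4)) ^+ 0).
apply: ell_mono (h _); last by rewrite divr_ge0// sqr_ge0.
by move=> n; rewrite big_ord0 subr0 addr0.
Qed.

Lemma lin_small U (f : C -> C) l : (forall s, U s -> region gam s) ->
  (forall s, U s -> nm (f s) < 1) -> supp U l ->
  forall e, 0 < e -> exists N, forall n, (N <= n)%N ->
    ell (lin gam [seq (f p.2 ^+ n * p.1, p.2) | p <- l]) e.
Proof.
move=> hU hf; elim: l => [_ e e0|p l IH sl e e0].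
  by exists 0 => n _; rewrite /= lin_nil; exact/ell0/ltW.
have e2 : 0 < e / 2 by rewrite divr_gt0.
have [|N hN] := IH _ _ e2; first by move=> q ql; apply: sl; rewrite inE ql orbT.
have Up : U p.2 by apply: sl; exact: mem_head.
have [r hr] := ev_ell (hU _ Up); have r0 := ell_ge0 hr.
pose A := nm p.1 * r + 1.
have A0 : 0 < A by rewrite ltr_wpDl// mulr_ge0// nm_ge0.
have [K hK] := pow_small (nm_ge0 (f p.2)) (hf _ Up) (divr_gt0 e2 A0).
exists (maxn N K) => n; rewrite geq_max => /andP[Nn Kn].
rewrite [map _ _]/= lin_cons [e]splitr; apply: ell_add; last exact: hN.
apply: ell_le (ell_scale (f p.2 ^+ n * p.1) hr) => /=.
have := ltW (hK n Kn); rewrite ler_pdivlMr// => h.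
rewrite nmM nmX -mulrA (le_trans _ h)// ler_wpM2l ?exprn_ge0 ?nm_ge0//.
by rewrite lerDl.
Qed.

Let U1 s := region gam s /\ nm (lam s) < 1.
Let U2 s := region gam s /\ 1 < nm (lam s).

Context (dense1 : forall x r, ell x r -> clos gam U1 x).
Context (dense2 : forall x r, ell x r -> clos gam U2 x).

(** Dividing the coefficients of [l] by n-th powers of their eigenvalues, of modulus above 1, gives
    a small vector that n iterations send back to [lin gam l]. The same n iterations make
    [lin gam L] small, its eigenvalues being of modulus below 1. *)
Lemma hyper_step L l m e : 0 < e -> supp U1 L -> supp U2 l ->
  exists z n, [/\ supp U1 z,
    forall i, (i <= m)%N -> ell (iter i J (lin gam z)) e,
    ell (iter n J (lin gam L)) e &
    ell (fun k => iter n J (lin gam z) k - lin gam l k) e].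
Proof.
move=> e0 sL sl.
have M0 : 0 < M := lt_le_trans ltr01 M_ge1.
have e2 : 0 < e / 2 by rewrite divr_gt0.
have [N1 hN1] := @lin_small U1 lam L (fun s => @proj1 _ _) (fun s => @proj2 _ _) sL e e0.
have hf s : U2 s -> nm (lam s)^-1 < 1.
  by move=> [_ h]; rewrite nmV invf_lt1// (lt_trans ltr01 h).
have em : 0 < e / 2 / M ^+ m by rewrite divr_gt0// exprn_gt0.
have [N2 hN2] := @lin_small U2 (fun s => (lam s)^-1) l (fun s => @proj1 _ _) hf sl _ em.
pose n := maxn N1 N2.
have nN1 : (N1 <= n)%N by exact: leq_maxl.
have nN2 : (N2 <= n)%N by exact: leq_maxr.
pose Sl := [seq ((lam p.2)^-1 ^+ n * p.1, p.2) | p <- l].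
have hS := hN2 n nN2; rewrite -/Sl in hS.
have en : 0 < e / 2 / M ^+ maxn n m by rewrite divr_gt0// exprn_gt0.
(* The preimage lies over [U2]; it is replaced by a close combination over [U1], where iterates tend
   to 0, so that it can join [L] at the next step. The precision survives max(n, m) applications of
   an operator of norm at most [M]. *)
have [z sz hz] := dense1 hS en.
have hz' : ell (fun k => lin gam z k - lin gam Sl k) (e / 2 / M ^+ maxn n m).
  by apply: ell_mono hz => k; rewrite nm_dist.
have Mle i j : (i <= j)%N -> M ^+ i <= M ^+ j by move=> ij; apply: ler_weXn2l => //; exact: M_ge1.
have it_small i : (i <= maxn n m)%N ->
    ell (fun k => iter i J (lin gam z) k - iter i J (lin gam Sl) k) (e / 2).
  move=> hi; rewrite -it_sub; apply: ell_le (it_ell i hz').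
  rewrite mulrA ler_pdivrMr ?exprn_gt0// mulrC ler_wpM2l ?(ltW e2)//.
  exact: Mle.
exists z, n; split=> //.
- move=> i im; rewrite [e]splitr.
  have h1 := it_small i (leq_trans im (leq_maxr _ _)).
  have h2' : ell (iter i J (lin gam Sl)) (e / 2).
    apply: ell_le (it_ell i hS).
    rewrite mulrA ler_pdivrMr ?exprn_gt0// mulrC ler_wpM2l ?(ltW e2)//.
    exact: Mle.
  by apply: ell_mono (ell_add h1 h2') => k; rewrite subrK.
- by rewrite it_lin; exact: hN1.
- have -> : lin gam l = iter n J (lin gam Sl).
    rewrite it_lin /Sl -map_comp; congr lin; rewrite -[LHS]map_id.
    apply/eq_in_map => p pl /=; have [_ hp] := sl p pl.
    have lp : lam p.2 != 0 by rewrite -nm_gt0 (lt_trans ltr01 hp).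
    by rewrite mulrA -exprMn divff// expr1n mul1r; case: p {pl hp lp}.
  by apply: ell_le (it_small n (leq_maxl _ _)); rewrite ler_pdivrMr// ler_peMr// ?ltW//; lra.
Qed.

(** The vector is the sum of the [z] given by [hyper_step]. A state records the step count, the list
    of all terms so far, the largest time used, the last term and the last time. The relation [step]
    is conditional because dependent choice asks for a successor of every state, also of those whose
    list is not over [U1]. *)
Lemma hypercyclic_vector : exists x r, ell x r /\
  forall d r', ell d r' -> forall e, 0 < e ->
    exists n, ell (fun k => iter n J x k - d k) e.
Proof.
pose dd (k : nat) : nat -> C :=
  if unpickle k is Some p then rseq (p : seq (rat * rat) * nat).1 else fun=> 0.
have hdd k : exists l, supp U2 l /\ ell (fun n => dd k n - lin gam l n) (h2 ^+ k).
  have [r hr] : exists r, ell (dd k) r.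
    rewrite /dd; case: unpickle => [[q j]|]; first exact: rseq_ell.
    by exists 0; exact: ell0.
  by have [l sl hl] := dense2 hr (h2_gt0 k); exists l.
have [y hy] := choice hdd.
pose X := (nat * seq (C * C) * nat * seq (C * C) * nat)%type.
pose cnt (s : X) := s.1.1.1.1; pose acc (s : X) := s.1.1.1.2.
pose mx (s : X) := s.1.1.2; pose zl (s : X) := s.1.2; pose nl (s : X) := s.2.
pose step (s s' : X) := [/\ cnt s' = (cnt s).+1, acc s' = acc s ++ zl s',
  mx s' = maxn (mx s) (nl s') & supp U1 (acc s) ->
   [/\ supp U1 (zl s'),
    forall i, (i <= mx s)%N -> ell (iter i J (lin gam (zl s'))) (h2 ^+ cnt s),
    ell (iter (nl s') J (lin gam (acc s))) (h2 ^+ cnt s) &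
    ell (fun k => iter (nl s') J (lin gam (zl s')) k - lin gam (y (cnt s)) k) (h2 ^+ cnt s)]].
have hstep s : {s' | step s s'}.
  apply: cid; have [hs|hs] := pselect (supp U1 (acc s)); last first.
    by exists ((cnt s).+1, acc s ++ [::], maxn (mx s) 0, [::], 0%N); split.
  have [z [n hzn]] := hyper_step (mx s) (h2_gt0 (cnt s)) hs (proj1 (hy (cnt s))).
  by exists ((cnt s).+1, acc s ++ z, maxn (mx s) n, z, n); split.
have [f [f0 fS]] := dependent_choice hstep (0%N, [::], 0%N, [::], 0%N).
have fcnt k : cnt (f k) = k.
  by elim: k => [|k IH]; [rewrite f0|have [-> _ _ _] := fS k; rewrite IH].
pose L k := acc (f k); pose z k := zl (f k.+1); pose n k := nl (f k.+1); pose m k := mx (f k).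
have LS k : L k.+1 = L k ++ z k by have [] := fS k.
have mS k : m k.+1 = maxn (m k) (n k) by have [] := fS k.
have sL k : supp U1 (L k).
  elim: k => [|k IH]; first by rewrite /L f0.
  by rewrite LS; apply: supp_cat => //; have [_ _ _ /(_ IH) []] := fS k.
have hz k i : (i <= m k)%N -> ell (iter i J (lin gam (z k))) (h2 ^+ k).
  by have [_ _ _ /(_ (sL k)) [_ + _ _]] := fS k; rewrite fcnt; apply.
have hL k : ell (iter (n k) J (lin gam (L k))) (h2 ^+ k).
  by have [_ _ _ /(_ (sL k)) [_ _ + _]] := fS k; rewrite fcnt.
have hzy k : ell (fun j => iter (n k) J (lin gam (z k)) j - lin gam (y k) j) (h2 ^+ k).
  by have [_ _ _ /(_ (sL k)) [_ _ _]] := fS k; rewrite fcnt.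
have nm_ k j : (k < j)%N -> (n k <= m j)%N.
  elim: j => [//|j IH]; rewrite ltnS leq_eqVlt mS => /orP[/eqP ->|/IH h].
    exact: leq_maxr.
  by rewrite (leq_trans h)// leq_maxl.
have linLS k : lin gam (L k.+1) = fun j => lin gam (L k) j + lin gam (z k) j.
  by apply/funext => j; rewrite LS lin_cat.
have [x hx] : exists x, forall k, ell (fun j => x j - lin gam (L k) j) (2 * h2 ^+ k).
  apply: ell_complete => k; rewrite linLS.
  by apply: ell_mono (hz k 0 (leq0n _)) => j /=; rewrite addrC addKr.
have L0 : lin gam (L 0) = fun=> 0 by rewrite /L f0 lin_nil.
exists x, (2 * h2 ^+ 0); split.
  by apply: ell_mono (hx 0) => j; rewrite L0 subr0.
(* At time [n k] the part [L k] has become small, [z k] is near its target, and the later terms are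
   still small, since [z i] was chosen small under all iterates up to [m i] >= [n k]. Each part
   contributes one h2^k. *)
have main k : ell (fun j => iter (n k) J x j - lin gam (y k) j) (3 * h2 ^+ k).
  have h1 : ell (fun j => iter (n k) J x j - iter (n k) J (lin gam (L k.+1)) j) (2 * h2 ^+ k.+1).
    apply: ell_lim; last by rewrite mulr_ge0// ltW// h2_gt0.
    move=> N e e0.
    have Mn0 : 0 < 2 * M ^+ n k by rewrite mulr_gt0// exprn_gt0// (lt_le_trans ltr01 M_ge1).
    have [K hK] := small_h2 (divr_gt0 e0 Mn0).
    exists (fun j => iter (n k) J (lin gam (L (maxn K k.+1))) j - iter (n k) J (lin gam (L k.+1)) j).
      apply: (@ell_telescope (fun i => iter (n k) J (lin gam (L i))) k.+1); last exact: leq_maxr.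
      move=> i ki; rewrite linLS it_add.
      by apply: ell_mono (hz i (n k) (nm_ _ _ ki)) => j; rewrite addrC addKr.
    move=> j _; rewrite opprB addrA subrK.
    have := ell_pt j (it_ell (n k) (hx (maxn K k.+1))); rewrite it_sub => /le_trans; apply.
    have := ltW (hK _ (leq_maxl K k.+1)); rewrite ler_pdivlMr// => /(le_trans _); apply.
    by rewrite le_eqVlt; apply/orP; left; apply/eqP; ring.
  have -> : 3 * h2 ^+ k = 2 * h2 ^+ k.+1 + h2 ^+ k + h2 ^+ k by rewrite -h2S; ring.
  apply: ell_mono (ell_add (ell_add h1 (hL k)) (hzy k)) => j.
  rewrite linLS it_add [X in nm X <= _](_ : _ = iter (n k) J x j -
    (iter (n k) J (lin gam (L k)) j + iter (n k) J (lin gam (z k)) j) +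
    iter (n k) J (lin gam (L k)) j + (iter (n k) J (lin gam (z k)) j - lin gam (y k) j))//.
  by ring.
move=> d r' hd e e0.
have [q hq] := rseq_dense hd (divr_gt0 e0 (ltr0Sn R 1)).
have [N hN] := small_h2 (divr_gt0 e0 (ltr0Sn R 7)).
have [j hj] := pickle_large q N.
pose k := pickle (q, j).
have ddk : dd k = rseq q by rewrite /dd /k pickleK.
exists (n k); have [_ hyk] := hy k; rewrite ddk in hyk.
apply: (@ell_le _ _ (3 * h2 ^+ k + h2 ^+ k + e / 2)).
  by have := hN _ hj; rewrite -/k; lra.
apply: ell_mono (ell_sub (ell_sub (main k) hyk) hq) => i.
rewrite [X in nm X <= _](_ : _ = iter (n k) J x i - lin gam (y k) i -
  (rseq q i - lin gam (y k) i) - (d i - rseq q i))//.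
by ring.
Qed.

End HypercyclicVector.

(** * Hypercyclicity of the matrix from two values of the symbol *)

Section SeqHypercyclic.
Context {R : realType}.
Local Notation C := R[i].

(** The inverse of om -> om + gam * conj om is s -> (s - gam * conj s) / (1 - |gam|^2), of norm at
    most 1 / (1 - |gam|); preimages of points close to the given one stay in the disc. *)
Lemma region_open (gam om : C) : nm gam < 1 -> nm om < 1 ->
  exists2 d : R, 0 < d & forall s, nm (s - (om + gam * conjc om)) < d -> region gam s.
Proof.
move=> g1 o1; have g0 := nm_ge0 gam.
exists ((1 - nm om) * (1 - nm gam)); first by rewrite mulr_gt0 ?subr_gt0.
move=> s hs; set s0 := om + gam * conjc om in hs.
have G0 : 0 < 1 - nm gam ^+ 2 by nra.
have GC : (1 - nm gam ^+ 2)%:C%C = 1 - gam * conjc gam :> C.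
  by rewrite mul_conj rcB rmorph1.
have GN : 1 - gam * conjc gam != 0 by rewrite -GC rc_eq0 gt_eqF.
exists (om + (s - s0 - gam * conjc (s - s0)) / (1 - gam * conjc gam)).
  rewrite (le_lt_trans (nmD _ _))// -ltrBrDl nmM nmV -GC (nm_pos (ltW G0)).
  rewrite ltr_pdivrMr// (le_lt_trans (nmB _ _))// nmM nm_conj.
  have -> : nm (s - s0) + nm gam * nm (s - s0) = nm (s - s0) * (1 + nm gam) by ring.
  have -> : (1 - nm om) * (1 - nm gam ^+ 2) = (1 - nm om) * (1 - nm gam) * (1 + nm gam) by ring.
  by rewrite ltr_pM2r// ltr_wpDr.
have GN' : 1 - conjc gam * gam != 0 by rewrite mulrC.
rewrite /s0 !(cjD, cjN, cjM, cjV, cj1, conjcK).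
by field; exact: GN'.
Qed.

Lemma seq_hypercyclic (a b c z1 z2 : C) : a != 0 -> nm c < nm a ->
  nm z1 < 1 -> nm z2 < 1 ->
  nm (a * conjc z1 + b + c * z1) < 1 -> 1 < nm (a * conjc z2 + b + c * z2) ->
  exists x r, ell x r /\
  forall d r', ell d r' -> forall e : R, 0 < e ->
    exists n, ell (fun k => iter n (jac a b c) x k - d k) e.
Proof.
move=> a0 ca z11 z21 h1 h2.
have g1 : nm (c / a) < 1 by rewrite nmM nmV ltr_pdivrMr ?nm_gt0// mul1r.
have na0 : 0 < nm a by rewrite nm_gt0.
have psiE z : a * conjc z + b + c * z = b + a * (conjc z + c / a * conjc (conjc z)).
  by rewrite conjcK; field.
rewrite !psiE in h1 h2.
have lip s s0 : nm (b + a * s) <= nm (b + a * s0) + nm a * nm (s - s0).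
  rewrite -nmM; have -> : b + a * s = b + a * s0 + a * (s - s0) by ring.
  exact: nmD.
have lip2 s s0 : nm (b + a * s0) <= nm (b + a * s) + nm a * nm (s - s0).
  by rewrite nm_dist lip.
rewrite -nm_conj in z11; rewrite -nm_conj in z21.
have [d1 d10 hd1] := region_open g1 z11.
have [d2 d20 hd2] := region_open g1 z21.
have reg z : nm (conjc z) < 1 -> region (c / a) (conjc z + c / a * conjc (conjc z)).
  by move=> hz; exists (conjc z).
apply: (@hypercyclic_vector _ a b c a0 g1).
  move=> x r; set s1 := conjc z1 + _ in h1 hd1.
  pose e := (1 - nm (b + a * s1)) / nm a.
  have e0 : 0 < e by rewrite divr_gt0// subr_gt0.
  apply: (@clos_ell _ _ _ s1 (Num.min d1 e) x r g1 (reg _ z11)) => [|s]; first by rewrite lt_min d10.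
  rewrite lt_min => /andP[hs hs2]; split; first exact: hd1.
  rewrite (le_lt_trans (lip s s1))//.
  by move: hs2; rewrite /e ltr_pdivlMr// mulrC; lra.
move=> x r; set s2 := conjc z2 + _ in h2 hd2.
pose e := (nm (b + a * s2) - 1) / nm a.
have e0 : 0 < e by rewrite divr_gt0// subr_gt0.
apply: (@clos_ell _ _ _ s2 (Num.min d2 e) x r g1 (reg _ z21)) => [|s]; first by rewrite lt_min d20.
rewrite lt_min => /andP[hs hs2]; split; first exact: hd2.
have := lip2 s s2.
by move: hs2; rewrite /e ltr_pdivlMr// mulrC; lra.
Qed.

End SeqHypercyclic.

(** * Holomorphic functions on the disc *)

Section Polar.
Context {R : realType}.
Local Notation C := R[i].
Local Notation ii := (Complex 0 1 : C).

Definition pz (r t : R) : C := Complex (r * cos t) (r * sin t).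

Lemma nm_pz r t : nm (pz r t) = `|r|.
Proof.
apply/eqP; rewrite -(@eqrXn2 _ 2)// ?nm_ge0// nm_sqr /= !exprMn -mulrDr cos2Dsin2 mulr1.
by rewrite real_normK// num_real.
Qed.

Lemma pzE r t : pz r t = r%:C%C * pz 1 t.
Proof. by apply: complex_eq; rewrite ?cReM ?cImM /= !mul1r mul0r ?subr0 ?addr0. Qed.

Lemma pz_2pi r : pz r (pi *+ 2) = pz r 0.
Proof. by rewrite /pz -[pi *+ 2]add0r cosD2pi sinD2pi. Qed.

Lemma cos_sin_lip (x y : R) : `|cos x - cos y| <= `|x - y| /\ `|sin x - sin y| <= `|x - y|.
Proof.
wlog xy : x y / y <= x => [h|].
  case: (leP y x) => [/h//|/ltW /h [h1 h2]].
  by split; rewrite distrC [`|x - y|]distrC.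
have lip (f df : R -> R) : (forall z : R, is_derive z (1 : R) f (df z)) -> (forall z : R, `|df z| <= 1) ->
    `|f x - f y| <= `|x - y|.
  move=> hf hd.
  have cf : {within `[y, x], continuous f}.
    apply: continuous_subspaceT => z; apply: differentiable_continuous.
    by apply/derivable1_diffP; case: (hf z).
  have [c _ ->] := MVT_segment xy (fun z _ => hf z) cf.
  by rewrite normrM ler_piMl.
split.
  apply: (lip cos (fun z => - sin z)) => z; rewrite normrN ler_norml.
  by rewrite sin_geN1 sin_le1.
by apply: (lip sin cos) => z; rewrite ler_norml cos_geN1 cos_le1.
Qed.

Lemma pz_dist r t r0 t0 : nm (pz r t - pz r0 t0) <= `|r - r0| + 2 * `|r| * `|t - t0|.
Proof.
have -> : pz r t - pz r0 t0 = (pz r t - pz r t0) + (pz r t0 - pz r0 t0) by rewrite addrA subrK.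
rewrite addrC (le_trans (nmD _ _))// lerD//.
  rewrite (_ : pz r t0 - pz r0 t0 = pz (r - r0) t0) ?nm_pz//.
  by apply: complex_eq; rewrite ?cReD ?cImD ?cReN ?cImN /=; ring.
rewrite (le_trans (nm_le_ReIm _))// cReD cImD cReN cImN /= -!mulrBr !normrM -mulrDr.
have [h1 h2] := cos_sin_lip t t0.
by rewrite [2 * _]mulrC -mulrA ler_wpM2l// mulr_natl mulr2n lerD.
Qed.

Lemma ccont_pzr t r0 : ccont (fun r => pz r t) r0.
Proof.
apply: (@ccont_lip _ _ _ 1) => r; rewrite (le_trans (pz_dist _ _ _ _))//.
by rewrite subrr normr0 mulr0 addr0 mul1r.
Qed.

Lemma ccont_pzt r t0 : ccont (fun t => pz r t) t0.
Proof.
apply: (@ccont_lip _ _ _ (2 * `|r|)) => t; rewrite (le_trans (pz_dist _ _ _ _))//.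
by rewrite subrr normr0 add0r.
Qed.

Lemma cd_pzr t r : cd (fun r => pz r t) r (pz 1 t).
Proof.
rewrite (_ : (fun r => pz r t) = (fun y : R => y%:C%C * pz 1 t)); last first.
  by apply/funext => s; exact: pzE.
have h : cd (fun y : R => y%:C%C : C) r 1 by split; [exact: is_derive_id|exact: is_derive_cst].
by have := cdM h (cd_cst (pz 1 t) r); rewrite mulr0 addr0 mul1r.
Qed.

Lemma cd_pzt r t : cd (fun t => pz r t) t (ii * pz r t).
Proof.
split; rewrite ?cReM ?cImM /=.
  rewrite (_ : (fun y : R => r * cos y) = r \*: (cos : R -> R))//.
  by apply: is_derive_eq; rewrite /GRing.scale /=; ring.
rewrite (_ : (fun y : R => r * sin y) = r \*: (sin : R -> R))//.
by apply: is_derive_eq; rewrite /GRing.scale /=; ring.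
Qed.

Lemma cdD (h k : R -> C) x dh dk : cd h x dh -> cd k x dk ->
  cd (fun y => h y + k y) x (dh + dk).
Proof.
move=> [hr hi] [kr ki]; split.
  rewrite (_ : (fun y => complex.Re (h y + k y)) =
    (fun y => complex.Re (h y)) + (fun y => complex.Re (k y))).
    by apply: is_derive_eq; rewrite cReD.
  by apply/funext => y; rewrite cReD.
rewrite (_ : (fun y => complex.Im (h y + k y)) =
  (fun y => complex.Im (h y)) + (fun y => complex.Im (k y))).
  by apply: is_derive_eq; rewrite cImD.
by apply/funext => y; rewrite cImD.
Qed.

Definition edge_r (F : C -> C) t r1 r2 := cint r1 r2 (fun r => F (pz r t) * pz 1 t).
Definition edge_t (F : C -> C) r t1 t2 := cint t1 t2 (fun t => F (pz r t) * (ii * pz r t)).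

(* The integral of [F dz] along the boundary of a polar rectangle. *)
Definition polar_rect F r1 r2 t1 t2 :=
  edge_r F t1 r1 r2 - edge_r F t2 r1 r2 + edge_t F r2 t1 t2 - edge_t F r1 t1 t2.

Definition zc_on (F : C -> C) (r1 r2 : R) := forall z, r1 <= nm z <= r2 -> zcont F z.

Lemma contab_edge_r F t r1 r2 : 0 <= r1 -> zc_on F r1 r2 ->
  contab r1 r2 (fun r => F (pz r t) * pz 1 t).
Proof.
move=> r10 hF r /andP[h1 h2]; apply: ccontM; last exact: ccont_cst.
apply: (@zcont_comp _ F (fun r => pz r t)); first exact: ccont_pzr.
by apply: hF; rewrite nm_pz ger0_norm ?h1// (le_trans r10).
Qed.

Lemma contab_edge_t F r r1 r2 t1 t2 : 0 <= r1 -> r1 <= r <= r2 -> zc_on F r1 r2 ->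
  contab t1 t2 (fun t => F (pz r t) * (ii * pz r t)).
Proof.
move=> r10 /andP[h1 h2] hF t _; apply: ccontM.
  apply: (@zcont_comp _ F (fun t => pz r t)); first exact: ccont_pzt.
  by apply: hF; rewrite nm_pz ger0_norm ?h1// (le_trans r10).
by apply: ccontM; [exact: ccont_cst|exact: ccont_pzt].
Qed.

Lemma zc_onS F r1 r2 s1 s2 : r1 <= s1 -> s2 <= r2 -> zc_on F r1 r2 -> zc_on F s1 s2.
Proof.
move=> h1 h2 hF z /andP[k1 k2]; apply: hF.
by rewrite (le_trans h1 k1) (le_trans k2 h2).
Qed.

Lemma polar_split F r1 rm r2 t1 tm t2 : 0 <= r1 -> r1 <= rm <= r2 -> t1 <= tm <= t2 ->
  zc_on F r1 r2 ->
  polar_rect F r1 r2 t1 t2 = polar_rect F r1 rm t1 tm + polar_rect F r1 rm tm t2 +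
    (polar_rect F rm r2 t1 tm + polar_rect F rm r2 tm t2).
Proof.
move=> r10 /andP[rm1 rm2] tm12 hF.
have [tm1 tm2] := andP tm12.
have er t : edge_r F t r1 r2 = edge_r F t r1 rm + edge_r F t rm r2.
  by apply: cint_split; [rewrite rm1|exact: contab_edge_r].
have et r : r1 <= r <= r2 -> edge_t F r t1 t2 = edge_t F r t1 tm + edge_t F r tm t2.
  by move=> hr; apply: cint_split => //; exact: (contab_edge_t r10 hr hF).
rewrite /polar_rect !er !et ?lexx ?(le_trans rm1 rm2)//.
move: (edge_r F t1 r1 rm) (edge_r F t1 rm r2) (edge_r F t2 r1 rm) (edge_r F t2 rm r2).
move: (edge_r F tm r1 rm) (edge_r F tm rm r2) (edge_t F r1 t1 tm) (edge_t F r1 tm t2).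
move: (edge_t F rm t1 tm) (edge_t F rm tm t2) (edge_t F r2 t1 tm) (edge_t F r2 tm t2) => *.
by ring.
Qed.

Lemma polar_rectD F G r1 r2 t1 t2 : 0 <= r1 -> r1 <= r2 -> zc_on F r1 r2 -> zc_on G r1 r2 ->
  polar_rect (fun z => F z + G z) r1 r2 t1 t2 =
  polar_rect F r1 r2 t1 t2 + polar_rect G r1 r2 t1 t2.
Proof.
move=> r10 r12 hF hG.
have er t : edge_r (fun z => F z + G z) t r1 r2 = edge_r F t r1 r2 + edge_r G t r1 r2.
  rewrite /edge_r -cintD; [|exact: contab_edge_r|exact: contab_edge_r].
  by apply: cint_eq => x _; rewrite mulrDl.
have et r : r1 <= r <= r2 ->
    edge_t (fun z => F z + G z) r t1 t2 = edge_t F r t1 t2 + edge_t G r t1 t2.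
  move=> hr; rewrite /edge_t -cintD;
    [|exact: (contab_edge_t r10 hr hF)|exact: (contab_edge_t r10 hr hG)].
  by apply: cint_eq => x _; rewrite mulrDl.
rewrite /polar_rect !er !et ?lexx ?r12//.
by ring.
Qed.

Lemma zcont_affine (al be : C) z : zcont (fun z => al + be * z) z.
Proof.
move=> e e0; pose b := nm be + 1; have b0 : 0 < b by rewrite ltr_wpDl// nm_ge0.
exists (e / b); first by rewrite divr_gt0.
move=> y; rewrite ltr_pdivlMr// => hy.
have -> : al + be * y - (al + be * z) = be * (y - z) by ring.
rewrite nmM (le_trans _ (ltW hy))// mulrC ler_wpM2l ?nm_ge0// lerDl//.
Qed.

(** Affine functions have a primitive, whose values at the four corners cancel. *)
Lemma polar_affine (al be : C) r1 r2 t1 t2 : 0 <= r1 -> r1 < r2 -> t1 < t2 ->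
  polar_rect (fun z => al + be * z) r1 r2 t1 t2 = 0.
Proof.
move=> r10 r12 t12.
pose W (z : C) := (al + be / 2 * z) * z.
have zc : zc_on (fun z => al + be * z) r1 r2 by move=> z _; exact: zcont_affine.
have cdW (h : R -> C) x d : cd h x d -> cd (fun y => W (h y)) x ((al + be * h x) * d).
  move=> hd; have -> : (al + be * h x) * d =
      (0 + (0 * h x + be / 2 * d)) * h x + (al + be / 2 * h x) * d by field.
  apply: cdM => //; apply: cdD; first exact: cd_cst.
  by apply: cdM => //; exact: cd_cst.
have er t : edge_r (fun z => al + be * z) t r1 r2 = W (pz r2 t) - W (pz r1 t).
  apply: (@cint_FTC _ _ _ (fun r => W (pz r t))) => // [x _|]; last exact: (contab_edge_r t r10 zc).
  exact: cdW (cd_pzr t x).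
have et r : r1 <= r <= r2 ->
    edge_t (fun z => al + be * z) r t1 t2 = W (pz r t2) - W (pz r t1).
  move=> hr; apply: (@cint_FTC _ _ _ (fun t => W (pz r t))) => // [x _|].
    exact: cdW (cd_pzt r x).
  exact: (contab_edge_t r10 hr zc).
rewrite /polar_rect !er !et ?lexx ?(ltW r12)//.
by ring.
Qed.

Lemma polar_bound F r1 r2 t1 t2 (M : R) : 0 <= r1 -> r1 <= r2 -> t1 <= t2 ->
  zc_on F r1 r2 ->
  (forall r t, r1 <= r <= r2 -> t1 <= t <= t2 -> nm (F (pz r t)) <= M) ->
  nm (polar_rect F r1 r2 t1 t2) <= 4 * M * ((r2 - r1) + r2 * (t2 - t1)).
Proof.
move=> r10 r12 t12 hF hM.
have M0 : 0 <= M by apply: le_trans (hM r1 t1 _ _); rewrite ?nm_ge0 ?lexx.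
have er t : t1 <= t <= t2 -> nm (edge_r F t r1 r2) <= 2 * M * (r2 - r1).
  move=> ht; apply: cint_bound => //; first exact: contab_edge_r.
  by move=> x hx; rewrite nmM nm_pz normr1 mulr1 hM.
have et r : r1 <= r <= r2 -> nm (edge_t F r t1 t2) <= 2 * M * (r2 * (t2 - t1)).
  move=> hr; have [h1 h2] := andP hr.
  have -> : 2 * M * (r2 * (t2 - t1)) = 2 * (M * r2) * (t2 - t1) by ring.
  apply: cint_bound => //; first exact: (contab_edge_t r10 hr hF).
  move=> x hx; rewrite !nmM nm_pz ger0_norm ?(le_trans r10)//.
  have -> : nm ii = 1 by rewrite /Normc.normc expr0n expr1n add0r sqrtr1.
  by rewrite mul1r ler_pM ?nm_ge0 ?(le_trans r10) ?hM.
rewrite /polar_rect (le_trans (nmB _ _))// (_ : 4 * M * _ =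
  2 * M * (r2 - r1) + 2 * M * (r2 - r1) + 2 * M * (r2 * (t2 - t1)) + 2 * M * (r2 * (t2 - t1))); last by ring.
rewrite lerD ?et ?lexx ?r12// (le_trans (nmD _ _))// lerD ?et ?lexx ?r12//.
by rewrite (le_trans (nmB _ _))// lerD ?er ?lexx ?t12.
Qed.

End Polar.

(** * Goursat's theorem for polar rectangles *)

Section Goursat.
Context {R : realType}.
Local Notation C := R[i].
Local Notation h2 := (2^-1 : R).

Lemma near_itv (x r s w : R) : x <= r <= x + w -> `|s - x| <= 2 * w -> `|r - s| <= 3 * w.
Proof. by move=> /andP[? ?]; rewrite !ler_norml => /andP[? ?]; apply/andP; split; lra. Qed.

Lemma nm_quarter (m : R) (I1 I2 I3 I4 : C) : m * 4 <= nm (I1 + I2 + (I3 + I4)) ->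
  [\/ m <= nm I1, m <= nm I2, m <= nm I3 | m <= nm I4].
Proof.
move=> h; have [|h1] := leP m (nm I1); first by constructor 1.
have [|h2'] := leP m (nm I2); first by constructor 2.
have [|h3] := leP m (nm I3); first by constructor 3.
constructor 4; move: (le_trans h (nmD _ _)) (nmD I1 I2) (nmD I3 I4); lra.
Qed.

(** Bisection in both polar coordinates keeps a quarter carrying at least a fourth of the integral;
    near the limit point [F] is compared with its affine approximation, whose integral vanishes.
    Polar rectangles have circular arcs as sides, so the full circle needs no deformation of
    contours. *)
Lemma goursat (F : C -> C) r1 r2 t1 t2 : 0 <= r1 -> r1 < r2 -> t1 < t2 ->
  (forall z, r1 <= nm z <= r2 -> cder F z) -> polar_rect F r1 r2 t1 t2 = 0.
Proof.
move=> r10 r12 t12 hF.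
have zcF : zc_on F r1 r2 by move=> z /hF; exact: derivable_zcont.
pose A := r2 - r1; pose B := t2 - t1.
have A0 : 0 < A by rewrite subr_gt0.
have B0 : 0 < B by rewrite subr_gt0.
pose I n x y := nm (polar_rect F x (x + A * h2 ^+ n) y (y + B * h2 ^+ n)).
pose N0 := nm (polar_rect F r1 r2 t1 t2).
pose P n x y := [/\ r1 <= x, x + A * h2 ^+ n <= r2 & N0 * (h2 ^+ n) ^+ 2 <= I n x y].
pose X := (nat * R * R)%type.
(* The implication makes the relation total, as dependent choice requires; [P] is then propagated
   from the initial rectangle. *)
pose step (s s' : X) := s'.1.1 = s.1.1.+1 /\ (P s.1.1 s.1.2 s.2 ->
  [/\ P s'.1.1 s'.1.2 s'.2, `|s'.1.2 - s.1.2| <= A * h2 ^+ s.1.1 &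
      `|s'.2 - s.2| <= B * h2 ^+ s.1.1]).
have hstep s : {s' | step s s'}.
  apply: cid; case: s => [[n x] y].
  have [[p1 p2 p3]|hP] := pselect (P n x y); last first.
    by exists (n.+1, x, y); split.
  have An := mulr_gt0 A0 (h2_gt0 n.+1); have Bn := mulr_gt0 B0 (h2_gt0 n.+1).
  have An2 : A * h2 ^+ n = A * h2 ^+ n.+1 + A * h2 ^+ n.+1 by rewrite [h2 ^+ n]h2S; ring.
  have Bn2 : B * h2 ^+ n = B * h2 ^+ n.+1 + B * h2 ^+ n.+1 by rewrite [h2 ^+ n]h2S; ring.
  have x0 : 0 <= x by rewrite (le_trans r10).
  move: p3; rewrite /I (@polar_split _ F x (x + A * h2 ^+ n.+1) _ y (y + B * h2 ^+ n.+1))//; first last.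
  - by apply: zc_onS zcF.
  - by rewrite Bn2; apply/andP; split; lra.
  - by rewrite An2; apply/andP; split; lra.
  have [-> ->] : x + A * h2 ^+ n = x + A * h2 ^+ n.+1 + A * h2 ^+ n.+1 /\
    y + B * h2 ^+ n = y + B * h2 ^+ n.+1 + B * h2 ^+ n.+1 by rewrite An2 Bn2 !addrA.
  set x' := x + _; set y' := y + _.
  have -> : N0 * (h2 ^+ n) ^+ 2 = N0 * (h2 ^+ n.+1) ^+ 2 * 4 by rewrite [h2 ^+ n]h2S; ring.
  set Nn := N0 * _; set I1 := polar_rect _ _ _ _ _; set I2 := polar_rect _ _ _ _ _.
  set I3 := polar_rect _ _ _ _ _; set I4 := polar_rect _ _ _ _ _ => hI.
  have hor := nm_quarter hI.
  have xx : `|x - x| <= A * h2 ^+ n by rewrite subrr normr0 An2; lra.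
  have yy : `|y - y| <= B * h2 ^+ n by rewrite subrr normr0 Bn2; lra.
  have xx' : `|x' - x| <= A * h2 ^+ n.
    by rewrite /x' [x + _]addrC addrK gtr0_norm// An2; lra.
  have yy' : `|y' - y| <= B * h2 ^+ n.
    by rewrite /y' [y + _]addrC addrK gtr0_norm// Bn2; lra.
  have xr : x + A * h2 ^+ n.+1 <= r2 by rewrite An2 in p2; lra.
  have xr' : x' + A * h2 ^+ n.+1 <= r2 by rewrite An2 in p2; rewrite /x'; lra.
  have rx' : r1 <= x' by rewrite /x'; lra.
  by case: hor => h; [exists (n.+1, x, y)|exists (n.+1, x, y')|exists (n.+1, x', y)
    |exists (n.+1, x', y')]; split.
have [f [f0 fS]] := dependent_choice hstep (0%N, r1, t1).
have fn k : (f k).1.1 = k by elim: k => [|k IH]; [rewrite f0|have [-> _] := fS k; rewrite IH].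
have fP k : P k (f k).1.2 (f k).2.
  elim: k => [|k IH].
    rewrite f0 /P /I /= !expr0 !mulr1 expr1n mulr1 /A /B !(addrC _ (_ - _)) !subrK.
    by split; rewrite ?lexx.
  by have [e1 h] := fS k; move: (h); rewrite e1 !fn => /(_ IH) [].
have lim2 (u : nat -> R) (L : R) : 0 <= L -> (forall k, `|u k.+1 - u k| <= L * h2 ^+ k) ->
    exists s, forall k, `|s - u k| <= 2 * L * h2 ^+ k.
  move=> L0 hu; apply: (@gap_limit _ u (fun k => 2 * L * h2 ^+ k) (fun k => L * h2 ^+ k)) => // k.
    by rewrite !mulr_ge0// ltW// h2_gt0.
  by rewrite [h2 ^+ k]h2S; lra.
have [xs hxs] : exists s, forall k, `|s - (f k).1.2| <= 2 * A * h2 ^+ k.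
  apply: (lim2 (fun k => (f k).1.2)) => [|k]; first exact: ltW.
  by have [e1 h] := fS k; have := fP k; rewrite -{1}[k]fn => /h [_]; rewrite fn.
have [ys hys] : exists s, forall k, `|s - (f k).2| <= 2 * B * h2 ^+ k.
  apply: (lim2 (fun k => (f k).2)) => [|k]; first exact: ltW.
  by have [e1 h] := fS k; have := fP k; rewrite -{1}[k]fn => /h [_ _]; rewrite fn.
have xs1 : r1 <= xs.
  apply: (@le_small_h2 R _ _ (2 * A)) => k; have [p1 _ _] := fP k.
  by have := hxs k; rewrite ler_norml => /andP[]; lra.
have xs2 : xs <= r2.
  apply: (@le_small_h2 R _ _ (2 * A)) => k; have [_ p2 _] := fP k.
  have := hxs k; rewrite ler_norml => /andP[].
  by have := mulr_gt0 A0 (h2_gt0 k); lra.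
have xs0 : 0 <= xs by lra.
have hFp : cder F (pz xs ys) by apply: hF; rewrite nm_pz ger0_norm ?xs1.
have [d hd] := (derivable_lin _ _).1 hFp.
(* S * h2^n bounds the distance from points of the n-th rectangle to the limit point: a side, plus
   twice a side from the limit estimate, with 2 r2 for the angle. [K] collects supremum and
   perimeter, both of order h2^n, against the factor 4^-n. *)
pose S := 3 * A + 6 * r2 * B; pose K := 4 * S * (A + r2 * B).
have r20 : 0 < r2 by lra.
have S0 : 0 < S by apply: addr_gt0; rewrite !mulr_gt0.
have K0 : 0 < K by apply: mulr_gt0; [rewrite mulr_gt0|apply: addr_gt0 => //; rewrite mulr_gt0].
suff hN (e : R) : 0 < e -> N0 <= e * K.
  apply/eqP; rewrite -nm_eq0 -/N0; apply/eqP/le_anti; rewrite nm_ge0 andbT.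
  apply/ler_addgt0Pr => e e0; rewrite add0r (le_trans (hN (e / K) _))//.
    by rewrite divr_gt0.
  by rewrite divfK// gt_eqF.
move=> e0.
have [del del0 hdel] := hd e e0.
have [n hn] := small_h2 (divr_gt0 del0 S0).
have := hn n (leqnn _); rewrite ltr_pdivlMr// => hnS.
have [p1 p2 p3] := fP n.
set x := (f n).1.2 in p1 p2 p3 *; set y := (f n).2 in p3 *.
have x0 : 0 <= x by lra.
have An := mulr_gt0 A0 (h2_gt0 n); have Bn := mulr_gt0 B0 (h2_gt0 n).
(* [F] minus its affine approximation at the limit point: same integral, but of size at most e times
   the distance. *)
pose G z := F z + (- (F (pz xs ys) - d * pz xs ys) + (- d) * z).
have zcx : zc_on F x (x + A * h2 ^+ n) by apply: zc_onS zcF.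
have zca : zc_on (fun z => - (F (pz xs ys) - d * pz xs ys) + (- d) * z) x (x + A * h2 ^+ n).
  by move=> z _; exact: zcont_affine.
have GE : polar_rect G x (x + A * h2 ^+ n) y (y + B * h2 ^+ n) =
    polar_rect F x (x + A * h2 ^+ n) y (y + B * h2 ^+ n).
  rewrite polar_rectD//; last by rewrite lerDl ltW.
  by rewrite polar_affine ?addr0// ltrDl.
have zcG : zc_on G x (x + A * h2 ^+ n).
  move=> z hz; apply: derivable_zcont; apply: derivableD.
    by apply: hF; have [z1 z2] := andP hz; rewrite (le_trans p1 z1) (le_trans z2 p2).
  apply: derivableD; first exact: derivable_cst.
  by apply: derivableM; [exact: derivable_cst|exact: derivable_id].
have hG r t : x <= r <= x + A * h2 ^+ n -> y <= t <= y + B * h2 ^+ n ->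
    nm (G (pz r t)) <= e * (S * h2 ^+ n).
  move=> /andP[k1 k2] /andP[l1 l2].
  have dist : nm (pz r t - pz xs ys) <= S * h2 ^+ n.
    rewrite (le_trans (pz_dist _ _ _ _))//.
    have h1 : `|r - xs| <= 3 * A * h2 ^+ n.
      by have := hxs n; rewrite -!mulrA; apply: near_itv; rewrite k1.
    have h3 : `|t - ys| <= 3 * B * h2 ^+ n.
      by have := hys n; rewrite -!mulrA; apply: near_itv; rewrite l1.
    have hr : `|r| <= r2 by rewrite ger0_norm; [exact: le_trans k2 p2|exact: le_trans x0 k1].
    have h4 : 2 * `|r| * `|t - ys| <= 2 * r2 * (3 * B * h2 ^+ n).
      by rewrite ler_pM ?mulr_ge0// ler_wpM2l.
    by rewrite /S; move: h1 h4; clear; lra.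
  have := hdel (pz r t) (le_lt_trans dist _); rewrite mulrC => /(_ hnS) hle.
  have -> : G (pz r t) = F (pz r t) - F (pz xs ys) - d * (pz r t - pz xs ys) by rewrite /G; ring.
  rewrite (le_trans hle)// mulrC ler_wpM2l// ltW//.
have := @polar_bound _ G x (x + A * h2 ^+ n) y (y + B * h2 ^+ n) _ x0 _ _ zcG hG.
rewrite !lerDl => /(_ (ltW An) (ltW Bn)); rewrite GE => hI.
have hI2 : N0 * (h2 ^+ n) ^+ 2 <= e * K * (h2 ^+ n) ^+ 2.
  rewrite (le_trans p3)// (le_trans hI)//.
  have -> : x + A * h2 ^+ n - x = A * h2 ^+ n by ring.
  have -> : y + B * h2 ^+ n - y = B * h2 ^+ n by ring.
  have -> : e * K * (h2 ^+ n) ^+ 2 = 4 * (e * (S * h2 ^+ n)) * (A * h2 ^+ n + r2 * (B * h2 ^+ n)).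
    by rewrite /K; ring.
  rewrite ler_wpM2l ?mulr_ge0 ?(ltW e0) ?(ltW S0) ?(ltW (h2_gt0 _))//.
  by rewrite lerD2l ler_wpM2r// ltW.
by rewrite ler_pM2r// exprn_gt0// h2_gt0 in hI2.
Qed.

End Goursat.

(** * Contour integrals over circles *)

Section CircleMean.
Context {R : realType}.
Local Notation C := R[i].
Local Notation ii := (Complex 0 1 : C).

Definition twopi_i : C := (pi *+ 2)%:C%C * ii.

(* The contour integral of [F] over the circle of radius [r], divided by [2 pi i]. *)
Definition avg (F : C -> C) (r : R) : C := edge_t F r 0 (pi *+ 2) / twopi_i.

Definition cder_circ (F : C -> C) (r : R) := forall z, nm z = r -> cder F z.

Lemma ii_neq0 : ii != 0. Proof. by rewrite eq_complex /= oner_eq0 andbF. Qed.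

Lemma twopi_gt0 : 0 < pi *+ 2 :> R. Proof. by rewrite mulrn_wgt0// pi_gt0. Qed.

Lemma twopi_i_neq0 : twopi_i != 0.
Proof. by rewrite mulf_neq0 ?ii_neq0// rc_eq0 gt_eqF// twopi_gt0. Qed.

Lemma nm_twopi_i : nm twopi_i = pi *+ 2.
Proof.
rewrite nmM nm_pos ?(ltW twopi_gt0)//.
have -> : nm ii = 1 by rewrite /Normc.normc expr0n expr1n add0r sqrtr1.
by rewrite mulr1.
Qed.

Lemma cderD (F G : C -> C) z : cder F z -> cder G z -> cder (fun y => F y + G y) z.
Proof. exact: derivableD. Qed.
Lemma cderB (F G : C -> C) z : cder F z -> cder G z -> cder (fun y => F y - G y) z.
Proof. exact: derivableB. Qed.
Lemma cderM (F G : C -> C) z : cder F z -> cder G z -> cder (fun y => F y * G y) z.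
Proof. exact: derivableM. Qed.
Lemma cder_cst (k z : C) : cder (fun _ : C => k) z.
Proof. exact: derivable_cst. Qed.
Lemma cder_id (z : C) : cder (fun y : C => y) z.
Proof. exact: derivable_id. Qed.
Lemma cderV (F : C -> C) z : F z != 0 -> cder F z -> cder (fun y => (F y)^-1) z.
Proof. exact: derivableV. Qed.
Lemma cderX (F : C -> C) n z : cder F z -> cder (fun y => F y ^+ n) z.
Proof.
move=> hF; elim: n => [|n IH]; first exact: cder_cst.
by under eq_fun do rewrite exprS; exact: cderM.
Qed.

Lemma cder_sum (F : nat -> C -> C) N z : (forall n, cder (F n) z) ->
  cder (fun y => \sum_(n < N) F n y) z.
Proof.
move=> hF; elim: N => [|N IH].
  by under eq_fun do rewrite big_ord0; exact: cder_cst.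
under eq_fun do rewrite big_ord_recr/=.
exact: (cderD IH (hF N)).
Qed.

Lemma contab_circ F r : 0 <= r -> cder_circ F r ->
  contab 0 (pi *+ 2) (fun t => F (pz r t) * (ii * pz r t)).
Proof.
move=> r0 hF; apply: (@contab_edge_t _ F r r r 0 (pi *+ 2) r0); first by rewrite lexx.
move=> z; rewrite -eq_le => /eqP zr; apply: derivable_zcont; apply: hF; by rewrite zr.
Qed.

Lemma avg_eq F G r : 0 <= r -> (forall z, nm z = r -> F z = G z) -> avg F r = avg G r.
Proof.
move=> r0 h; congr (_ / _); apply: cint_eq => t _; rewrite h// nm_pz ger0_norm//.
Qed.

Lemma avgD F G r : 0 <= r -> cder_circ F r -> cder_circ G r ->
  avg (fun z => F z + G z) r = avg F r + avg G r.
Proof.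
move=> r0 hF hG; rewrite /avg -mulrDl; congr (_ / _).
rewrite /edge_t -cintD; [|exact: contab_circ|exact: contab_circ].
by apply: cint_eq => t _; rewrite mulrDl.
Qed.

Lemma avgZ F r k : 0 <= r -> cder_circ F r -> avg (fun z => k * F z) r = k * avg F r.
Proof.
move=> r0 hF; rewrite /avg mulrA; congr (_ / _).
rewrite /edge_t -cintZ; last exact: contab_circ.
by apply: cint_eq => t _; rewrite -mulrA.
Qed.

Lemma avgB F G r : 0 <= r -> cder_circ F r -> cder_circ G r ->
  avg (fun z => F z - G z) r = avg F r - avg G r.
Proof.
move=> r0 hF hG.
have hG' : cder_circ (fun z => -1 * G z) r.
  by move=> z hz; apply: cderM; [exact: cder_cst|exact: hG].
transitivity (avg (fun z => F z + -1 * G z) r).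
  by apply: avg_eq => // z _; rewrite mulN1r.
by rewrite (avgD r0 hF hG') (avgZ _ r0 hG) mulN1r.
Qed.

Lemma avg_sum (F : nat -> C -> C) N r : 0 <= r -> (forall n, cder_circ (F n) r) ->
  avg (fun z => \sum_(n < N) F n z) r = \sum_(n < N) avg (F n) r.
Proof.
move=> r0 hF; elim: N => [|N IH].
  rewrite big_ord0 (@avg_eq _ (fun z => 0 * 0))//; last by move=> z _; rewrite big_ord0 mulr0.
  by rewrite avgZ ?mul0r// => z _; exact: cder_cst.
rewrite big_ord_recr/= -IH -avgD//; first by apply: avg_eq => // z _; rewrite big_ord_recr.
by move=> z hz; apply: cder_sum => n; exact: hF.
Qed.

Lemma avg_bound F r M : 0 <= r -> cder_circ F r ->
  (forall t, 0 <= t <= pi *+ 2 -> nm (F (pz r t)) <= M) -> nm (avg F r) <= 2 * (M * r).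
Proof.
move=> r0 hF hM; rewrite /avg nmM nmV nm_twopi_i ler_pdivrMr ?twopi_gt0//.
have := @cint_bound _ _ _ _ (M * r) (ltW twopi_gt0) (contab_circ r0 hF).
rewrite subr0; apply.
move=> t /hM ht; rewrite !nmM nm_pz ger0_norm//.
have -> : nm ii = 1 by rewrite /Normc.normc expr0n expr1n add0r sqrtr1.
by rewrite mul1r ler_wpM2r.
Qed.

(** Goursat for a full turn: the radial sides at angles 0 and 2 pi coincide and cancel. *)
Lemma avg_const F r1 r2 : 0 <= r1 -> r1 <= r2 ->
  (forall z, r1 <= nm z <= r2 -> cder F z) -> avg F r1 = avg F r2.
Proof.
move=> r10; rewrite le_eqVlt => /predU1P[->//|r12] hF.
have := goursat r10 r12 twopi_gt0 hF.
rewrite /polar_rect /edge_r !pz_2pi.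
have -> : cint r1 r2 (fun r => F (pz r (pi *+ 2)) * pz 1 0) = cint r1 r2 (fun r => F (pz r 0) * pz 1 0).
  by apply: cint_eq => r _; rewrite pz_2pi.
by rewrite subrr add0r /avg => /eqP; rewrite subr_eq0 => /eqP ->.
Qed.

Lemma avg_inv r : 0 < r -> avg (fun z => z^-1) r = 1.
Proof.
move=> r0; rewrite /avg; suff -> : edge_t (fun z => z^-1) r 0 (pi *+ 2) = twopi_i.
  by rewrite divff// twopi_i_neq0.
transitivity (cint 0 (pi *+ 2) (fun=> ii)).
  apply: cint_eq => t _; rewrite mulrCA mulVf ?mulr1//.
  by rewrite -nm_gt0 nm_pz gtr0_norm.
rewrite (@cint_FTC _ _ _ (fun t => t%:C%C * ii)); [|exact: twopi_gt0| |].
- by rewrite mul0r subr0.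
- move=> t _; have h : cd (fun y : R => y%:C%C : C) t 1.
    by split; [exact: is_derive_id|exact: is_derive_cst].
  by have := cdM h (cd_cst ii t); rewrite mulr0 addr0 mul1r.
- by move=> t _; exact: ccont_cst.
Qed.

(* [F] homogeneous under [z := 2 z]: the mean scales, yet does not depend on the radius. *)
Lemma avg_homog F kp r : kp != 1 -> (forall z, z != 0 -> cder F z) ->
  (forall z, F (2 * z) * 2 = kp * F z) -> 0 < r -> avg F r = 0.
Proof.
move=> kp1 hF hk r0.
have hF' s : 0 < s -> cder_circ F s by move=> s0 z zs; apply: hF; rewrite -nm_gt0 zs.
have e1 : avg F r = avg F (2 * r).
  apply: avg_const; [exact: ltW|lra|move=> z /andP[h _]].
  by apply: hF; rewrite -nm_gt0; lra.
have e2 : avg F (2 * r) = kp * avg F r.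
  rewrite -avgZ ?(ltW r0)//; last exact: hF'.
  congr (_ / _); apply: cint_eq => t _.
  have -> : pz (2 * r) t = 2 * pz r t by rewrite pzE rcM [pz r t]pzE mulrA rc_nat.
  have -> : F (2 * pz r t) * (ii * (2 * pz r t)) = F (2 * pz r t) * 2 * (ii * pz r t) by ring.
  by rewrite hk.
have : (1 - kp) * avg F r = 0 by rewrite mulrBl mul1r -e2 -e1 subrr.
by move/eqP; rewrite mulf_eq0 subr_eq0 eq_sym (negbTE kp1) => /eqP.
Qed.

Lemma pow2_neq1 n : (2 : C) ^+ n.+1 != 1.
Proof.
by rewrite -natrX pnatr_eq1 expnS mul2n; case: (2 ^ n)%N.
Qed.

Lemma avg_pow n r : 0 < r -> avg (fun z => z ^+ n) r = 0.
Proof.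
apply: (avg_homog (pow2_neq1 n)) => [z _|z].
  by apply: cderX; exact: cder_id.
by rewrite exprMn exprS; ring.
Qed.

Lemma avg_npow n r : 0 < r -> avg (fun z => z^-1 ^+ n.+2) r = 0.
Proof.
apply: (@avg_homog _ (2 ^- n.+1)) => [|z z0|z].
- by rewrite invr_eq1 pow2_neq1.
- by apply: cderX; apply: cderV => //; exact: cder_id.
- by rewrite invfM exprMn [2^-1 ^+ n.+2]exprSr exprVn; field; rewrite expf_neq0.
Qed.

Lemma circ_bdd F r : 0 <= r -> cder_circ F r ->
  exists2 M, 0 <= M & forall t, 0 <= t <= pi *+ 2 -> nm (F (pz r t)) <= M.
Proof.
move=> r0 hF.
have hc t : {for t, continuous (fun t => nm (F (pz r t)))}.
  have hF' : ccont (fun t => F (pz r t)) t.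
    apply: (@zcont_comp _ F (fun t => pz r t)); first exact: ccont_pzt.
    by apply: derivable_zcont; apply: hF; rewrite nm_pz ger0_norm.
  apply/cvgrPdist_le => e e0; have [d d0 hd] := hF' e e0.
  apply/nbhs_ballP; exists d => // y /=; rewrite distrC => /hd hy.
  rewrite ler_norml; apply/andP; split.
    by have := nm_sub_ge (F (pz r y)) (F (pz r t)); lra.
  by have := nm_sub_ge (F (pz r t)) (F (pz r y)); rewrite nm_dist; lra.
have cw : {within `[0, pi *+ 2], continuous (fun t => nm (F (pz r t)))}.
  exact: continuous_subspaceT.
have [c _ hcmax] := EVT_max (ltW twopi_gt0) cw.
exists (nm (F (pz r c))); first exact: nm_ge0.
by move=> t ht; apply: hcmax; rewrite in_itv.
Qed.

End CircleMean.

(** * Power series and their differentiability *)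

Section PowerSeries.
Context {R : realType}.
Local Notation C := R[i].

(* [u] has radius of convergence at least one. *)
Definition pbd (u : nat -> C) := forall r : R, 0 <= r -> r < 1 ->
  exists2 B, 0 <= B & forall n, nm (u n) * r ^+ n <= B.

Definition psum_to (u : nat -> C) (z S : C) := forall e : R, 0 < e ->
  exists N, forall n, (N <= n)%N -> nm (\sum_(k < n) u k * z ^+ k - S) <= e.

(** The sum of the series, with value 0 where it diverges. *)
Definition ps (u : nat -> C) (z : C) : C := xget 0 [set S | psum_to u z S].

Lemma psum_to_uniq u z S T : psum_to u z S -> psum_to u z T -> S = T.
Proof.
move=> hS hT; apply/eqP; rewrite -subr_eq0 -nm_eq0 eq_le nm_ge0 andbT.
apply/ler_addgt0Pr => e e0; rewrite add0r.
have e2 : 0 < e / 2 by rewrite divr_gt0.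
have [N hN] := hS _ e2; have [M hM] := hT _ e2.
have h1 := hN (maxn N M) (leq_maxl _ _); have h2 := hM (maxn N M) (leq_maxr _ _).
have -> : S - T = (\sum_(k < maxn N M) u k * z ^+ k - T) - (\sum_(k < maxn N M) u k * z ^+ k - S) by ring.
by rewrite (le_trans (nmB _ _))//; lra.
Qed.

Lemma psE u z S : psum_to u z S -> ps u z = S.
Proof. by move=> hS; apply: xget_unique => // T hT; exact: psum_to_uniq hT hS. Qed.

Lemma ps_rate u z (B th : R) : 0 <= th -> th < 1 ->
  (forall n, nm (u n * z ^+ n) <= B * th ^+ n) ->
  forall n, nm (\sum_(k < n) u k * z ^+ k - ps u z) <= 2 * (B / (1 - th)) * th ^+ n.
Proof.
move=> th0 th1 hB.
have t0 : 0 < 1 - th by lra.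
have B0 : 0 <= B by have := hB 0; rewrite expr0 mulr1 expr0 mulr1; apply: le_trans; exact: nm_ge0.
have [S hS] : exists S, forall k, nm (S - \sum_(j < k) u j * z ^+ j) <= 2 * (B / (1 - th) * th ^+ k).
  apply: (@gap_limitC _ _ _ (fun k => B * th ^+ k)) => k.
  - by rewrite mulr_ge0 ?exprn_ge0// divr_ge0// ltW.
  - have -> : B / (1 - th) * th ^+ k.+1 + B * th ^+ k = B / (1 - th) * th ^+ k.
      by rewrite exprS; field; rewrite gt_eqF.
    exact: lexx.
  - by rewrite big_ord_recr/= addrAC subrr add0r.
suff -> : ps u z = S by move=> n; rewrite nm_dist -mulrA.
apply: psE => e e0.
pose L := 2 * (B / (1 - th)) + 1.
have L0 : 0 < L by rewrite ltr_wpDl// mulr_ge0// divr_ge0// ltW.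
have [N hN] := pow_small th0 th1 (divr_gt0 e0 L0); exists N => n /hN.
rewrite ltr_pdivlMr// => /ltW h; rewrite nm_dist (le_trans (hS n))// (le_trans _ h)//.
by rewrite mulrA mulrC ler_wpM2l ?exprn_ge0// lerDl.
Qed.

Lemma pbd_geom u (s : R) : pbd u -> 0 <= s -> s < 1 ->
  exists B th : R, [/\ 0 <= B, 0 <= th, th < 1 &
   forall z, nm z <= s -> forall n, nm (u n * z ^+ n) <= B * th ^+ n].
Proof.
move=> hu s0 s1; pose r := (s + 1) / 2.
have r0 : 0 < r by rewrite /r; lra.
have r1 : r < 1 by rewrite /r; lra.
have [B B0 hB] := hu r (ltW r0) r1.
exists B, (s / r); split=> //; first by rewrite divr_ge0// ltW.
  by rewrite ltr_pdivrMr// /r; lra.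
move=> z hz n; rewrite nmM nmX expr_div_n.
have rn : 0 < r ^+ n by rewrite exprn_gt0.
rewrite mulrA ler_pdivlMr//.
rewrite mulrAC ler_pM ?mulr_ge0 ?exprn_ge0 ?nm_ge0 ?(ltW r0)//.
by apply: lerXn2r; rewrite ?nnegrE ?nm_ge0.
Qed.

(** The second-order remainder E n of the n-th power obeys E (n + 1) = y E n + n z^(n-1) (y - z)^2.
    Multiplying by r^2 avoids the exponent n - 2. *)
Lemma pow_diff2 (y z : C) (r : R) n : 0 <= r -> nm y <= r -> nm z <= r ->
  r ^+ 2 * nm (y ^+ n - z ^+ n - n%:R * z ^+ n.-1 * (y - z)) <=
  n%:R ^+ 2 * r ^+ n * nm (y - z) ^+ 2.
Proof.
move=> r0 hy hz; elim: n => [|n IH].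
  by rewrite !expr0 subrr mul0r mul0r subr0 nm0 mulr0 expr0n /= !mul0r.
set E := y ^+ n - z ^+ n - n%:R * z ^+ n.-1 * (y - z) in IH.
have -> : y ^+ n.+1 - z ^+ n.+1 - n.+1%:R * z ^+ n.+1.-1 * (y - z) =
    y * E + n%:R * z ^+ n.-1 * (y - z) ^+ 2.
  rewrite /E; case: n {IH E} => [|n] /=; first by rewrite !expr1 !expr0; ring.
  by rewrite -!natr1 !exprS; ring.
have zn : r ^+ 2 * (n%:R * nm z ^+ n.-1) <= n%:R * r ^+ n.+1.
  case: n {IH E} => [|n]; first by rewrite !mul0r mulr0.
  have -> : r ^+ n.+2 = r ^+ 2 * r ^+ n by rewrite -exprD.
  rewrite mulrCA ler_wpM2l// ler_wpM2l ?sqr_ge0//.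
  by apply: lerXn2r; rewrite ?nnegrE ?nm_ge0.
apply: (@le_trans _ _ (r * (n%:R ^+ 2 * r ^+ n * nm (y - z) ^+ 2) + n%:R * r ^+ n.+1 * nm (y - z) ^+ 2)).
  apply: (@le_trans _ _ (r ^+ 2 * (nm y * nm E + n%:R * nm z ^+ n.-1 * nm (y - z) ^+ 2))).
    rewrite ler_wpM2l ?sqr_ge0// (le_trans (nmD _ _))// !nmM !nmX nm_nat//.
  rewrite mulrDr; apply: lerD.
    by rewrite mulrCA; apply: ler_pM => //; rewrite ?nm_ge0// mulr_ge0 ?sqr_ge0 ?nm_ge0.
  by rewrite mulrA ler_wpM2r// sqr_ge0.
have -> : r * (n%:R ^+ 2 * r ^+ n * nm (y - z) ^+ 2) + n%:R * r ^+ n.+1 * nm (y - z) ^+ 2 =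
  (n%:R ^+ 2 + n%:R) * (r ^+ n.+1 * nm (y - z) ^+ 2) by rewrite [r ^+ n.+1]exprS; ring.
rewrite -[leRHS]mulrA ler_wpM2r ?mulr_ge0 ?exprn_ge0 ?nm_ge0//.
by rewrite -natr1; have := ler0n R n; nra.
Qed.

Lemma succ_sqr_geom (q : R) : 0 <= q -> q < 1 ->
  exists B th : R, [/\ 0 <= B, 0 <= th, th < 1 & forall n, n.+1%:R ^+ 2 * q ^+ n <= B * th ^+ n].
Proof.
move=> q0 q1; pose s := Num.sqrt q; pose t := Num.sqrt s.
have s0 : 0 <= s by rewrite sqrtr_ge0.
have t0 : 0 <= t by rewrite sqrtr_ge0.
have ss : s ^+ 2 = q by rewrite sqr_sqrtr.
have tt : t ^+ 2 = s by rewrite sqr_sqrtr.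
have s1 : s < 1 by nra.
have t1 : t < 1 by nra.
have t10 : 0 < 1 - t by lra.
exists ((1 - t)^-1 ^+ 2), s; split=> //; first by rewrite sqr_ge0.
move=> n; have h := succ_geom n t0 t1.
have -> : n.+1%:R ^+ 2 * q ^+ n = (n.+1%:R * t ^+ n) ^+ 2 * s ^+ n.
  have e1 : q ^+ n = s ^+ n * s ^+ n by rewrite -ss expr2 exprMn.
  have e2 : s ^+ n = t ^+ n * t ^+ n by rewrite -tt expr2 exprMn.
  by rewrite e1 [X in _ * (X * _)]e2; ring.
rewrite ler_wpM2r ?exprn_ge0// ler_pXn2r// ?nnegrE ?invr_ge0 ?mulr_ge0 ?exprn_ge0//.
exact: ltW.
Qed.

Lemma pbd_deriv u : pbd u -> pbd (fun n => n.+1%:R * u n.+1).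
Proof.
move=> hu r r0 r1; pose s := (r + 1) / 2.
have s0 : 0 < s by rewrite /s; lra.
have s1 : s < 1 by rewrite /s; lra.
have [B B0 hB] := hu s (ltW s0) s1.
have q0 : 0 <= r / s by rewrite divr_ge0// ltW.
have q1 : r / s < 1 by rewrite ltr_pdivrMr// /s; lra.
exists (B / s * (1 - r / s)^-1).
  by apply: divr_ge0; [exact: divr_ge0 B0 (ltW s0)|rewrite subr_ge0 ltW].
move=> n; rewrite nmM nm_nat.
have -> : n.+1%:R * nm (u n.+1) * r ^+ n = (nm (u n.+1) * s ^+ n.+1) / s * (n.+1%:R * (r / s) ^+ n).
  have sn : s ^+ n != 0 by rewrite expf_neq0// gt_eqF.
  have sN : s != 0 by rewrite gt_eqF.
  rewrite [(r / s) ^+ n]expr_div_n [s ^+ n.+1]exprS.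
  move: (s ^+ n) (r ^+ n) sn (n.+1%:R : R) => p p' pn q'; clear -sN pn.
  by field; rewrite pn sN.
have h := succ_geom n q0 q1.
rewrite ler_pM ?mulr_ge0 ?nm_ge0 ?exprn_ge0 ?invr_ge0 ?(ltW s0)//.
by rewrite ler_wpM2r ?invr_ge0 ?(ltW s0).
Qed.

Lemma nm_add4 (p q v w : C) : nm (p - q + v + w) <= nm p + nm q + nm v + nm w.
Proof.
rewrite (le_trans (nmD _ _))// lerD2r (le_trans (nmD _ _))// lerD2r; exact: nmB.
Qed.

(** On |y| <= s the remainders of the single powers add up to at most K |y - z|^2, because k^2 (s /
    s')^k is summable for s < s' < 1. The estimate is made on partial sums, with three truncation
    errors of at most e / 4 each. *)
Lemma ps_cder u z : pbd u -> nm z < 1 -> cder (ps u) z.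
Proof.
move=> hu z1; apply/derivable_lin; exists (ps (fun n => n.+1%:R * u n.+1) z).
set d := ps _ _.
pose s := (nm z + 1) / 2; pose s' := (s + 1) / 2.
have z0 := nm_ge0 z.
have zs : nm z < s by rewrite /s; lra.
have s0 : 0 < s by lra.
have s1 : s < 1 by rewrite /s; lra.
have ss' : s < s' by rewrite /s'; lra.
have s'0 : 0 < s' by lra.
have s'1 : s' < 1 by rewrite /s'; lra.
have [B B0 hB] := hu s' (ltW s'0) s'1.
have q0 : 0 <= s / s' by rewrite divr_ge0// ltW.
have q1 : s / s' < 1 by rewrite ltr_pdivrMr// mul1r.
have [B2 [th [B20 th0 th1 hth]]] := succ_sqr_geom q0 q1.
have th10 : 0 < 1 - th by lra.
pose K := B * B2 / (1 - th) / s ^+ 2.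
have K0 : 0 <= K by rewrite !mulr_ge0// invr_ge0 ?(ltW th10)// exprn_ge0 ?ltW.
have main y : nm y <= s -> nm (ps u y - ps u z - d * (y - z)) <= K * nm (y - z) ^+ 2.
  move=> ys; apply/ler_addgt0Pr => e e0.
  have [B1 [t1 [_ t10 t11 hg]]] := pbd_geom hu (ltW s0) s1.
  have [B3 [t3 [_ t30 t31 hg3]]] := pbd_geom (pbd_deriv hu) (ltW s0) s1.
  have ry := ps_rate t10 t11 (hg y ys); have rz := ps_rate t10 t11 (hg z (ltW zs)).
  have rd := ps_rate t30 t31 (hg3 z (ltW zs)); rewrite -/d in rd.
  have e4 : 0 < e / 4 by lra.
  have sm (A t c : R) : 0 <= t -> t < 1 -> 0 <= c ->
      exists N, forall n, (N <= n)%N -> A * t ^+ n * c <= e / 4.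
    move=> t0' t1' c0; pose L := `|A| * c + 1.
    have L0 : 0 < L by rewrite ltr_wpDl// mulr_ge0.
    have [N hN] := pow_small t0' t1' (divr_gt0 e4 L0); exists N => n /hN.
    rewrite ltr_pdivlMr// => /ltW; apply: le_trans.
    rewrite mulrAC mulrC ler_wpM2l ?exprn_ge0// /L.
    by rewrite (le_trans (ler_wpM2r c0 (ler_norm A)))// lerDl.
  have [N1 h1] := sm (2 * (B1 / (1 - t1))) _ 1 t10 t11 ler01.
  have [N3 h3] := sm (2 * (B3 / (1 - t3))) _ (nm (y - z)) t30 t31 (nm_ge0 _).
  pose n := maxn N1 N3.
  have k1 := h1 n.+1 (leqW (leq_maxl _ _)); rewrite mulr1 in k1.
  have k3 := h3 n (leq_maxr _ _).
  have ry' := le_trans (ry n.+1) k1; have rz' := le_trans (rz n.+1) k1.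
  have rd' := le_trans (ler_wpM2r (nm_ge0 (y - z)) (rd n)) k3.
  pose E (k : nat) := y ^+ k - z ^+ k - k%:R * z ^+ k.-1 * (y - z).
  have sumE : \sum_(k < n.+1) u k * E k = \sum_(k < n.+1) u k * y ^+ k -
      \sum_(k < n.+1) u k * z ^+ k - (\sum_(k < n) k.+1%:R * u k.+1 * z ^+ k) * (y - z).
    have -> : \sum_(k < n) k.+1%:R * u k.+1 * z ^+ k =
        \sum_(k < n.+1) k%:R * u k * z ^+ k.-1 by rewrite big_ord_recl !mul0r add0r.
    rewrite mulr_suml -!sumrB; apply: eq_bigr => k _; rewrite /E; ring.
  have sumb : nm (\sum_(k < n.+1) u k * E k) <= K * nm (y - z) ^+ 2.
    rewrite (le_trans (nm_sum _ _ _))//.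
    apply: (@le_trans _ _ (\sum_(k < n.+1) B * B2 / s ^+ 2 * nm (y - z) ^+ 2 * th ^+ k)).
      apply: ler_sum => k _; rewrite nmM.
      have hE := pow_diff2 k (ltW s0) ys (ltW zs); rewrite -/(E k) in hE.
      have sp : 0 < s ^+ 2 by rewrite exprn_gt0.
      rewrite -(ler_pM2l sp) mulrCA.
      apply: (@le_trans _ _ (nm (u k) * (k%:R ^+ 2 * s ^+ k * nm (y - z) ^+ 2))).
        by rewrite ler_wpM2l ?nm_ge0.
      have -> : s ^+ 2 * (B * B2 / s ^+ 2 * nm (y - z) ^+ 2 * th ^+ k) =
        B * (B2 * th ^+ k) * nm (y - z) ^+ 2 by field; rewrite gt_eqF.
      rewrite mulrA ler_wpM2r ?sqr_ge0//.
      have -> : nm (u k) * (k%:R ^+ 2 * s ^+ k) = (nm (u k) * s' ^+ k) * (k%:R ^+ 2 * (s / s') ^+ k).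
        by rewrite [(s / s') ^+ k]expr_div_n; field; rewrite expf_neq0// gt_eqF.
      have kk : k%:R ^+ 2 * (s / s') ^+ k <= B2 * th ^+ k.
        rewrite (le_trans _ (hth k))// ler_wpM2r ?exprn_ge0//.
        by rewrite ler_pXn2r ?nnegrE// ler_nat.
      by apply: ler_pM => //; rewrite mulr_ge0 ?nm_ge0 ?sqr_ge0// exprn_ge0// ltW.
    rewrite -mulr_sumr.
    have gs : \sum_(k < n.+1) th ^+ k <= (1 - th)^-1.
      rewrite -[leRHS]mul1r ler_pdivlMr// mulrC -opprB mulNr -subrX1 opprB.
      by rewrite gerBl exprn_ge0.
    have -> : K * nm (y - z) ^+ 2 = B * B2 / s ^+ 2 * nm (y - z) ^+ 2 * (1 - th)^-1.
      by rewrite /K; ring.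
    by rewrite ler_wpM2l// !mulr_ge0 ?invr_ge0 ?exprn_ge0 ?nm_ge0 ?(ltW s0).
  have -> : ps u y - ps u z - d * (y - z) = \sum_(k < n.+1) u k * E k -
    (\sum_(k < n.+1) u k * y ^+ k - ps u y) + (\sum_(k < n.+1) u k * z ^+ k - ps u z) +
    (\sum_(k < n) k.+1%:R * u k.+1 * z ^+ k - d) * (y - z).
    rewrite sumE; move: (\sum_(k < n.+1) u k * y ^+ k) (\sum_(k < n.+1) u k * z ^+ k).
    by move: (\sum_(k < n) _) (ps u y) (ps u z) => v1 v2 v3 v4 v5; ring.
  apply: (le_trans (nm_add4 _ _ _ _)); rewrite nmM.
  apply: (le_trans (lerD (lerD (lerD sumb ry') rz') rd')).
  by rewrite -!addrA lerD2l; move: e0; clear; lra.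
move=> e e0; have K1 : 0 < K + 1 by lra.
exists (Num.min (s - nm z) (e / (K + 1))).
  by rewrite lt_min subr_gt0 zs divr_gt0.
move=> y; rewrite lt_min => /andP[y1]; rewrite ltr_pdivlMr// => y2.
have ys : nm y <= s.
  have := nmD (y - z) z; rewrite subrK; lra.
rewrite (le_trans (main y ys))// expr2 mulrA ler_wpM2r ?nm_ge0//.
by have := nm_ge0 (y - z); nra.
Qed.

End PowerSeries.

(** * Cauchy's coefficient formula and the Taylor expansion on the disc *)

Section Cauchy.
Context {R : realType}.
Local Notation C := R[i].

Definition hol (F : C -> C) := forall z, nm z < 1 -> cder F z.

Definition coef (F : C -> C) (r : R) (n : nat) : C := avg (fun z : C => F z * z^-1 ^+ n.+1) r.

(* The Taylor coefficients at the origin of a function holomorphic on the disc. *)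
Definition cf (F : C -> C) (n : nat) : C := coef F 2^-1 n.

Lemma hol_circ F r : hol F -> r < 1 -> cder_circ F r.
Proof. by move=> hF r1 z zr; apply: hF; rewrite zr. Qed.

Lemma cder_npow n (z : C) : z != 0 -> cder (fun z : C => z^-1 ^+ n) z.
Proof. by move=> z0; apply: cderX; apply: cderV => //; exact: cder_id. Qed.

Lemma circ_neq0 r (z : C) : 0 < r -> nm z = r -> z != 0.
Proof. by move=> r0 zr; rewrite -nm_gt0 zr. Qed.

Lemma cder_circ_coef F r n : 0 < r -> cder_circ F r ->
  cder_circ (fun z : C => F z * z^-1 ^+ n) r.
Proof.
move=> r0 hF z zr; apply: cderM; first exact: hF.
exact: cder_npow (circ_neq0 r0 zr).
Qed.

Arguments cder_circ_coef {F r} n.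

Lemma coef_const F r1 r2 n : hol F -> 0 < r1 -> r1 <= r2 -> r2 < 1 ->
  coef F r1 n = coef F r2 n.
Proof.
move=> hF r10 r12 r21; apply: avg_const => //; first exact: ltW.
move=> z /andP[h1 h2]; apply: cderM; first by apply: hF; lra.
by apply: cder_npow; rewrite -nm_gt0; lra.
Qed.

Lemma coef_cf F r n : hol F -> 0 < r -> r < 1 -> coef F r n = cf F n.
Proof.
move=> hF r0 r1; have [h|/ltW h] := leP r 2^-1.
  by apply: coef_const => //; lra.
by rewrite /cf; symmetry; apply: coef_const => //; lra.
Qed.

Lemma cf_bound F s : hol F -> 0 < s -> s < 1 ->
  exists2 M, 0 <= M & forall n, nm (cf F n) * s ^+ n <= M.
Proof.
move=> hF s0 s1; have [M M0 hM] := circ_bdd (ltW s0) (hol_circ hF s1).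
exists (2 * M); first by rewrite mulr_ge0.
move=> n; rewrite -(coef_cf n hF s0 s1).
have sn : 0 < s ^+ n by rewrite exprn_gt0.
rewrite -ler_pdivlMr//.
have -> : 2 * M / s ^+ n = 2 * (M * s^-1 ^+ n.+1 * s).
  by rewrite exprS exprVn; field; rewrite !gt_eqF.
apply: avg_bound; [exact: ltW|exact: (cder_circ_coef _ s0 (hol_circ hF s1))|].
move=> t /hM ht; rewrite nmM nmX nmV nm_pz gtr0_norm// ler_wpM2r//.
by rewrite exprn_ge0// invr_ge0 ltW.
Qed.

Lemma cf_pbd F : hol F -> pbd (cf F).
Proof.
move=> hF r r0 r1; pose s := (r + 1) / 2.
have s0 : 0 < s by rewrite /s; lra.
have s1 : s < 1 by rewrite /s; lra.
have [M M0 hM] := cf_bound hF s0 s1; exists M => // n.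
rewrite (le_trans _ (hM n))// ler_wpM2l ?nm_ge0//.
by apply: lerXn2r; rewrite ?nnegrE// ?(ltW s0)// /s; lra.
Qed.

Lemma geom_kernel (z w : C) n : z != 0 -> z - w != 0 ->
  (z - w)^-1 = \sum_(k < n) w ^+ k * z^-1 ^+ k.+1 + (w * z^-1) ^+ n / (z - w).
Proof.
move=> z0 zw; elim: n => [|n IH]; first by rewrite big_ord0 expr0 add0r mul1r.
rewrite big_ord_recr/= [LHS]IH -addrA; congr (_ + _).
rewrite !exprS !exprMn; field; by rewrite z0 zw.
Qed.

(** Expanding 1 / (z - w) in a geometric series yields the Taylor series; that this equals [F w] is
    not yet known and is not presupposed. *)
Lemma cauchy_kernel F r w : hol F -> nm w < r -> r < 1 ->
  avg (fun z : C => F z / (z - w)) r = ps (cf F) w.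
Proof.
move=> hF wr r1; have w0 := nm_ge0 w; have r0 : 0 < r by lra.
symmetry; apply: psE => e e0.
have [M M0 hM] := circ_bdd (ltW r0) (hol_circ hF r1).
have rw : 0 < r - nm w by lra.
pose q := nm w / r.
have q0 : 0 <= q by rewrite divr_ge0// ltW.
have q1 : q < 1 by rewrite ltr_pdivrMr// mul1r.
pose L := 2 * (M / (r - nm w) * r) + 1.
have L0 : 0 < L by rewrite ltr_wpDl// mulr_ge0// mulr_ge0 ?(ltW r0)// divr_ge0// ltW.
have [N hN] := pow_small q0 q1 (divr_gt0 e0 L0).
exists N => n /hN; rewrite ltr_pdivlMr// => /ltW hn.
have zw z : nm z = r -> z - w != 0.
  by move=> zr; rewrite -nm_gt0 (lt_le_trans rw)// -zr nm_sub_ge.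
have cK : cder_circ (fun z : C => F z * ((w * z^-1) ^+ n / (z - w))) r.
  move=> z zr; have z0 := circ_neq0 r0 zr.
  apply: cderM; first exact: (hol_circ hF r1).
  apply: cderM.
    by apply: cderX; apply: cderM; [exact: cder_cst|apply: cderV => //; exact: cder_id].
  apply: cderV; first exact: zw.
  by apply: cderB; [exact: cder_id|exact: cder_cst].
have cS k : cder_circ (fun z : C => w ^+ k * (F z * z^-1 ^+ k.+1)) r.
  move=> z zr; apply: cderM; first exact: cder_cst.
  exact: (cder_circ_coef _ r0 (hol_circ hF r1) _ zr).
have E : avg (fun z : C => F z / (z - w)) r = \sum_(k < n) cf F k * w ^+ k +
    avg (fun z : C => F z * ((w * z^-1) ^+ n / (z - w))) r.
  transitivity (avg (fun z : C => \sum_(k < n) w ^+ k * (F z * z^-1 ^+ k.+1) +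
      F z * ((w * z^-1) ^+ n / (z - w))) r).
    apply: avg_eq => [|z zr]; first exact: ltW.
    rewrite [in LHS](geom_kernel n (circ_neq0 r0 zr) (zw z zr)) mulrDr; congr (_ + _).
    by rewrite mulr_sumr; apply: eq_bigr => k _; rewrite mulrCA.
  have cSum : cder_circ (fun z : C => \sum_(k < n) w ^+ k * (F z * z^-1 ^+ k.+1)) r.
    move=> z zr; apply: (@cder_sum _ (fun k z => w ^+ k * (F z * z^-1 ^+ k.+1))) => k.
    exact: (cS k z zr).
  rewrite (avgD (ltW r0) cSum cK); congr (_ + _).
  rewrite (@avg_sum _ (fun k z => w ^+ k * (F z * z^-1 ^+ k.+1)) n r (ltW r0) cS).
  apply: eq_bigr => k _.
  rewrite (avgZ _ (ltW r0) (cder_circ_coef k.+1 r0 (hol_circ hF r1))).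
  by rewrite mulrC -(coef_cf k hF r0 r1).
rewrite E opprD addrA subrr add0r nmN.
apply: le_trans (avg_bound (M := M * (q ^+ n / (r - nm w))) (ltW r0) cK _) _.
  move=> t /hM ht; have zr : nm (pz r t) = r by rewrite nm_pz gtr0_norm.
  rewrite !nmM nmX nmM !nmV zr; apply: ler_pM; rewrite ?nm_ge0 ?mulr_ge0 ?exprn_ge0 ?invr_ge0 ?nm_ge0//.
  rewrite ler_wpM2l ?exprn_ge0// lef_pV2 ?posrE ?nm_gt0 ?zw//.
  by rewrite -{1}zr nm_sub_ge.
rewrite (le_trans _ hn)//.
have -> : 2 * (M * (q ^+ n / (r - nm w)) * r) = q ^+ n * (2 * (M / (r - nm w) * r)) by ring.
by rewrite ler_wpM2l ?exprn_ge0// lerDl.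
Qed.

Lemma avg_monomial r k n : 0 < r -> avg (fun z : C => z ^+ k * z^-1 ^+ n.+1) r = (k == n)%:R.
Proof.
move=> r0; have [->|kn] := eqVneq k n.
  rewrite -[RHS](avg_inv r0); apply: avg_eq => [|z zr]; first exact: ltW.
  by rewrite exprSr mulrA -exprMn divff ?(circ_neq0 r0 zr)// expr1n mul1r.
have [nk|kn'] := ltnP n k.
  transitivity (avg (fun z : C => z ^+ (k - n.+1)) r); last exact: avg_pow.
  apply: avg_eq => [|z zr]; first exact: ltW.
  by rewrite -{1}(subnK nk) exprD -mulrA -exprMn divff ?(circ_neq0 r0 zr)// expr1n mulr1.
have kn2 : (k < n)%N by rewrite ltn_neqAle kn.
transitivity (avg (fun z : C => z^-1 ^+ (n - k.+1).+2) r); last exact: avg_npow.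
apply: avg_eq => [|z zr]; first exact: ltW.
have -> : n.+1 = (k + (n - k.+1).+2)%N by rewrite !addnS -addSn subnKC.
by rewrite exprD mulrA -exprMn divff ?(circ_neq0 r0 zr)// expr1n mul1r.
Qed.

Lemma hol_ps u : pbd u -> hol (ps u).
Proof. by move=> hu z z1; exact: ps_cder. Qed.

Lemma cf_ps u n : pbd u -> cf (ps u) n = u n.
Proof.
move=> hu; have r0 : 0 < 2^-1 :> R by lra.
have r1 : 2^-1 < 1 :> R by lra.
have [B [th [B0 th0 th1 hB]]] := pbd_geom hu (ltW r0) r1.
have hS N : cder_circ (fun z : C => \sum_(k < N) u k * z ^+ k) (2^-1 : R).
  move=> z _; apply: (@cder_sum _ (fun k z => u k * z ^+ k)) => k; apply: cderM; first exact: cder_cst.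
  by apply: cderX; exact: cder_id.
apply/eqP; rewrite -subr_eq0 -nm_eq0 eq_le nm_ge0 andbT.
apply/ler_addgt0Pr => e e0; rewrite add0r.
pose D := 2 * (B / (1 - th)).
have D0 : 0 <= D by rewrite mulr_ge0// divr_ge0// ltW// subr_gt0.
pose A := 2 * (D * 2 ^+ n.+1 * 2^-1) + 1.
have A0 : 0 < A.
  apply: ltr_wpDl => //; apply: mulr_ge0 => //; apply: divr_ge0 => //.
  by apply: mulr_ge0 => //; exact: exprn_ge0.
have [N hN] := pow_small th0 th1 (divr_gt0 e0 A0).
pose N' := maxn N n.+1.
have := hN N' (leq_maxl _ _); rewrite ltr_pdivlMr// => /ltW hn.
have E : u n = avg (fun z : C => (\sum_(k < N') u k * z ^+ k) * z^-1 ^+ n.+1) 2^-1.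
  transitivity (\sum_(k < N') avg (fun z : C => u k * (z ^+ k * z^-1 ^+ n.+1)) 2^-1).
    have nN' : (n < N')%N by exact: leq_maxr.
    have cm k : cder_circ (fun z : C => z ^+ k * z^-1 ^+ n.+1) 2^-1.
      by apply: (cder_circ_coef n.+1 r0) => z _; apply: cderX; exact: cder_id.
    under eq_bigr => k _ do rewrite (avgZ _ (ltW r0) (cm k)) (avg_monomial k n r0).
    rewrite (bigD1 (Ordinal nN'))//= big1 ?addr0 => [|k kn]; first by rewrite eqxx mulr1.
    by have /negbTE -> : (k : nat) != n; [rewrite -val_eqE in kn|rewrite mulr0].
  have cm k : cder_circ (fun z : C => u k * (z ^+ k * z^-1 ^+ n.+1)) 2^-1.
    move=> z zr; apply: cderM; first exact: cder_cst.
    have hX : cder_circ (fun z : C => z ^+ k) 2^-1 by move=> y _; apply: cderX; exact: cder_id.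
    exact: (cder_circ_coef n.+1 r0 hX z zr).
  rewrite -(@avg_sum _ (fun k z => u k * (z ^+ k * z^-1 ^+ n.+1)) N' _ (ltW r0) cm).
  apply: avg_eq => // z _; rewrite mulr_suml; apply: eq_bigr => k _; by rewrite mulrA.
have hP := hol_circ (hol_ps hu) r1.
have c1 := cder_circ_coef n.+1 r0 hP; have c2 := cder_circ_coef n.+1 r0 (hS N').
rewrite E /cf /coef -(avgB (ltW r0) c1 c2).
apply: le_trans (avg_bound (M := D * th ^+ N' * 2 ^+ n.+1) (ltW r0) _ _) _.
- by move=> z zr; apply: cderB; [exact: (c1 z zr)|exact: (c2 z zr)].
- move=> t _; have zr : nm (pz 2^-1 t) = 2^-1 :> R by rewrite nm_pz gtr0_norm.
  rewrite -mulrBl nmM nmX nmV zr invrK ler_wpM2r ?exprn_ge0// nm_dist.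
  by apply: ps_rate => // m; apply: hB; rewrite zr.
rewrite (le_trans _ hn)//.
have -> : 2 * (D * th ^+ N' * 2 ^+ n.+1 * 2^-1) = th ^+ N' * (2 * (D * 2 ^+ n.+1 * 2^-1)) by ring.
by rewrite ler_wpM2l ?exprn_ge0// lerDl.
Qed.

Lemma cf_eq F G n : (forall z, nm z < 1 -> F z = G z) -> cf F n = cf G n.
Proof.
by move=> h; apply: avg_eq => // z zr; rewrite h// zr; lra.
Qed.

Lemma cfB F G n : hol F -> hol G -> cf (fun z : C => F z - G z) n = cf F n - cf G n.
Proof.
move=> hF hG; have r0 : 0 < 2^-1 :> R by lra.
have r1 : 2^-1 < 1 :> R by lra.
have c1 := cder_circ_coef n.+1 r0 (hol_circ hF r1).
have c2 := cder_circ_coef n.+1 r0 (hol_circ hG r1).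
rewrite /cf /coef -(avgB (ltW r0) c1 c2).
by apply: avg_eq => [|z _]; [exact: ltW|rewrite mulrBl].
Qed.

Lemma ps0 u w : (forall n, u n = 0) -> ps u w = 0 :> C.
Proof.
move=> u0; apply: psE => e e0; exists 0 => n _.
by rewrite big1 ?subr0 ?nm0 ?ltW// => k _; rewrite u0 mul0r.
Qed.

Lemma hol_cst (k : C) : hol (fun=> k).
Proof. by move=> z _; exact: cder_cst. Qed.

Arguments hol_cst k : clear implicits.

Lemma cf_one n : cf (fun=> 1) n = (n == 0%N)%:R.
Proof.
have r0 : 0 < 2^-1 :> R by lra.
rewrite eq_sym -(avg_monomial 0 n r0); apply: avg_eq => [|z _]; first exact: ltW.
by rewrite expr0.
Qed.

Lemma ps_one w : ps (cf (fun=> 1)) w = 1 :> C.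
Proof.
apply: psE => e e0; exists 1%N => -[//|n] _.
rewrite big_ord_recl cf_one mul1r expr0 big1 ?addr0 ?subrr ?nm0 ?ltW// => k _.
by rewrite cf_one mul0r.
Qed.

(* [K] below extends to [w] with value 0 there, thanks to the square, and is
   differentiable at [w] as well; so no removable singularity has to be handled. *)
Lemma square_identity d w : hol d -> nm w < 1 ->
  ps (cf (fun z : C => d z ^+ 2)) w - 2 * d w * ps (cf d) w + d w ^+ 2 = 0.
Proof.
move=> hd w1.
pose K z := (d z - d w) ^+ 2 / (z - w).
have hK : hol K.
  move=> z z1; have [->|zw] := eqVneq z w; last first.
    apply: cderM.
      by apply: cderX; apply: cderB; [exact: hd|exact: cder_cst].
    by apply: cderV; [rewrite subr_eq0|apply: cderB; [exact: cder_id|exact: cder_cst]].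
  (* With d y - d w = D h + et and et = o(h), K y = D^2 h + 2 D et + et^2 / h; so D^2 is the
     derivative of [K] at [w]. *)
  have /derivable_lin[D hD] := hd w w1.
  apply/derivable_lin; exists (D ^+ 2) => e e0.
  pose A := 2 * nm D + 1.
  have A0 : 0 < A by rewrite ltr_wpDl// mulr_ge0// nm_ge0.
  pose e1 := Num.min 1 (e / A).
  have e10 : 0 < e1 by rewrite lt_min ltr01 divr_gt0.
  have e11 : e1 <= 1 by rewrite ge_min lexx.
  have e1A : e1 * A <= e by rewrite -ler_pdivlMr// ge_min lexx orbT.
  have [del del0 hdel] := hD _ e10; exists del => // y /hdel hy.
  have Kw : K w = 0 by rewrite /K !subrr expr0n mul0r.
  have [->|yw] := eqVneq y w; first by rewrite !subrr mulr0 subrr nm0 mulr0.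
  rewrite Kw subr0; set h := y - w in hy *.
  have h0 : h != 0 by rewrite subr_eq0.
  have nh : 0 < nm h by rewrite nm_gt0.
  set et := d y - d w - D * h in hy.
  have -> : K y - D ^+ 2 * h = 2 * D * et + et ^+ 2 / h.
    rewrite /K -/h; have -> : d y - d w = D * h + et by rewrite /et; ring.
    by field.
  have n1 : nm (2 * D * et) = 2 * nm D * nm et by rewrite !nmM nm_nat.
  have n2 : nm (et ^+ 2 / h) = nm et ^+ 2 / nm h by rewrite nmM nmV nmX.
  rewrite (le_trans (nmD _ _))// n1 n2.
  apply: (@le_trans _ _ (2 * nm D * (e1 * nm h) + (e1 * nm h) ^+ 2 / nm h)).
    apply: lerD; first by rewrite ler_wpM2l// mulr_ge0// nm_ge0.
    by rewrite ler_pM2r ?invr_gt0// ler_pXn2r// ?nnegrE ?nm_ge0// mulr_ge0 ?ltW.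
  have -> : 2 * nm D * (e1 * nm h) + (e1 * nm h) ^+ 2 / nm h = (2 * nm D * e1 + e1 ^+ 2) * nm h.
    by field; rewrite gt_eqF.
  rewrite ler_pM2r// (le_trans _ e1A)// /A.
  by have := nm_ge0 D; nra.
pose r := (nm w + 1) / 2.
have w0 := nm_ge0 w.
have wr : nm w < r by rewrite /r; lra.
have r0 : 0 < r by lra.
have r1 : r < 1 by rewrite /r; lra.
(* The mean does not depend on the radius, and for small radii it is of the order of the radius, [K]
   being bounded near 0. *)
have K0 : avg K r = 0.
  have /derivable_zcont hz : cder K 0 by apply: hK; rewrite nm0.
  have [del del0 hdel] := hz 1 ltr01.
  apply/eqP; rewrite -nm_eq0 eq_le nm_ge0 andbT.
  apply/ler_addgt0Pr => e e0; rewrite add0r.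
  pose M := nm (K 0) + 1; have M0 : 0 < M by rewrite ltr_wpDl// nm_ge0.
  pose s := Num.min r (Num.min (del / 2) (e / (2 * M))).
  have s0 : 0 < s by rewrite !lt_min r0 !divr_gt0// mulr_gt0.
  have sr : s <= r by rewrite ge_min lexx.
  have sd : s < del by rewrite (@le_lt_trans _ _ (del / 2)) ?ge_min ?lexx ?orbT//; lra.
  have se : s * (2 * M) <= e by rewrite -ler_pdivlMr ?mulr_gt0// !ge_min lexx !orbT.
  have <- : avg K s = avg K r.
    by apply: avg_const => //; [exact: ltW|move=> z /andP[_ h]; apply: hK; lra].
  have s1 : s < 1 by lra.
  apply: le_trans (avg_bound (M := M) (ltW s0) (hol_circ hK s1) _) _.
    move=> t _; have := hdel (pz s t); rewrite subr0 nm_pz gtr0_norm// => /(_ sd) h.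
    by have := nm_sub_ge (K (pz s t)) (K 0); rewrite /M; lra.
  by lra.
have zw z : nm z = r -> z - w != 0.
  by move=> zr; rewrite -nm_gt0; have := nm_sub_ge z w; rewrite zr; lra.
have cI : cder_circ (fun z : C => (z - w)^-1) r.
  move=> z zr; apply: cderV; first exact: zw.
  by apply: cderB; [exact: cder_id|exact: cder_cst].
have cG G : hol G -> cder_circ (fun z : C => G z / (z - w)) r.
  by move=> hG z zr; apply: cderM; [exact: (hol_circ hG r1)|exact: cI].
have hd2 : hol (fun z : C => d z ^+ 2) by move=> z /hd hz; exact: cderX.
rewrite -(cauchy_kernel hd2 wr r1) -(cauchy_kernel hd wr r1).
(* The constant term is also written as a Cauchy integral, that of the function 1; the three
   integrands then combine to [K]. *)
rewrite -[d w ^+ 2]mulr1 -[X in d w ^+ 2 * X](ps_one w) -(cauchy_kernel (hol_cst 1) wr r1).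
have r0' := ltW r0.
have c1 := cG _ hd2; have c2 := cG _ hd; have c3 := cG _ (hol_cst 1).
have c2' : cder_circ (fun z : C => 2 * d w * (d z / (z - w))) r.
  by move=> z zr; apply: cderM; [exact: cder_cst|exact: c2].
have c3' : cder_circ (fun z : C => d w ^+ 2 * (1 / (z - w))) r.
  by move=> z zr; apply: cderM; [exact: cder_cst|exact: c3].
have c12 : cder_circ (fun z : C => d z ^+ 2 / (z - w) - 2 * d w * (d z / (z - w))) r.
  by move=> z zr; apply: cderB; [exact: c1|exact: c2'].
rewrite -(avgZ _ r0' c2) -(avgZ _ r0' c3) -(avgB r0' c1 c2') -(avgD r0' c12 c3') -K0.
apply: avg_eq => // z zr; rewrite /K; field; exact: zw.
Qed.

(** The difference d of [F] and its series has zero coefficients, so [square_identity] reduces to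
    d^2 = - ps u, where u is the coefficient sequence of d^2. Taking coefficients gives u = - u,
    whence u = 0 and d = 0. *)
Theorem hol_power_series F : hol F -> forall w, nm w < 1 -> F w = ps (cf F) w.
Proof.
move=> hF.
have hP : hol (ps (cf F)) by apply: hol_ps; exact: cf_pbd.
pose d z := F z - ps (cf F) z.
have hd : hol d by move=> z z1; apply: cderB; [exact: hF|exact: hP].
have d0 n : cf d n = 0 by rewrite cfB// (cf_ps n (cf_pbd hF)) subrr.
have hd2 : hol (fun z : C => d z ^+ 2) by move=> z /hd hz; exact: cderX.
pose u := cf (fun z : C => d z ^+ 2).
have hu : pbd u by exact: cf_pbd.
have dE w : nm w < 1 -> d w ^+ 2 = - ps u w.
  move=> w1; have := square_identity hd w1; rewrite (ps0 w d0) mulr0 subr0 -/u.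
  by rewrite addrC => /eqP; rewrite addr_eq0 => /eqP.
have u0 n : u n = 0.
  have e1 : u n = cf (fun z : C => 0 - ps u z) n.
    by apply: cf_eq => z /dE ->; rewrite sub0r.
  have c0 : cf (fun=> 0 : C) n = 0.
    have h1 := hol_cst (0 : C).
    by have := cfB n h1 h1; rewrite !subrr.
  move: e1; rewrite (cfB n (hol_cst 0) (hol_ps hu)) c0 (cf_ps n hu) sub0r => /eqP.
  rewrite -subr_eq0 opprK -mulr2n mulrn_eq0 /= => /eqP//.
move=> w w1; have := dE w w1; rewrite (ps0 w u0) oppr0 => /eqP.
by rewrite sqrf_eq0 /d subr_eq0 => /eqP.
Qed.

End Cauchy.

(** * Moments of the disc *)

Section DiskArea.
Context {R : realType}.
Local Notation mu := (@lebesgue_measure R).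
Local Notation T2 := (measurableTypeR R * measurableTypeR R)%type.

Definition disk (r : R) : set T2 := [set p | p.1 ^+ 2 + p.2 ^+ 2 < r ^+ 2].

Lemma disk_measurable r : measurable (disk r).
Proof.
rewrite (_ : disk r = setT `&` [set p : T2 | p.1 ^+ 2 + p.2 ^+ 2 < r ^+ 2]); last by rewrite setTI.
have m : measurable_fun [set: T2] (fun p : T2 => p.1 ^+ 2 + p.2 ^+ 2 < r ^+ 2).
  apply: measurable_fun_ltr; last exact: measurable_cst.
  by apply: measurable_funD; apply: measurable_funX; [exact: measurable_fst|exact: measurable_snd].
by have := m measurableT [set true] I; congr measurable.
Qed.

Lemma itv_sqrt (x r : R) : 0 <= r -> (x ^+ 2 < r) = (- Num.sqrt r < x < Num.sqrt r).
Proof.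
by move=> r0; rewrite -ltr_norml -[in LHS](sqr_sqrtr r0) -(real_normK (num_real x)) ltr_pXn2r// ?nnegrE ?sqrtr_ge0.
Qed.

Lemma disk_xsection (r x : R) : xsection (disk r) x =
  `]- Num.sqrt (r ^+ 2 - x ^+ 2), Num.sqrt (r ^+ 2 - x ^+ 2)[%classic.
Proof.
apply/seteqP; split => y; rewrite /xsection /= inE /disk /= in_itv /=.
  move=> h; rewrite -itv_sqrt; last by rewrite subr_ge0 ltW// (le_lt_trans _ h)// lerDl sqr_ge0.
  by rewrite ltrBrDl.
have [h|h] := lerP 0 (r ^+ 2 - x ^+ 2).
  by rewrite -itv_sqrt// ltrBrDl.
by rewrite ltr0_sqrtr// oppr0 => /andP[h1 h2]; have := lt_trans h1 h2; rewrite ltxx.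
Qed.

(** Substitution x = r sin t, after which r^2 (t + sin t cos t) is a primitive. *)
Lemma int_semicircle (r : R) : 0 < r ->
  (\int[mu]_(x in `[(- r)%R, r]) (2 * Num.sqrt (r ^+ 2 - x ^+ 2))%:E = (r ^+ 2 * pi)%:E)%E.
Proof.
move=> r0; pose F (t : R) := r * sin t; pose p2 : R := pi / 2.
have p20 : 0 < p2 by rewrite divr_gt0// pi_gt0.
have dF (t : R) : is_derive t 1 F (r * cos t).
  by rewrite (_ : F = r \*: sin)//; apply: is_derive_eq.
have F'E : derive1 F = (fun t => r * cos t) by apply/funext => t; rewrite derive1E; have [_ ->] := dF t.
have cF (t : R) : {for t, continuous F}.
  by apply: differentiable_continuous; apply/derivable1_diffP; case: (dF t).
have cF' (t : R) : {for t, continuous (derive1 F)}.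
  by rewrite F'E; apply: continuousM; [exact: cst_continuous|exact: continuous_cos].
have Fa : F (- p2) = - r by rewrite /F sinN sin_pihalf mulrN1.
have Fb : F p2 = r by rewrite /F sin_pihalf mulr1.
have ab : - p2 <= p2 by lra.
have sub := @integration_by_substitution_increasing R F (fun x => 2 * Num.sqrt (r ^+ 2 - x ^+ 2)) (- p2) p2 ab.
rewrite Fa Fb in sub.
rewrite sub; first last.
- apply: continuous_subspaceT => x; apply: cvgM; first exact: cvg_cst.
  apply: (@continuous_comp _ _ _ (fun x : R => r ^+ 2 - x ^+ 2) (@Num.sqrt R)); last exact: sqrt_continuous.
  apply: cvgB; first exact: cvg_cst.
  exact: exprn_continuous.
- split => [x _||]; [by case: (dF x)|by apply: cvg_at_right_filter; exact: cF|by apply: cvg_at_left_filter; exact: cF].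
- by apply/cvg_ex; exists ((derive1 F) p2); apply: cvg_at_left_filter; exact: cF'.
- by apply/cvg_ex; exists (derive1 F (- p2)); apply: cvg_at_right_filter; exact: cF'.
- by move=> x _; exact: cF'.
- by move=> x y hx hy xy; rewrite /F ltr_pM2l// ltr_sin.
pose G (t : R) := r ^+ 2 * (t + sin t * cos t).
have dG (t : R) : is_derive t 1 G (2 * r ^+ 2 * cos t ^+ 2).
  have d := is_deriveZ (r ^+ 2) (is_deriveD (is_derive_id t 1) (is_deriveM (is_derive_sin t) (is_derive_cos t))).
  apply: (is_derive_eq d).
  rewrite /GRing.scale /=.
  have -> : cos t * cos t = cos t ^+ 2 by [].
  by have := cos2Dsin2 t => h; have -> : sin t * - sin t = cos t ^+ 2 - 1; [rewrite -h; ring|ring].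
have cG (t : R) : {for t, continuous G}.
  by apply: differentiable_continuous; apply/derivable1_diffP; case: (dG t).
transitivity (\int[mu]_(x in `[(- p2)%R, p2]) (2 * r ^+ 2 * cos x ^+ 2)%:E)%E.
  apply: eq_integral => t /set_mem /=; rewrite in_itv/= => ht; congr EFin.
  rewrite fctE /= F'E /F -(_ : (r * cos t) ^+ 2 = r ^+ 2 - (r * sin t) ^+ 2).
    rewrite sqrtr_sqr ger0_norm; first by ring.
    by rewrite mulr_ge0// ?(ltW r0)//; exact: cos_ge0_pihalf.
  by rewrite !exprMn cos2sin2; ring.
have cc : {within `[- p2, p2], continuous (fun x : R => 2 * r ^+ 2 * cos x ^+ 2)}.
  apply: continuous_subspaceT => x; apply: cvgM; first exact: cvg_cst.
  by apply: cvgM; exact: continuous_cos.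
rewrite (@continuous_FTC2 _ (fun x : R => 2 * r ^+ 2 * cos x ^+ 2) G (- p2) p2).
- rewrite /G sinN cosN /p2 cos_pihalf !mulr0 !addr0 -EFinB; congr EFin; lra.
- by lra.
- exact: cc.
- split => [x _||]; [by case: (dG x)|by apply: cvg_at_right_filter; exact: cG|by apply: cvg_at_left_filter; exact: cG].
- by move=> x _; rewrite derive1E; have [_ ->] := dG x.
Qed.

Lemma dA_disk (r : R) : 0 < r -> dA (disk r) = (r ^+ 2)%:E.
Proof.
move=> r0; have pi0 : pi != 0 :> R by rewrite gt_eqF// pi_gt0.
have E0 : dA (disk r) = ((pi : R)^-1%:E * \int[mu]_x mu (xsection (disk r) x))%E by [].
rewrite E0; have -> : (\int[mu]_x mu (xsection (disk r) x) = (r ^+ 2 * pi)%:E)%E.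
  rewrite -int_semicircle// [RHS]integral_mkcond; apply: eq_integral => x _.
  rewrite disk_xsection lebesgue_measure_itv /= lte_fin patchE.
  have [/set_mem|/negP] := boolP (x \in `[(- r)%R, r]%classic).
    rewrite /= in_itv/= => xr; case: ifPn; first by rewrite -EFinB => _; congr EFin; ring.
    have := sqrtr_ge0 (r ^+ 2 - x ^+ 2); set s := Num.sqrt _ => s0; rewrite -leNgt => h.
    by congr EFin; lra.
  rewrite inE /= in_itv/= => xr; rewrite (_ : Num.sqrt _ = 0) ?oppr0 ?ltxx//.
  apply: ler0_sqrtr; rewrite subr_le0; apply: contra_notT xr; rewrite -ltNge => h.
  have := h; rewrite -(real_normK (num_real x)) ltr_pXn2r ?nnegrE ?(ltW r0)//.
  by rewrite ltr_norml => /andP[h1 h2]; rewrite !ltW.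
by rewrite -EFinM mulrC -mulrA mulfV// mulr1.
Qed.
End DiskArea.

(** * Measurability and integrals of complex functions on plane sets *)

Section ComplexIntegral.
Context {R : realType}.
Local Notation C := R[i].
Local Notation T2 := (measurableTypeR R * measurableTypeR R)%type.
Local Notation dA := (@dA R).
Implicit Types (D : set T2) (F G : C -> C) (k : C).

Definition cmeas D F :=
  measurable_fun D (fun p => complex.Re (F (cplx p)) : R) /\
  measurable_fun D (fun p => complex.Im (F (cplx p)) : R).

Lemma cmeas_eq D F G : (forall p, D p -> F (cplx p) = G (cplx p)) -> cmeas D F -> cmeas D G.
Proof.
by move=> FG [h1 h2]; split; [apply: eq_measurable_fun h1|apply: eq_measurable_fun h2] => p /set_mem /FG ->.
Qed.
Lemma cmeas_cst D k : cmeas D (fun=> k).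
Proof. by split; exact: measurable_cst. Qed.
Lemma cmeas_id D : cmeas D id.
Proof.
by split; apply: (@measurable_funTS _ _ _ _ D); [exact: measurable_fst|exact: measurable_snd].
Qed.
Lemma cmeasD D F G : cmeas D F -> cmeas D G -> cmeas D (fun z => F z + G z).
Proof.
move=> [h1 h2] [h3 h4]; split.
  by under eq_fun do rewrite cReD; exact: measurable_funD.
by under eq_fun do rewrite cImD; exact: measurable_funD.
Qed.
Lemma cmeasM D F G : cmeas D F -> cmeas D G -> cmeas D (fun z => F z * G z).
Proof.
move=> [h1 h2] [h3 h4]; split.
  under eq_fun do rewrite cReM.
  by apply: measurable_funB; exact: measurable_funM.
under eq_fun do rewrite cImM.
by apply: measurable_funD; exact: measurable_funM.
Qed.
Lemma cmeasC D F : cmeas D F -> cmeas D (fun z => conjc (F z)).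
Proof.
move=> [h1 h2]; split; first by under eq_fun do rewrite cReC.
by under eq_fun do rewrite cImC; exact: measurableT_comp.
Qed.
Lemma cmeas_nm2 D F : cmeas D F -> measurable_fun D (fun p => nm (F (cplx p)) ^+ 2).
Proof.
move=> [h1 h2]; under eq_fun do rewrite nm_sqr.
by apply: measurable_funD; exact: measurable_funX.
Qed.
Lemma cmeas_sub D E F : measurable E -> D `<=` E -> cmeas E F -> cmeas D F.
Proof. by move=> mE DE [h1 h2]; split; [apply: measurable_funS h1|apply: measurable_funS h2]. Qed.

Definition CI D F : C :=
  Complex (\int[dA]_(p in D) complex.Re (F (cplx p)))
          (\int[dA]_(p in D) complex.Im (F (cplx p))).

Definition rinteg D (g : T2 -> R) := dA.-integrable D (EFin \o g).

Definition cinteg D F :=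
  rinteg D (fun p => complex.Re (F (cplx p))) /\ rinteg D (fun p => complex.Im (F (cplx p))).

Lemma rinteg_le D (f g : T2 -> R) : measurable D -> measurable_fun D f -> rinteg D g ->
  (forall p, D p -> `|f p| <= g p) -> rinteg D f.
Proof.
move=> mD mf ig h; apply: (le_integrable mD _ _ ig); first exact/measurable_EFinP.
by move=> p Dp; rewrite /= lee_fin (le_trans (h p Dp))// ler_norm.
Qed.

Lemma cinteg_le D F (g : T2 -> R) : measurable D -> cmeas D F -> rinteg D g ->
  (forall p, D p -> nm (F (cplx p)) <= g p) -> cinteg D F.
Proof.
move=> mD [h1 h2] ig h; split; apply: rinteg_le ig _ => // p /h; apply: le_trans.
  exact: Re_le_nm.
exact: Im_le_nm.
Qed.

Lemma rinteg_cst D (M : R) : measurable D -> (dA D < +oo)%E -> rinteg D (fun=> M).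
Proof.
move=> mD fD; apply/integrableP; split; first exact: measurable_cst.
by rewrite (_ : (fun x => _) = cst (`|M|%:E))// integral_cst// lte_mul_pinfty.
Qed.

Lemma rintegD D (f g : T2 -> R) : measurable D -> rinteg D f -> rinteg D g -> rinteg D (fun p => f p + g p).
Proof. by move=> mD h1 h2; have := integrableD mD h1 h2; apply: eq_integrable. Qed.

Lemma rintegZ D (f : T2 -> R) (r : R) : measurable D -> rinteg D f -> rinteg D (fun p => r * f p).
Proof. by move=> mD h1; have := integrableZl mD r h1; apply: eq_integrable. Qed.

Lemma cintegD D F G : measurable D -> cinteg D F -> cinteg D G -> cinteg D (fun z => F z + G z).
Proof.
move=> mD [h1 h2] [h3 h4]; split.
  by under eq_fun do rewrite cReD; exact: rintegD.
by under eq_fun do rewrite cImD; exact: rintegD.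
Qed.

Lemma cintegZ D F k : measurable D -> cinteg D F -> cinteg D (fun z => k * F z).
Proof.
move=> mD [h1 h2]; split.
  by under eq_fun do rewrite cReM -mulNr; apply: rintegD => //; exact: rintegZ.
by under eq_fun do rewrite cImM; apply: rintegD => //; exact: rintegZ.
Qed.

Lemma CI_eq D F G : (forall p, D p -> F (cplx p) = G (cplx p)) -> CI D F = CI D G.
Proof.
by move=> FG; rewrite /CI; congr Complex; apply: eq_Rintegral => p /set_mem /FG ->.
Qed.

Lemma CID D F G : measurable D -> cinteg D F -> cinteg D G ->
  CI D (fun z => F z + G z) = CI D F + CI D G.
Proof.
move=> mD [h1 h2] [h3 h4]; apply: complex_eq; rewrite ?cReD ?cImD /CI /=.
  by rewrite -RintegralD//; apply: eq_Rintegral => p _; rewrite cReD.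
by rewrite -RintegralD//; apply: eq_Rintegral => p _; rewrite cImD.
Qed.

Lemma CIZ D F k : measurable D -> cinteg D F -> CI D (fun z => k * F z) = k * CI D F.
Proof.
move=> mD [h1 h2]; apply: complex_eq; [rewrite [in RHS]cReM|rewrite [in RHS]cImM]; rewrite /CI /=.
  rewrite -!RintegralZl// -RintegralB//; [|exact: rintegZ|exact: rintegZ].
  by apply: eq_Rintegral => p _; rewrite cReM.
rewrite -!RintegralZl// -RintegralD//; [|exact: rintegZ|exact: rintegZ].
by apply: eq_Rintegral => p _; rewrite cImM.
Qed.

Lemma CI_conj D F : measurable D -> cinteg D F -> CI D (fun z => conjc (F z)) = conjc (CI D F).
Proof.
move=> mD [h1 h2]; apply: complex_eq; rewrite ?cReC ?cImC /CI /=.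
  by apply: eq_Rintegral => p _; rewrite cReC.
rewrite -mulN1r -RintegralZl//; apply: eq_Rintegral => p _; by rewrite cImC mulN1r.
Qed.

Lemma CI0 D : CI D (fun=> 0) = 0.
Proof. by apply: complex_eq; rewrite /CI /= /Rintegral integral0. Qed.

Lemma Rint_le D (f g : T2 -> R) : measurable D -> rinteg D f -> rinteg D g ->
  (forall p, D p -> f p <= g p) -> \int[dA]_(p in D) f p <= \int[dA]_(p in D) g p.
Proof. by move=> mD h1 h2 h; exact: le_Rintegral. Qed.

End ComplexIntegral.

(** * Tonelli's theorem over a measurable subset of a product *)

Section Slices.
Local Open Scope ereal_scope.
Context {d1 d2 : measure_display} {T1 : measurableType d1} {T2 : measurableType d2} {R : realType}.
Context (m1 : {sigma_finite_measure set T1 -> \bar R}) (m2 : {sigma_finite_measure set T2 -> \bar R}).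

Lemma ge0_slices1 (D : set (T1 * T2)) (g : T1 * T2 -> \bar R) : measurable D ->
  measurable_fun D g -> (forall p, D p -> 0 <= g p) ->
  \int[m1 \x m2]_(p in D) g p = \int[m1]_x \int[m2]_(y in xsection D x) g (x, y).
Proof.
move=> mD mg g0; rewrite integral_mkcond fubini_tonelli1.
- apply: eq_integral => x _; rewrite /fubini_F [RHS]integral_mkcond; apply: eq_integral => y _.
  by rewrite !patchE mem_xsection.
- exact/(measurable_restrictT _ _).1.
- by move=> p; rewrite patchE; case: ifPn => // /set_mem /g0.
Qed.

Lemma ge0_slices2 (D : set (T1 * T2)) (g : T1 * T2 -> \bar R) : measurable D ->
  measurable_fun D g -> (forall p, D p -> 0 <= g p) ->
  \int[m1 \x m2]_(p in D) g p = \int[m2]_y \int[m1]_(x in ysection D y) g (x, y).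
Proof.
move=> mD mg g0; rewrite integral_mkcond fubini_tonelli2.
- apply: eq_integral => y _; rewrite /fubini_G [RHS]integral_mkcond; apply: eq_integral => x _.
  by rewrite !patchE mem_ysection.
- exact/(measurable_restrictT _ _).1.
- by move=> p; rewrite patchE; case: ifPn => // /set_mem /g0.
Qed.
End Slices.

(** * Area integrals over a disk computed along chords *)

Section Sections.
Context {R : realType}.
Local Notation mu := (@lebesgue_measure R).
Local Notation T2 := (measurableTypeR R * measurableTypeR R)%type.
Local Notation dA := (@dA R).

Definition chord (r x : R) : set (measurableTypeR R) :=
  `]- Num.sqrt (r ^+ 2 - x ^+ 2), Num.sqrt (r ^+ 2 - x ^+ 2)[%classic.

Lemma disk_ysection (r y : R) : ysection (disk r) y = chord r y.
Proof.
rewrite -[RHS]disk_xsection; apply/seteqP.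
by split => x; rewrite /xsection /ysection /= !inE /disk /= addrC.
Qed.

Lemma ge0_disk_sections1 (g : T2 -> R) (r : R) : measurable_fun (disk r) g ->
  (forall p, disk r p -> 0 <= g p) ->
  (\int[dA]_(p in disk r) (g p)%:E =
   ((pi : R)^-1)%:E * \int[mu]_x \int[mu]_(y in chord r x) (g (x, y))%:E)%E.
Proof.
move=> mg g0; have mD := disk_measurable r; rewrite /Defs.dA.
have /measurable_EFinP mg' := mg.
have gE p : disk r p -> (0 <= (g p)%:E)%E by move=> /g0; rewrite lee_fin.
rewrite (ge0_integral_mscale _ mD _ mg' gE); congr (_ * _)%E; rewrite (ge0_slices1 _ _ mD mg' gE).
by apply: eq_integral => x _; rewrite disk_xsection.
Qed.

Lemma ge0_disk_sections2 (g : T2 -> R) (r : R) : measurable_fun (disk r) g ->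
  (forall p, disk r p -> 0 <= g p) ->
  (\int[dA]_(p in disk r) (g p)%:E =
   ((pi : R)^-1)%:E * \int[mu]_y \int[mu]_(x in chord r y) (g (x, y))%:E)%E.
Proof.
move=> mg g0; have mD := disk_measurable r; rewrite /Defs.dA.
have /measurable_EFinP mg' := mg.
have gE p : disk r p -> (0 <= (g p)%:E)%E by move=> /g0; rewrite lee_fin.
rewrite (ge0_integral_mscale _ mD _ mg' gE); congr (_ * _)%E; rewrite (ge0_slices2 _ _ mD mg' gE).
by apply: eq_integral => x _; rewrite disk_ysection.
Qed.

Lemma dA_disk_lty (r : R) : (dA (disk r) < +oo)%E.
Proof.
have E x : disk x = disk `|x| :> set T2 by rewrite /disk real_normK ?num_real.
have [->|r0] := eqVneq r 0; last by rewrite E dA_disk ?ltry// normr_gt0.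
apply: (@le_lt_trans _ _ (dA (disk 1))); last by rewrite dA_disk// ltry.
apply: le_measure; rewrite ?inE; [exact: disk_measurable|exact: disk_measurable|].
by move=> p; rewrite /disk /= => h; apply: (lt_trans h); rewrite expr0n /= expr1n ltr01.
Qed.

(** Where [f] integrates to zero, only the shift [M] counts. Sections of a disk are open intervals
    while curve integrals live on closed ones, hence the two forms of the chord. *)
Lemma chord_shift (f : R -> R) (M s : R) :
  mu.-integrable `[(- s)%R, s] (EFin \o f) -> \int[mu]_(y in `[(- s)%R, s]) f y = 0 ->
  (\int[mu]_(y in `](- s)%R, s[%classic) (f y + M)%:E = \int[mu]_(y in `](- s)%R, s[%classic) M%:E)%E.
Proof.
move=> hf h0; have [s0|s0] := leP s (- s); first by rewrite set_itv_ge ?integral_set0// bnd_simp -leNgt.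
have sub : (`](- s)%R, s[%classic : set R) `<=` `[(- s)%R, s]%classic by exact: subset_itvW.
have hf' : mu.-integrable `](- s)%R, s[ (EFin \o f) by apply: integrableS hf.
have mI : measurable (`](- s)%R, s[%classic : set (measurableTypeR R)) by exact: measurable_itv.
have fin : (mu `](- s)%R, s[%classic < +oo)%E by rewrite lebesgue_measure_itv/=; case: ifP; rewrite ?ltry.
have hM : mu.-integrable `](- s)%R, s[ (EFin \o (fun=> M)).
  apply/integrableP; split; first exact: measurable_cst.
  by rewrite (_ : (fun x => _) = cst (`|M|%:E))// integral_cst// lte_mul_pinfty.
rewrite integralD_EFin// (_ : integral mu _ (EFin \o f) = 0%E) ?add0e//.
have <- : (\int[mu]_(y in `[(- s)%R, s]) (f y)%:E = \int[mu]_(y in `](- s)%R, s[) (f y)%:E)%E.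
  by rewrite integral_itv_bndoo//; exact: measurable_int hf'.
by rewrite -[LHS]fineK; [congr EFin; exact: h0|exact: integrable_fin_num].
Qed.

(** Tonelli's theorem is applied to the nonnegative function f + M and to the constant [M]: their
    slice integrals agree, so their area integrals do. *)
Lemma green1 (f : T2 -> R) (M r : R) : measurable_fun (disk r) f ->
  (forall p, disk r p -> `|f p| <= M) ->
  (forall x, let s := Num.sqrt (r ^+ 2 - x ^+ 2) in
    mu.-integrable `[(- s)%R, s] (EFin \o (fun y => f (x, y))) /\
    \int[mu]_(y in `[(- s)%R, s]) f (x, y) = 0) ->
  \int[dA]_(p in disk r) f p = 0.
Proof.
move=> mf fM hs; have mD := disk_measurable r; have fD := dA_disk_lty r.
have iM := rinteg_cst M mD fD.
have if_ : rinteg (disk r) f by apply: rinteg_le iM fM.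
have mfM : measurable_fun (disk r) (fun p => f p + M).
  by apply: measurable_funD => //; exact: measurable_cst.
have E : (\int[dA]_(p in disk r) (f p + M)%:E = \int[dA]_(p in disk r) M%:E)%E.
  have mM : measurable_fun (disk r) (fun _ : T2 => M) by exact: measurable_cst.
  have M0 p : disk r p -> 0 <= M by move=> /fM; apply: le_trans.
  have fM0 p : disk r p -> 0 <= f p + M by move=> /fM; rewrite ler_norml => /andP[h _]; lra.
  rewrite (ge0_disk_sections1 mfM fM0) (ge0_disk_sections1 mM M0); congr (_ * _)%E.
  by apply: eq_integral => x _; have [h1 h2] := hs x; exact: chord_shift.
have : \int[dA]_(p in disk r) (f p + M) = \int[dA]_(p in disk r) M by rewrite /Rintegral E.
by rewrite RintegralD// => /eqP; rewrite -subr_eq0 addrK => /eqP.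
Qed.

Lemma green2 (f : T2 -> R) (M r : R) : measurable_fun (disk r) f ->
  (forall p, disk r p -> `|f p| <= M) ->
  (forall y, let s := Num.sqrt (r ^+ 2 - y ^+ 2) in
    mu.-integrable `[(- s)%R, s] (EFin \o (fun x => f (x, y))) /\
    \int[mu]_(x in `[(- s)%R, s]) f (x, y) = 0) ->
  \int[dA]_(p in disk r) f p = 0.
Proof.
move=> mf fM hs; have mD := disk_measurable r; have fD := dA_disk_lty r.
have iM := rinteg_cst M mD fD.
have if_ : rinteg (disk r) f by apply: rinteg_le iM fM.
have mfM : measurable_fun (disk r) (fun p => f p + M).
  by apply: measurable_funD => //; exact: measurable_cst.
have E : (\int[dA]_(p in disk r) (f p + M)%:E = \int[dA]_(p in disk r) M%:E)%E.
  have mM : measurable_fun (disk r) (fun _ : T2 => M) by exact: measurable_cst.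
  have M0 p : disk r p -> 0 <= M by move=> /fM; apply: le_trans.
  have fM0 p : disk r p -> 0 <= f p + M by move=> /fM; rewrite ler_norml => /andP[h _]; lra.
  rewrite (ge0_disk_sections2 mfM fM0) (ge0_disk_sections2 mM M0); congr (_ * _)%E.
  by apply: eq_integral => y _; have [h1 h2] := hs y; exact: (@chord_shift (fun x => f (x, y))).
have : \int[dA]_(p in disk r) (f p + M) = \int[dA]_(p in disk r) M by rewrite /Rintegral E.
by rewrite RintegralD// => /eqP; rewrite -subr_eq0 addrK => /eqP.
Qed.
End Sections.

(** * Green's formula and the integrals of z^j conj(z)^k *)

Section Moments.
Context {R : realType}.
Local Notation C := R[i].
Local Notation T2 := (measurableTypeR R * measurableTypeR R)%type.
Local Notation dA := (@dA R).
Implicit Types (D : set T2) (F G : C -> C) (a : C).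

Definition bm D F := cmeas D F /\ exists M : R, forall p, D p -> nm (F (cplx p)) <= M.

Lemma bm_cst D a : bm D (fun=> a).
Proof. by split; [exact: cmeas_cst|exists (nm a)]. Qed.
Lemma bmD D F G : bm D F -> bm D G -> bm D (fun z => F z + G z).
Proof.
move=> [mF [M hM]] [mG [N hN]]; split; first exact: cmeasD.
by exists (M + N) => p Dp; rewrite (le_trans (nmD _ _))// lerD ?hM ?hN.
Qed.
Lemma bmM D F G : bm D F -> bm D G -> bm D (fun z => F z * G z).
Proof.
move=> [mF [M hM]] [mG [N hN]]; split; first exact: cmeasM.
by exists (M * N) => p Dp; rewrite nmM ler_pM ?hM ?hN ?nm_ge0.
Qed.
Lemma bmC D F : bm D F -> bm D (fun z => conjc (F z)).
Proof.
move=> [mF [M hM]]; split; first exact: cmeasC.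
by exists M => p Dp; rewrite nm_conj hM.
Qed.
Lemma bmX D F n : bm D F -> bm D (fun z => F z ^+ n).
Proof.
move=> hF; elim: n => [|n IH]; first exact: (bm_cst D 1).
by under eq_fun do rewrite exprS; exact: bmM.
Qed.
Lemma bm_id (r : R) : bm (disk r) id.
Proof.
split; first exact: cmeas_id.
exists `|r| => p; rewrite /disk /= => h.
by rewrite -(@ler_pXn2r _ 2)// ?nnegrE ?nm_ge0// nm_sqr /= real_normK ?num_real// ltW.
Qed.
Lemma bm_sum D (F : nat -> C -> C) N : (forall n, bm D (F n)) ->
  bm D (fun z => \sum_(n < N) F n z).
Proof.
move=> hF; elim: N => [|N IH]; first by under eq_fun do rewrite big_ord0; exact: bm_cst.
by under eq_fun do rewrite big_ord_recr /=; exact: bmD.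
Qed.
Lemma bm_cinteg D F : measurable D -> (dA D < +oo)%E -> bm D F -> cinteg D F.
Proof. by move=> mD fD [mF [M hM]]; apply: cinteg_le hM => //; exact: rinteg_cst. Qed.

Definition mono (j k : nat) (z : C) : C := z ^+ j * conjc z ^+ k.

Lemma bm_mono (r : R) j k : bm (disk r) (mono j k).
Proof. by apply: bmM; [apply: bmX|apply: bmX; apply: bmC]; exact: bm_id. Qed.

Lemma cdC (h : R -> C) x d : cd h x d -> cd (fun y => conjc (h y)) x (conjc d).
Proof.
move=> [h1 h2]; split; first by rewrite cReC; under eq_fun do rewrite cReC.
by rewrite cImC; under eq_fun do rewrite cImC; exact: is_deriveN.
Qed.

Lemma cd_eq (h : R -> C) x d e : cd h x d -> d = e -> cd h x e.
Proof. by move=> hd <-. Qed.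

Lemma cdX (h : R -> C) x d n : cd h x d -> cd (fun y => h y ^+ n) x (n%:R * h x ^+ n.-1 * d).
Proof.
move=> hd; elim: n => [|n IH]; first by rewrite !mul0r; exact: (cd_cst 1).
under eq_fun do rewrite exprS; apply: cd_eq (cdM hd IH) _ => /=.
by case: n {IH} => [|n] /=; rewrite ?expr0 ?mul0r ?mulr0 ?exprS -?[in RHS]natr1; ring.
Qed.

Lemma cd_mono (h : R -> C) x d j k : cd h x d ->
  cd (fun y => mono j k (h y)) x (j%:R * mono j.-1 k (h x) * d + k%:R * mono j k.-1 (h x) * conjc d).
Proof.
move=> hd; apply: cd_eq (cdM (cdX j hd) (cdX k (cdC hd))) _; rewrite /mono; ring.
Qed.

Lemma cd_hor (x y : R) : cd (fun t => Complex t y) x 1.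
Proof. by split; [exact: is_derive_id|exact: is_derive_cst]. Qed.

Lemma cd_ver (x y : R) : cd (fun t => Complex x t) y (Complex 0 1).
Proof. by split; [exact: is_derive_cst|exact: is_derive_id]. Qed.

(** Continuity along the two families of lines on which the fundamental theorem of calculus is
    applied. *)
Definition cline F := forall x y : R,
  ccont (fun t => F (Complex t y)) x /\ ccont (fun t => F (Complex x t)) y.

Lemma cline_cst a : cline (fun=> a).
Proof. by move=> x y; split; exact: ccont_cst. Qed.
Lemma clineD F G : cline F -> cline G -> cline (fun z => F z + G z).
Proof.
by move=> hF hG x y; have [h1 h2] := hF x y; have [h3 h4] := hG x y; split; exact: ccontD.
Qed.
Lemma clineM F G : cline F -> cline G -> cline (fun z => F z * G z).
Proof.
by move=> hF hG x y; have [h1 h2] := hF x y; have [h3 h4] := hG x y; split; exact: ccontM.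
Qed.
Lemma clineX F n : cline F -> cline (fun z => F z ^+ n).
Proof.
move=> hF; elim: n => [|n IH]; first exact: (cline_cst 1).
by under eq_fun do rewrite exprS; exact: (clineM hF IH).
Qed.
Lemma cline_mono j k : cline (mono j k).
Proof.
have cl : cline id.
  by move=> x y; split; apply: (@ccont_lip _ _ _ 1) => t; rewrite mul1r;
     rewrite (le_trans (nm_le_ReIm _))// cReD cReN cImD cImN /= subrr normr0 ?addr0 ?add0r.
apply: clineM; apply: clineX => // x y; split; apply: (@ccont_lip _ _ _ 1) => t; rewrite mul1r;
  rewrite (le_trans (nm_le_ReIm _))// cReD cReN cImD cImN /= subrr normr0 ?addr0 ?add0r//.
by rewrite -opprD normrN.
Qed.

Lemma ltNpos (s : R) : 0 < s -> - s < s.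
Proof. by move=> s0; lra. Qed.

(** On a horizontal chord [w] integrates to the difference of [W] at the two ends, which lie on the
    circle where [W] vanishes. *)
Lemma green_x (W w : C -> C) (r : R) : bm (disk r) w -> cline w ->
  (forall x y, cd (fun t => W (Complex t y)) x (w (Complex x y))) ->
  (forall z, nm z ^+ 2 = r ^+ 2 -> W z = 0) -> CI (disk r) w = 0.
Proof.
move=> [mw [M hM]] cw dW W0.
have ab (y : R) (s := Num.sqrt (r ^+ 2 - y ^+ 2)) : contab (- s) s (fun t => w (Complex t y)).
  by move=> x _; have [] := cw x y.
have I0 (y : R) (s := Num.sqrt (r ^+ 2 - y ^+ 2)) : cint (- s) s (fun t => w (Complex t y)) = 0.
  (* This includes |y| > |r|, since the square root of a negative number is 0. *)
  have [s0|s0] := eqVneq s 0.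
    by rewrite s0 oppr0; apply: complex_eq; rewrite /cint /= set_itv1 Rintegral_set1.
  have sp : 0 < s by rewrite lt_neqAle eq_sym s0 sqrtr_ge0.
  have ss : s ^+ 2 = r ^+ 2 - y ^+ 2.
    by rewrite sqr_sqrtr//; move: sp; rewrite sqrtr_gt0 => /ltW.
  have ns := ltNpos sp.
  rewrite (cint_FTC ns (fun x _ => dW x y) (ab y)).
  by rewrite !W0 ?subrr// nm_sqr /= ?sqrrN ss subrK.
apply: complex_eq; rewrite /CI /=.
  apply: (@green2 R (fun p => complex.Re (w (cplx p))) M) => [|p /hM|y s].
  - by case: mw.
  - by apply: le_trans; exact: Re_le_nm.
  - by split; [exact: (int_Re (ab y))|have /(congr1 (@complex.Re R)) := I0 y].
apply: (@green2 R (fun p => complex.Im (w (cplx p))) M) => [|p /hM|y s].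
- by case: mw.
- by apply: le_trans; exact: Im_le_nm.
- by split; [exact: (int_Im (ab y))|have /(congr1 (@complex.Im R)) := I0 y].
Qed.

Lemma green_y (W w : C -> C) (r : R) : bm (disk r) w -> cline w ->
  (forall x y, cd (fun t => W (Complex x t)) y (w (Complex x y))) ->
  (forall z, nm z ^+ 2 = r ^+ 2 -> W z = 0) -> CI (disk r) w = 0.
Proof.
move=> [mw [M hM]] cw dW W0.
have ab (x : R) (s := Num.sqrt (r ^+ 2 - x ^+ 2)) : contab (- s) s (fun t => w (Complex x t)).
  by move=> y _; have [] := cw x y.
have I0 (x : R) (s := Num.sqrt (r ^+ 2 - x ^+ 2)) : cint (- s) s (fun t => w (Complex x t)) = 0.
  have [s0|s0] := eqVneq s 0.
    by rewrite s0 oppr0; apply: complex_eq; rewrite /cint /= set_itv1 Rintegral_set1.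
  have sp : 0 < s by rewrite lt_neqAle eq_sym s0 sqrtr_ge0.
  have ss : s ^+ 2 = r ^+ 2 - x ^+ 2.
    by rewrite sqr_sqrtr//; move: sp; rewrite sqrtr_gt0 => /ltW.
  have ns := ltNpos sp.
  rewrite (cint_FTC ns (fun y _ => dW x y) (ab x)).
  by rewrite !W0 ?subrr// nm_sqr /= ?sqrrN ss addrC subrK.
apply: complex_eq; rewrite /CI /=.
  apply: (@green1 R (fun p => complex.Re (w (cplx p))) M) => [|p /hM|x s].
  - by case: mw.
  - by apply: le_trans; exact: Re_le_nm.
  - by split; [exact: (int_Re (ab x))|have /(congr1 (@complex.Re R)) := I0 x].
apply: (@green1 R (fun p => complex.Im (w (cplx p))) M) => [|p /hM|x s].
- by case: mw.
- by apply: le_trans; exact: Im_le_nm.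
- by split; [exact: (int_Im (ab x))|have /(congr1 (@complex.Im R)) := I0 x].
Qed.

Definition moment (r : R) j k : C := CI (disk r) (mono j k).

(* Green's formula for $z^j \bar z^k (|z|^2 - r^2)$, which vanishes on the circle
   of radius [r]: the integral over the disk of its $\partial_z$ derivative is zero. *)
Lemma moment_rec (r : R) j k :
  j.+1%:R * moment r j k.+1 = (r ^+ 2)%:C%C * (j%:R * moment r j.-1 k).
Proof.
have mD := disk_measurable r; have fD := dA_disk_lty r.
pose c2 : C := (r ^+ 2)%:C%C.
(* [A] and [B] are the derivatives of [W] with respect to z and conj z: the x-derivative is A + B,
   the y-derivative i (A - B). Both have zero integral, hence so does [A]. *)
pose A (z : C) := j.+1%:R * mono j k.+1 z + (- c2) * (j%:R * mono j.-1 k z).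
pose B (z : C) := k.+1%:R * mono j.+1 k z + (- c2) * (k%:R * mono j k.-1 z).
pose W (z : C) := mono j.+1 k.+1 z + (- c2) * mono j k z.
pose ii : C := Complex 0 1.
have bmA : bm (disk r) A.
  exact: (bmD (bmM (bm_cst _ _) (bm_mono _ _ _)) (bmM (bm_cst _ _) (bmM (bm_cst _ _) (bm_mono _ _ _)))).
have bmB : bm (disk r) B.
  exact: (bmD (bmM (bm_cst _ _) (bm_mono _ _ _)) (bmM (bm_cst _ _) (bmM (bm_cst _ _) (bm_mono _ _ _)))).
have clA : cline A.
  exact: (clineD (clineM (cline_cst _) (cline_mono _ _)) (clineM (cline_cst _) (clineM (cline_cst _) (cline_mono _ _)))).
have clB : cline B.
  exact: (clineD (clineM (cline_cst _) (cline_mono _ _)) (clineM (cline_cst _) (clineM (cline_cst _) (cline_mono _ _)))).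
have W0 z : nm z ^+ 2 = r ^+ 2 -> W z = 0.
  move=> zr; rewrite /W /mono; have := mul_conj z; rewrite zr -/c2 => <-.
  by rewrite !exprS; ring.
have dW (h : R -> C) x d : cd h x d -> cd (fun t => W (h t)) x (A (h x) * d + B (h x) * conjc d).
  move=> hd; rewrite /W.
  apply: cd_eq (cdD (cd_mono j.+1 k.+1 hd) (cdM (cd_cst (- c2) x) (cd_mono j k hd))) _.
  by rewrite /A /B /=; ring.
have X0 : CI (disk r) (fun z => A z + B z) = 0.
  apply: (@green_x W) => //; [exact: (bmD bmA bmB)|exact: (clineD clA clB)|].
  move=> x y; apply: cd_eq (dW _ _ _ (cd_hor x y)) _.
  by rewrite cj1 !mulr1.
have Y0 : CI (disk r) (fun z => ii * (A z + (-1) * B z)) = 0.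
  apply: (@green_y W) => //.
  - exact: (bmM (bm_cst _ _) (bmD bmA (bmM (bm_cst _ _) bmB))).
  - exact: (clineM (cline_cst _) (clineD clA (clineM (cline_cst _) clB))).
  move=> x y; apply: cd_eq (dW _ _ _ (cd_ver x y)) _.
  have -> : conjc (Complex 0 1) = - ii by apply: complex_eq; rewrite /= ?oppr0.
  rewrite -/ii; ring.
have iA := bm_cinteg mD fD bmA; have iB := bm_cinteg mD fD bmB.
have iB' := cintegZ (-1) mD iB.
move: X0 Y0; rewrite CIZ//; last exact: cintegD.
rewrite (CID mD iA iB) (CID mD iA iB') (CIZ _ mD iB) => X0 /eqP; rewrite mulf_eq0 (_ : ii == 0 = false) /=; last first.
  by apply/negP => /eqP /(congr1 (@complex.Im R)) /= /eqP; rewrite oner_eq0.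
move=> /eqP Y0; have A0 : CI (disk r) A = 0.
  have : 2 * CI (disk r) A = 0.
    by rewrite (_ : 2 * _ = (CI (disk r) A + CI (disk r) B) + (CI (disk r) A + -1 * CI (disk r) B)); [rewrite X0 Y0 addr0|ring].
  by move=> /eqP; rewrite mulf_eq0 pnatr_eq0 /= => /eqP.
have im j' k' : cinteg (disk r) (mono j' k') by apply: bm_cinteg => //; exact: bm_mono.
have iZ a j' k' := cintegZ a mD (im j' k').
move: A0; rewrite /A (CID mD (iZ _ _ _) (cintegZ _ mD (iZ _ _ _))) (CIZ _ mD (iZ _ _ _)).
by rewrite !(CIZ _ mD (im _ _)) mulNr => /eqP; rewrite subr_eq0 => /eqP.
Qed.

Lemma moment_conj (r : R) j k : moment r j k = conjc (moment r k j).
Proof.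
rewrite /moment -CI_conj; [|exact: disk_measurable|].
  by apply: CI_eq => p _; rewrite /mono cjM !cjX conjcK mulrC.
by apply: bm_cinteg; [exact: disk_measurable|exact: dA_disk_lty|exact: bm_mono].
Qed.

(** [moment_rec] lowers both exponents together and kills the moments with j = 0 < k; conjugation
    handles k = 0 < j, and the area of the disk is left. *)
Lemma momentE (r : R) j k : 0 < r ->
  moment r j k = if j == k then (r ^+ (2 * j.+1) / j.+1%:R)%:C%C else 0.
Proof.
move=> r0; have nz n : n.+1%:R != 0 :> C by rewrite pnatr_eq0.
have m0 n : moment r 0 n.+1 = 0.
  by have := moment_rec r 0 n; rewrite mul0r mulr0 mul1r.
elim: j k => [|j IH] [|k].
- rewrite /= divr1 muln1; apply: complex_eq; rewrite /moment /CI /mono /=.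
    transitivity (\int[dA]_(p in disk r) (1 : R)).
      by apply: eq_Rintegral => p _; rewrite ?mulr1 ?mulr0 ?mul0r ?subr0 ?addr0.
    by rewrite Rintegral_cst; [rewrite mul1r dA_disk|exact: disk_measurable].
  transitivity (\int[dA]_(p in disk r) (0 : R)).
    by apply: eq_Rintegral => p _; rewrite ?mulr1 ?mulr0 ?mul0r ?subr0 ?addr0.
  by rewrite Rintegral_cst ?mul0r//; exact: disk_measurable.
- by rewrite m0.
- by rewrite moment_conj m0 cj0.
- apply: (mulfI (nz j.+1)); rewrite moment_rec /= IH eqSS; case: eqP => [_|_]; last by rewrite !mulr0.
  rewrite -!rc_nat -!rcM; congr (_%:C)%C.
  have -> : r ^+ (2 * j.+2) = r ^+ 2 * r ^+ (2 * j.+1) by rewrite -exprD -mulnS.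
  by rewrite (mulrCA _ (r ^+ 2 * _)) mulfV ?pnatr_eq0// mulr1 (mulrCA _ (r ^+ (2 * j.+1))) mulfV ?pnatr_eq0// mulr1.
Qed.
End Moments.

(** * Bergman space functions in coordinates *)

Section InnerProduct.
Context {R : realType}.
Local Notation C := R[i].
Local Notation T2 := (measurableTypeR R * measurableTypeR R)%type.
Local Notation dA := (@dA R).
Context (D : set T2) (mD : measurable D).
Implicit Types (F G H : C -> C) (k : C).

Definition l2 F := cmeas D F /\ rinteg D (fun p => nm (F (cplx p)) ^+ 2).
Definition sq F : R := \int[dA]_(p in D) (nm (F (cplx p)) ^+ 2).
Definition ip F G : C := CI D (fun z => F z * conjc (G z)).

Lemma l2_le F (g : T2 -> R) : cmeas D F -> rinteg D g ->
  (forall p, D p -> nm (F (cplx p)) ^+ 2 <= g p) -> l2 F.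
Proof.
move=> mF ig h; split => //; apply: rinteg_le ig _ => //; first exact: cmeas_nm2.
by move=> p /h; rewrite ger0_norm// sqr_ge0.
Qed.

Lemma l2_eq F G : (forall p, D p -> F (cplx p) = G (cplx p)) -> l2 F -> l2 G.
Proof.
move=> FG [mF iF]; apply: l2_le iF _; first exact: cmeas_eq FG mF.
by move=> p /FG ->.
Qed.

Lemma sq_eq F G : (forall p, D p -> F (cplx p) = G (cplx p)) -> sq F = sq G.
Proof. by move=> FG; apply: eq_Rintegral => p /set_mem /FG ->. Qed.

Lemma ip_eq F F' G G' : (forall p, D p -> F (cplx p) = F' (cplx p)) ->
  (forall p, D p -> G (cplx p) = G' (cplx p)) -> ip F G = ip F' G'.
Proof. by move=> h1 h2; apply: CI_eq => p Dp; rewrite h1// h2. Qed.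

Lemma l2D F G : l2 F -> l2 G -> l2 (fun z => F z + G z).
Proof.
move=> [mF iF] [mG iG]; apply: (l2_le _ (rintegZ 2 mD (rintegD mD iF iG))); first exact: cmeasD.
move=> p _; have h := nmD (F (cplx p)) (G (cplx p)).
apply: (@le_trans _ _ ((nm (F (cplx p)) + nm (G (cplx p))) ^+ 2)).
  by rewrite lerXn2r ?nnegrE ?addr_ge0 ?nm_ge0.
by have := sqr_ge0 (nm (F (cplx p)) - nm (G (cplx p))); rewrite sqrrB sqrrD; lra.
Qed.

Lemma l2_bmM F G : bm D F -> l2 G -> l2 (fun z => F z * G z).
Proof.
move=> [mF [M hM]] [mG iG]; apply: (l2_le _ (rintegZ (M ^+ 2) mD iG)); first exact: cmeasM.
move=> p /hM h; rewrite nmM exprMn ler_wpM2r ?sqr_ge0//.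
by rewrite lerXn2r ?nnegrE ?nm_ge0// (le_trans (nm_ge0 _) h).
Qed.

Lemma l2Z F k : l2 F -> l2 (fun z => k * F z).
Proof. by apply: l2_bmM; exact: bm_cst. Qed.

Lemma l2B F G : l2 F -> l2 G -> l2 (fun z => F z - G z).
Proof.
move=> hF hG; apply: (@l2_eq (fun z => F z + -1 * G z)); first by move=> p _; rewrite mulN1r.
by apply: l2D => //; exact: l2Z.
Qed.

Lemma l2_bm F : (dA D < +oo)%E -> bm D F -> l2 F.
Proof.
move=> fD [mF [M hM]]; apply: (l2_le mF (rinteg_cst (M ^+ 2) mD fD)).
by move=> p /hM h; rewrite lerXn2r ?nnegrE ?nm_ge0// (le_trans (nm_ge0 _) h).
Qed.

Lemma l2_cinteg F G : l2 F -> l2 G -> cinteg D (fun z => F z * conjc (G z)).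
Proof.
move=> [mF iF] [mG iG]; apply: (cinteg_le mD _ (rintegD mD iF iG)).
  by apply: cmeasM => //; exact: cmeasC.
move=> p _; rewrite nmM nm_conj; move: (nm _) (nm _) => x y; nra.
Qed.

Lemma sq_ge0 F : 0 <= sq F.
Proof. by apply: Rintegral_ge0 => p _; exact: sqr_ge0. Qed.

Lemma ip_self F : ip F F = (sq F)%:C%C.
Proof.
apply: complex_eq; rewrite /ip /CI /sq /=; first by apply: eq_Rintegral => p _; rewrite mul_conj.
transitivity (\int[dA]_(p in D) (0 : R)); last by rewrite /Rintegral integral0.
by apply: eq_Rintegral => p _; rewrite mul_conj.
Qed.

Lemma ipDl F G H : l2 F -> l2 G -> l2 H -> ip (fun z => F z + G z) H = ip F H + ip G H.
Proof.
move=> hF hG hH; rewrite /ip -(CID mD (l2_cinteg hF hH) (l2_cinteg hG hH)).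
by apply: CI_eq => p _; rewrite mulrDl.
Qed.

Lemma ipZl F G k : l2 F -> l2 G -> ip (fun z => k * F z) G = k * ip F G.
Proof.
move=> hF hG; rewrite /ip -(CIZ _ mD (l2_cinteg hF hG)).
by apply: CI_eq => p _; rewrite mulrA.
Qed.

Lemma ip_conj F G : l2 F -> l2 G -> ip G F = conjc (ip F G).
Proof.
move=> hF hG; rewrite /ip -(CI_conj mD (l2_cinteg hF hG)).
by apply: CI_eq => p _; rewrite cjM conjcK mulrC.
Qed.

Lemma ipDr F G H : l2 F -> l2 G -> l2 H -> ip H (fun z => F z + G z) = ip H F + ip H G.
Proof.
move=> hF hG hH; rewrite (ip_conj (l2D hF hG) hH) ipDl// cjD.
by rewrite -!ip_conj.
Qed.

Lemma ipZr F G k : l2 F -> l2 G -> ip F (fun z => k * G z) = conjc k * ip F G.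
Proof. by move=> hF hG; rewrite (ip_conj (l2Z k hG) hF) ipZl// cjM -ip_conj. Qed.

Lemma sq_add F G : l2 F -> l2 G ->
  sq (fun z => F z + G z) = sq F + sq G + 2 * complex.Re (ip F G).
Proof.
move=> hF hG; have hFG := l2D hF hG.
transitivity (complex.Re (ip (fun z => F z + G z) (fun z => F z + G z))); first by rewrite ip_self.
rewrite (ipDl hF hG hFG) (ipDr hF hG hF) (ipDr hF hG hG) !cReD !ip_self (ip_conj hF hG) cReC.
by rewrite ![complex.Re _%:C%C]/=; ring.
Qed.

Lemma sqZ F k : l2 F -> sq (fun z => k * F z) = nm k ^+ 2 * sq F.
Proof.
move=> [_ iF]; rewrite /sq -(RintegralZl _ mD iF); apply: eq_Rintegral => p _.
by rewrite nmM exprMn.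
Qed.

Lemma sq_le F G (M : R) : l2 F -> l2 G ->
  (forall p, D p -> nm (F (cplx p)) ^+ 2 <= M * nm (G (cplx p)) ^+ 2) -> sq F <= M * sq G.
Proof.
move=> [_ iF] [_ iG] h; rewrite /sq -(RintegralZl _ mD iG).
exact: (Rint_le mD iF (rintegZ M mD iG) h).
Qed.

(** Positivity of |F - t c G|^2 with c = <F, G> and t real; t = 1 / |G|^2 is optimal. *)
Lemma cauchy_schwarz F G : l2 F -> l2 G -> nm (ip F G) ^+ 2 <= sq F * sq G.
Proof.
move=> hF hG; pose c := ip F G.
have key (t : R) : 0 <= sq F + t ^+ 2 * nm c ^+ 2 * sq G - 2 * t * nm c ^+ 2.
  have := sq_ge0 (fun z => F z + (- t%:C%C * c) * G z); rewrite (sq_add hF (l2Z _ hG)) sqZ// ipZr// -/c.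
  have -> : nm (- t%:C%C * c) ^+ 2 = t ^+ 2 * nm c ^+ 2 by rewrite nmM nmN nmR exprMn real_normK ?num_real.
  have -> : conjc (- t%:C%C * c) * c = (- t * nm c ^+ 2)%:C%C.
    rewrite rcM -mul_conj cjM cjN (_ : conjc t%:C%C = t%:C%C) ?rmorphN /=; first by ring.
    by rewrite oppr0.
  by rewrite [complex.Re _]/=; lra.
have F0 := sq_ge0 F; have G0 := sq_ge0 G; have c0 : 0 <= nm c ^+ 2 := sqr_ge0 _.
have [Gz|Gnz] := eqVneq (sq G) 0.
  (* When |G| = 0 and c is nonzero, this t turns [key] into 0 <= -1. *)
  have h := key ((sq F + 1) / (2 * nm c ^+ 2)).
  have [->|cn] := eqVneq (nm c ^+ 2) 0; first by rewrite mulr_ge0.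
  exfalso; move: h cn; rewrite Gz mulr0 addr0; move: (nm c ^+ 2) => n h cn; move: h.
  have -> : 2 * ((sq F + 1) / (2 * n)) * n = sq F + 1 by field.
  by lra.
have Gp : 0 < sq G by rewrite lt_neqAle eq_sym Gnz.
have := key (sq G)^-1.
rewrite -(@ler_pM2r _ (sq G)) //; set n := nm c ^+ 2 in c0 *; move=> h.
have E : (sq F + (sq G)^-1 ^+ 2 * n * sq G - 2 * (sq G)^-1 * n) * sq G = sq F * sq G - n by field.
by move: h; rewrite mul0r E subr_ge0.
Qed.

Definition l2norm F := Num.sqrt (sq F).

Lemma l2norm_ge0 F : 0 <= l2norm F.
Proof. exact: sqrtr_ge0. Qed.

Lemma l2norm_sqr F : l2norm F ^+ 2 = sq F.
Proof. by rewrite sqr_sqrtr// sq_ge0. Qed.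

Lemma l2norm_ip F G : l2 F -> l2 G -> nm (ip F G) <= l2norm F * l2norm G.
Proof.
move=> hF hG; rewrite -(@ler_pXn2r _ 2)// ?nnegrE ?nm_ge0 ?mulr_ge0 ?l2norm_ge0//.
by rewrite exprMn !l2norm_sqr cauchy_schwarz.
Qed.

Lemma l2normD F G : l2 F -> l2 G -> l2norm (fun z => F z + G z) <= l2norm F + l2norm G.
Proof.
move=> hF hG; rewrite -(@ler_pXn2r _ 2)// ?nnegrE ?addr_ge0 ?l2norm_ge0//.
rewrite l2norm_sqr (sq_add hF hG) sqrrD !l2norm_sqr -mulr_natl.
have : complex.Re (ip F G) <= l2norm F * l2norm G.
  by rewrite (le_trans (ler_norm _))// (le_trans (Re_le_nm _))// l2norm_ip.
by lra.
Qed.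

Lemma l2normZ F k : l2 F -> l2norm (fun z => k * F z) = nm k * l2norm F.
Proof. by move=> hF; rewrite /l2norm sqZ// sqrtrM ?sqr_ge0// sqrtr_sqr ger0_norm// nm_ge0. Qed.
End InnerProduct.

(** * Polynomials and power series on smaller disks *)

Section DiskSeries.
Context {R : realType}.
Local Notation C := R[i].
Local Notation T2 := (measurableTypeR R * measurableTypeR R)%type.
Local Notation dA := (@dA R).
Implicit Types (F G : C -> C) (u : nat -> C) (r : R).

Definition pp u N (z : C) : C := \sum_(n < N) u n * z ^+ n.

Let mD r := disk_measurable r.
Let fD r := dA_disk_lty r.

Lemma nm_disk r (p : T2) : 0 <= r -> disk r p <-> nm (cplx p) < r.
Proof.
move=> r0; have -> : (nm (cplx p) < r) = (nm (cplx p) ^+ 2 < r ^+ 2).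
  by rewrite ltr_pXn2r ?nnegrE ?nm_ge0.
by rewrite nm_sqr.
Qed.

Lemma bm_pow r n : bm (disk r) (fun z : C => z ^+ n).
Proof. by apply: bmX; exact: bm_id. Qed.

Lemma bm_pp r u N : bm (disk r) (pp u N).
Proof.
by apply: (@bm_sum R (disk r) (fun n z => u n * z ^+ n)) => n; apply: bmM; [exact: bm_cst|exact: bm_pow].
Qed.

Lemma l2_pow r n : l2 (disk r) (fun z : C => z ^+ n).
Proof. exact: (l2_bm (mD r) (fD r) (bm_pow r n)). Qed.

Lemma l2_pp r u N : l2 (disk r) (pp u N).
Proof. exact: (l2_bm (mD r) (fD r) (bm_pp r u N)). Qed.

Lemma ppS u N : pp u N.+1 = (fun z => pp u N z + u N * z ^+ N).
Proof. by apply/funext => z; rewrite /pp big_ord_recr. Qed.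

Lemma ip_pow r j k : 0 < r -> ip (disk r) (fun z => z ^+ j) (fun z => z ^+ k) =
  if j == k then (r ^+ (2 * j.+1) / j.+1%:R)%:C%C else 0.
Proof.
by move=> r0; rewrite -momentE//; apply: CI_eq => p _; rewrite cjX.
Qed.

Lemma ip_pp_r r u N G : l2 (disk r) G ->
  ip (disk r) (pp u N) G = \sum_(n < N) u n * ip (disk r) (fun z => z ^+ n) G.
Proof.
move=> hG; elim: N => [|N IH].
  rewrite big_ord0 -[RHS](CI0 (disk r)); apply: CI_eq => p _.
  by rewrite /pp big_ord0 mul0r.
rewrite ppS (ipDl (mD r) (l2_pp r u N) (l2Z (mD r) _ (l2_pow r N)) hG).
by rewrite (ipZl (mD r) _ (l2_pow r N) hG) IH big_ord_recr.
Qed.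

Lemma sum_mul_delta u (w : nat -> C) N k :
  \sum_(n < N) u n * (if n == k :> nat then w n else 0) = if (k < N)%N then w k * u k else 0.
Proof.
elim: N => [|N IH]; first by rewrite big_ord0.
rewrite big_ord_recr /= IH; have [->|nk] := eqVneq N k.
  by rewrite ltnn ltnSn add0r mulrC.
by rewrite mulr0 addr0 ltnS [in RHS]leq_eqVlt eq_sym (negbTE nk).
Qed.

Lemma ip_pp_pow r u N k : 0 < r -> ip (disk r) (pp u N) (fun z => z ^+ k) =
  if (k < N)%N then (r ^+ (2 * k.+1) / k.+1%:R)%:C%C * u k else 0.
Proof.
move=> r0; rewrite (ip_pp_r _ _ (l2_pow r k)).
apply: etrans (sum_mul_delta u (fun n => (r ^+ (2 * n.+1) / n.+1%:R)%:C%C) N k).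
by apply: eq_bigr => n _; rewrite (ip_pow _ _ r0).
Qed.

Lemma sq_pp r u N : 0 < r ->
  sq (disk r) (pp u N) = \sum_(n < N) nm (u n) ^+ 2 * (r ^+ (2 * n.+1) / n.+1%:R).
Proof.
move=> r0; elim: N => [|N IH].
  rewrite big_ord0 /sq; transitivity (\int[dA]_(p in disk r) (0 : R)).
    by apply: eq_Rintegral => p _; rewrite /pp big_ord0 nm0 expr0n.
  by rewrite /Rintegral integral0.
rewrite ppS (sq_add (mD r) (l2_pp r u N) (l2Z (mD r) _ (l2_pow r N))).
rewrite (ipZr (mD r) _ (l2_pp r u N) (l2_pow r N)) ip_pp_pow// ltnn mulr0 /= mulr0 addr0.
rewrite (sqZ (mD r) _ (l2_pow r N)) big_ord_recr /= IH; congr (_ + _ * _).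
by have := ip_self (disk r) (fun z : C => z ^+ N); rewrite ip_pow// eqxx => /(congr1 (@complex.Re R)).
Qed.

Lemma ps_unif u r e : pbd u -> 0 <= r -> r < 1 -> 0 < e ->
  exists N0, forall N z, (N0 <= N)%N -> nm z <= r -> nm (ps u z - pp u N z) <= e.
Proof.
move=> hu r0 r1 e0; have [B [th [B0 th0 th1 h]]] := pbd_geom hu r0 r1.
pose L := 2 * (B / (1 - th)) + 1.
have L0 : 0 < L by rewrite ltr_wpDl// mulr_ge0// divr_ge0// subr_ge0 ltW.
have [N0 hN] := pow_small th0 th1 (divr_gt0 e0 L0); exists N0 => N z N0N /h hz.
rewrite nm_dist (le_trans (ps_rate th0 th1 hz N))//.
have /ltW := hN N N0N; rewrite ler_pdivlMr// => hh; rewrite (le_trans _ hh)//.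
by rewrite mulrC ler_wpM2l ?exprn_ge0// lerDl.
Qed.

Lemma cmeas_lim (D : set T2) (Fn : nat -> C -> C) F : (forall n, cmeas D (Fn n)) ->
  (forall p, D p -> forall e, 0 < e ->
     exists N, forall n, (N <= n)%N -> nm (F (cplx p) - Fn n (cplx p)) <= e) -> cmeas D F.
Proof.
move=> hm hl; split.
  apply: (@measurable_fun_cvg _ _ _ _ (fun n p => complex.Re (Fn n (cplx p)))) => [m|p Dp].
    by case: (hm m).
  apply/cvgrPdist_le => e e0; have [N hN] := hl p Dp e e0.
  exists N => // n /= Nn; rewrite -cReN -cReD (le_trans (Re_le_nm _))//; exact: hN.
apply: (@measurable_fun_cvg _ _ _ _ (fun n p => complex.Im (Fn n (cplx p)))) => [m|p Dp].
  by case: (hm m).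
apply/cvgrPdist_le => e e0; have [N hN] := hl p Dp e e0.
exists N => // n /= Nn; rewrite -cImN -cImD (le_trans (Im_le_nm _))//; exact: hN.
Qed.

Lemma cmeas_ps u : pbd u -> cmeas (disk 1) (ps u).
Proof.
move=> hu; apply: (@cmeas_lim _ (pp u)) => [n|p /(nm_disk _ ler01) p1]; first by case: (bm_pp 1 u n).
by move=> e e0; have [N hN] := ps_unif hu (nm_ge0 _) p1 e0; exists N => n Nn; exact: hN.
Qed.

Lemma disk_sub r s : 0 <= r -> r <= s -> (disk r : set T2) `<=` disk s.
Proof.
move=> r0 rs p /(nm_disk _ r0) h; apply/(nm_disk _ (le_trans r0 rs)); exact: lt_le_trans h rs.
Qed.

Lemma bm_ps u r : pbd u -> 0 <= r -> r < 1 -> bm (disk r) (ps u).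
Proof.
move=> hu r0 r1; split.
  by apply: (cmeas_sub (mD 1)) (cmeas_ps hu); apply: disk_sub => //; exact: ltW.
have [N /(_ N _ (leqnn N)) hN] := ps_unif hu r0 r1 ltr01; have [_ [M hM]] := bm_pp r u N.
exists (1 + M) => p rp; have /(nm_disk _ r0)/ltW pr := rp.
rewrite -(subrK (pp u N (cplx p)) (ps u _)) (le_trans (nmD _ _))// lerD//; [exact: hN|exact: hM].
Qed.

Lemma l2norm_cst_le r e F : 0 < r -> 0 <= e -> l2 (disk r) F ->
  (forall z, nm z <= r -> nm (F z) <= e) -> l2norm (disk r) F <= e * r.
Proof.
move=> r0 e0 hF h; rewrite -(@ler_pXn2r _ 2)// ?nnegrE ?mulr_ge0 ?l2norm_ge0 ?(ltW r0)// l2norm_sqr.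
have h1 := l2_pow r 0.
have := sq_le (M := e ^+ 2) (mD r) hF h1 => /(_ _)/le_trans; apply.
  move=> p /(nm_disk _ (ltW r0)) /ltW/h hp; rewrite expr0 nm1 expr1n mulr1.
  by rewrite lerXn2r ?nnegrE ?nm_ge0.
rewrite exprMn ler_wpM2l ?sqr_ge0//.
have := ip_self (disk r) (fun z : C => z ^+ 0); rewrite ip_pow// eqxx => /(congr1 (@complex.Re R)) /=.
by rewrite muln1 divr1 => ->.
Qed.

Lemma ip_ps_pow u r k : pbd u -> 0 < r -> r < 1 ->
  ip (disk r) (ps u) (fun z => z ^+ k) = (r ^+ (2 * k.+1) / k.+1%:R)%:C%C * u k.
Proof.
move=> hu r0 r1; apply/eqP; rewrite -subr_eq0 -nm_eq0 eq_le nm_ge0 andbT.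
apply/ler_addgt0Pr => e e0; rewrite add0r.
have hps := l2_bm (mD r) (fD r) (bm_ps hu (ltW r0) r1).
pose K := l2norm (disk r) (fun z : C => z ^+ k) + 1.
have K0 : 0 < K by rewrite ltr_wpDl// l2norm_ge0.
have eK : 0 < e / K by rewrite divr_gt0.
have [N0 hN0] := ps_unif hu (ltW r0) r1 eK; pose N := maxn N0 k.+1.
have hN z : nm z <= r -> nm (ps u z - pp u N z) <= e / K.
  by apply: hN0; exact: leq_maxl.
have := ip_pp_pow u N k r0; rewrite leq_maxr => <-.
have hd := l2B (mD r) hps (l2_pp r u N).
have E : ip (disk r) (ps u) (fun z => z ^+ k) =
    ip (disk r) (fun z => ps u z - pp u N z) (fun z => z ^+ k) + ip (disk r) (pp u N) (fun z => z ^+ k).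
  rewrite -(ipDl (mD r) hd (l2_pp r u N) (l2_pow r k)); apply: ip_eq => // p _.
  by rewrite subrK.
rewrite E addrK (le_trans (l2norm_ip (mD r) hd (l2_pow r k)))//.
have h1 := l2norm_cst_le r0 (ltW eK) hd hN.
have h2 : l2norm (disk r) (fun z => ps u z - pp u N z) <= e / K.
  by rewrite (le_trans h1)// ler_piMr// ltW.
rewrite (le_trans (ler_wpM2r (l2norm_ge0 _ _) h2))// mulrAC ler_pdivrMr// ler_wpM2l ?(ltW e0)//.
by rewrite lerDl.
Qed.

Lemma l2norm_ps u r B : pbd u -> 0 < r -> r < 1 -> 0 <= B ->
  (forall N, \sum_(n < N) nm (u n) ^+ 2 / n.+1%:R <= B ^+ 2) -> l2norm (disk r) (ps u) <= B.
Proof.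
move=> hu r0 r1 B0 hB; apply/ler_addgt0Pr => e e0.
have hps := l2_bm (mD r) (fD r) (bm_ps hu (ltW r0) r1).
have [N /(_ N _ (leqnn N)) hN] := ps_unif hu (ltW r0) r1 e0.
have hd := l2B (mD r) hps (l2_pp r u N).
have -> : l2norm (disk r) (ps u) = l2norm (disk r) (fun z => pp u N z + (ps u z - pp u N z)).
  by congr Num.sqrt; apply: sq_eq => p _; rewrite addrC subrK.
rewrite (le_trans (l2normD (mD r) (l2_pp r u N) hd))// lerD//.
  rewrite -(@ler_pXn2r _ 2)// ?nnegrE ?l2norm_ge0// l2norm_sqr sq_pp// (le_trans _ (hB N))//.
  apply: ler_sum => n _; rewrite ler_wpM2l ?sqr_ge0// ler_pdivrMr ?ltr0Sn// mulVf ?pnatr_eq0//.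
  by rewrite exprn_ile1// ltW.
by rewrite (le_trans (l2norm_cst_le r0 (ltW e0) hd hN))// ler_piMr// ltW.
Qed.
End DiskSeries.

(** * Passing from smaller disks to the whole disc *)

Section Exhaustion.
Context {R : realType}.
Local Notation C := R[i].
Local Notation T2 := (measurableTypeR R * measurableTypeR R)%type.
Local Notation dA := (@dA R).
Implicit Types (F G : C -> C) (u : nat -> C) (r : R).

Let mD r := disk_measurable r.
Let fD r := dA_disk_lty r.

Lemma disc2E : disc2 = disk 1 :> set T2.
Proof.
apply/seteqP; split => p; first by move=> /discE /(nm_disk _ ler01).
by move=> /(nm_disk _ ler01) h; apply/discE.
Qed.

Lemma l2_sub (D E : set T2) F : measurable D -> measurable E -> D `<=` E -> l2 E F -> l2 D F.
Proof.
by move=> hD hE DE [mF iF]; split; [exact: cmeas_sub mF|exact: integrableS iF].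
Qed.

(** Monotone convergence along the radii 1 - 1 / (n + 2). Bounds obtained on smaller disks, where a
    power series is bounded, thus reach the unit disc. *)
Lemma l2_exhaust F B : cmeas (disk 1) F ->
  (forall r, 0 < r -> r < 1 -> l2 (disk r) F /\ sq (disk r) F <= B) ->
  l2 (disk 1) F /\ sq (disk 1) F <= B.
Proof.
move=> mF h; pose rn n : R := 1 - n.+2%:R^-1.
have rn0 n : 0 < rn n by rewrite subr_gt0 invf_lt1// ltr1n.
have rn1 n : rn n < 1 by rewrite ltrBlDr ltrDl invr_gt0.
have E1 : \bigcup_n disk (rn n) = disk 1 :> set T2.
  apply/seteqP; split => p; first by move=> [n _]; apply: disk_sub; rewrite ltW.
  move=> /(nm_disk _ ler01) p1; pose d := 1 - nm (cplx p).
  have d0 : 0 < d by rewrite subr_gt0.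
  exists (Num.bound d^-1) => //; apply/(nm_disk _ (ltW (rn0 _))).
  rewrite /rn ltrBrDr -ltrBrDl -/d -[ltRHS]invrK ltf_pV2 ?posrE ?invr_gt0//.
  have := archi_boundP (_ : 0 <= d^-1); rewrite invr_ge0 (ltW d0) => /(_ isT) /lt_trans; apply.
  by rewrite ltr_nat.
pose g (p : T2) := (nm (F (cplx p)) ^+ 2)%:E.
have mg D : D `<=` disk 1 -> measurable D -> measurable_fun D g.
  by move=> D1 hD; apply/measurable_EFinP; exact: (cmeas_nm2 (cmeas_sub (mD 1) D1 mF)).
have sub n : disk (rn n) `<=` disk 1 by apply: disk_sub; exact: ltW.
have g0 p : (0 <= g p)%E by rewrite lee_fin sqr_ge0.
have gB n : (\int[dA]_(p in disk (rn n)) g p <= B%:E)%E.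
  have [[h1 h2] h3] := h _ (rn0 n) (rn1 n).
  by rewrite -[leLHS]fineK ?lee_fin//; exact: integrable_fin_num.
have nd : nondecreasing_seq (fun n => disk (rn n)).
  move=> m n mn; apply/subsetPset/disk_sub; first exact: ltW.
  by rewrite lerD2l lerN2 lef_pV2 ?posrE// ler_nat.
have := @ge0_nondecreasing_set_cvg_integral _ _ R (fun n => disk (rn n)) g dA nd
  (fun n => mD _) (fun n => mg _ (sub n) (mD _)) (fun n p _ => g0 p).
rewrite E1 => cv; have le : (\int[dA]_(p in disk 1) g p <= B%:E)%E.
  rewrite -(cvg_lim _ cv)//; apply: lime_le; first by apply/cvg_ex; eexists; exact: cv.
  by apply: nearW => n; exact: gB.
have il : rinteg (disk 1) (fun p => nm (F (cplx p)) ^+ 2).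
  apply/integrableP; split; first exact: mg.
  under eq_integral do rewrite gee0_abs//.
  by rewrite (le_lt_trans le)// ltry.
split=> //; rewrite -lee_fin [leLHS]fineK//; exact: integrable_fin_num.
Qed.

Lemma sq_split (D E : set T2) F : measurable D -> measurable E -> D `<=` E -> l2 E F ->
  sq E F = sq D F + sq (E `\` D) F.
Proof.
move=> hD hE DE [mF iF]; rewrite /sq -Rintegral_setU//.
- by rewrite setDUK.
- exact: measurableD.
- by rewrite setDUK.
- by apply/disj_setPS => p [? []].
Qed.

Lemma ip_split (D E : set T2) F G : measurable D -> measurable E -> D `<=` E ->
  l2 E F -> l2 E G -> ip E F G = ip D F G + ip (E `\` D) F G.
Proof.
move=> hD hE DE hF hG; have [i1 i2] := l2_cinteg hE hF hG.
have ED : D `|` (E `\` D) = E by exact: setDUK.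
have dj : [disjoint D & E `\` D] by apply/disj_setPS => p [? []].
rewrite /ip /CI; apply: complex_eq; rewrite ?cReD ?cImD /=.
  by rewrite -Rintegral_setU ?ED//; exact: measurableD.
by rewrite -Rintegral_setU ?ED//; exact: measurableD.
Qed.

Lemma sq_disk_pow (r : R) k : 0 < r -> sq (disk r) (fun z : C => z ^+ k) = r ^+ (2 * k.+1) / k.+1%:R.
Proof.
move=> r0; have := ip_self (disk r) (fun z : C => z ^+ k); rewrite ip_pow// eqxx.
by move=> /(congr1 (@complex.Re R)).
Qed.

Lemma bernoulli_sub (r : R) m : 0 <= r -> r <= 1 -> 1 - r ^+ m <= m%:R * (1 - r).
Proof.
move=> r0 r1; elim: m => [|m IH]; first by rewrite expr0 subrr mul0r.
have h : 0 <= r ^+ m <= 1 by rewrite exprn_ge0//= exprn_ile1.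
by rewrite exprS -natr1; nra.
Qed.

(** The difference is the pairing over the ring between the radii r and 1; by Cauchy-Schwarz its
    square is at most |F|^2 times the integral of |z^k|^2 there, which is at most 2 (k + 1) (1 -
    r). *)
Lemma ip_pow_approx F k (e : R) : l2 (disk 1) F -> 0 < e -> exists2 r0 : R, r0 < 1 &
  forall r, 0 < r -> r0 < r -> r < 1 ->
  nm (ip (disk 1) F (fun z => z ^+ k) - ip (disk r) F (fun z => z ^+ k)) <= e.
Proof.
move=> hF e0; pose S := sq (disk 1) F * (2 * k.+1)%:R + 1.
have S0 : 0 < S by rewrite ltr_wpDl// mulr_ge0 ?sq_ge0.
have e2 : 0 < e ^+ 2 by rewrite exprn_gt0.
exists (1 - e ^+ 2 / S); first by rewrite ltrBlDr ltrDl divr_gt0.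
move=> r r0 rr r1; pose A := disk 1 `\` disk r : set T2.
have sub : (disk r : set T2) `<=` disk 1 by apply: disk_sub; exact: ltW.
have mA : measurable A by exact: measurableD.
have A1 : A `<=` disk 1 by move=> p [].
have hFA := l2_sub mA (mD 1) A1 hF; have hkA := l2_sub mA (mD 1) A1 (l2_pow 1 k).
rewrite (ip_split (mD r) (mD 1) sub hF (l2_pow 1 k)) addrAC subrr add0r.
rewrite -(@ler_pXn2r _ 2)// ?nnegrE ?nm_ge0 ?(ltW e0)//.
rewrite (le_trans (cauchy_schwarz mA hFA hkA))//.
have h1 := sq_split (mD r) (mD 1) sub hF; rewrite -/A in h1.
have h2 := sq_split (mD r) (mD 1) sub (l2_pow 1 k); rewrite -/A !sq_disk_pow// expr1n in h2.
have h3 : sq A F <= sq (disk 1) F by rewrite h1 lerDr sq_ge0.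
have h4 : sq A (fun z => z ^+ k) <= (2 * k.+1)%:R * (1 - r).
  rewrite (le_trans _ (bernoulli_sub (2 * k.+1) (ltW r0) (ltW r1)))//.
  have -> : sq A (fun z => z ^+ k) = (1 - r ^+ (2 * k.+1)) / k.+1%:R.
    by rewrite mulrBl h2 addrAC subrr add0r.
  rewrite ler_pdivrMr ?ltr0Sn// ler_peMr ?ler1n//.
  by rewrite subr_ge0 exprn_ile1// ltW.
rewrite (le_trans (ler_pM (sq_ge0 _ _) (sq_ge0 _ _) h3 h4))// mulrA.
have : S * (1 - r) <= e ^+ 2 by rewrite mulrC -ler_pdivlMr//; lra.
apply: le_trans; rewrite ler_wpM2r ?subr_ge0 ?(ltW r1)//.
by rewrite /S lerDl.
Qed.
End Exhaustion.

(** * The isomorphism of the Bergman space with square-summable sequences *)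

Section Coordinates.
Context {R : realType}.
Local Notation C := R[i].
Local Notation D1 := (@disk R 1).
Implicit Types (F G : C -> C) (u x : nat -> C) (r : R).

Let mD : measurable D1 := disk_measurable 1.

(* The coordinates with respect to the orthonormal basis $\sqrt{n+1} z^n$. *)
Definition coord F n : C := (sqn n)%:C%C * ip D1 F (fun z => z ^+ n).

Definition syn x : C -> C := ps (fun n => (sqn n)%:C%C * x n).

(** For r < 1 the series converges uniformly on the disk and [ip_ps_pow] gives the pairing. Since
    [F] is only square-integrable up to the boundary, r -> 1 goes through [ip_pow_approx]. *)
Lemma coef_ip F u k : pbd u -> l2 D1 F -> (forall z, nm z < 1 -> F z = ps u z) ->
  ip D1 F (fun z => z ^+ k) = u k / k.+1%:R.
Proof.
move=> hu hF FE; apply/eqP; rewrite -subr_eq0 -nm_eq0 eq_le nm_ge0 andbT.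
apply/ler_addgt0Pr => e e0; rewrite add0r.
have e2 : 0 < e / 2 by rewrite divr_gt0.
have [r0 r01 h] := ip_pow_approx k hF e2.
pose K := (2 * k.+1)%:R * nm (u k) + 1.
have K0 : 0 < K by rewrite ltr_wpDl// mulr_ge0// nm_ge0.
(* The terms ensure r > 0, r > r0 and (1 - r) K <= e / 2. *)
pose r := Num.max (Num.max 2^-1 ((1 + r0) / 2)) (1 - e / 2 / K).
have rp : 0 < r by rewrite !lt_max invr_gt0 ltr0n.
have r0r : r0 < r by rewrite !lt_max (_ : r0 < (1 + r0) / 2) ?orbT//; lra.
have eK : 0 < e / 2 / K by rewrite divr_gt0.
have r1 : r < 1 by rewrite !gt_max -andbA; apply/and3P; split; [rewrite invf_lt1// ltr1n|lra|lra].
have rK : (1 - r) * K <= e / 2.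
  by rewrite -ler_pdivlMr// lerBlDr -lerBlDl le_max lexx orbT.
have E : ip (disk r) F (fun z => z ^+ k) = (r ^+ (2 * k.+1) / k.+1%:R)%:C%C * u k.
  rewrite -(ip_ps_pow k hu rp r1); apply: ip_eq => // p /(nm_disk _ (ltW rp)) pr.
  by apply: FE; apply: lt_trans r1.
have := h r rp r0r r1; rewrite E => h1.
rewrite -(subrK ((r ^+ (2 * k.+1) / k.+1%:R)%:C%C * u k) (ip D1 F _)) -addrA (le_trans (nmD _ _))//.
have h2 : nm ((r ^+ (2 * k.+1) / k.+1%:R)%:C%C * u k - u k / k.+1%:R) <= e / 2.
  have -> : (r ^+ (2 * k.+1) / k.+1%:R)%:C%C * u k - u k / k.+1%:R =
     - (((1 - r ^+ (2 * k.+1)) / k.+1%:R)%:C%C * u k).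
    by rewrite !rcM rcB rcV rc_nat; ring.
  have b0 : 0 <= 1 - r ^+ (2 * k.+1) by rewrite subr_ge0 exprn_ile1// ltW.
  have b1 := bernoulli_sub (2 * k.+1) (ltW rp) (ltW r1).
  rewrite nmN nmM nm_pos; last by rewrite divr_ge0.
  rewrite (le_trans _ rK)//.
  have : (1 - r ^+ (2 * k.+1)) / k.+1%:R <= (2 * k.+1)%:R * (1 - r).
    by rewrite (le_trans _ b1)// ler_pdivrMr ?ltr0Sn// ler_peMr ?ler1n.
  move=> /(ler_wpM2r (nm_ge0 (u k))) /le_trans; apply.
  by rewrite /K [leRHS]mulrDr mulr1 [leLHS]mulrAC [leLHS]mulrC lerDl subr_ge0 ltW.
by lra.
Qed.

(** Bessel's inequality, from 0 <= |F - p|^2 for a partial sum p, for which |p|^2 = <p, F>. *)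
Lemma bessel F : l2 D1 F -> ell (coord F) (l2norm D1 F).
Proof.
move=> hF; split; first exact: l2norm_ge0.
move=> N; rewrite l2norm_sqr; pose u n : C := (sqn n)%:C%C * coord F n.
set S := \sum_(_ < _) _.
have sq1 : sq D1 (pp u N) = S.
  rewrite sq_pp//; apply: eq_bigr => n _; rewrite expr1n /u nmM (nm_pos (ltW (sqn_gt0 _))) exprMn sqn_sqr.
  by rewrite mulrAC mul1r mulfV ?mul1r// pnatr_eq0.
have ip1 : ip D1 (pp u N) F = S%:C%C.
  rewrite ip_pp_r// rc_sum; apply: eq_bigr => n _; rewrite -mul_conj /u.
  rewrite (ip_conj mD hF (l2_pow 1 n)) {3}/coord cjM (_ : conjc (sqn n)%:C%C = (sqn n)%:C%C) /= ?oppr0//.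
  ring.
have := sq_ge0 D1 (fun z => F z + -1 * pp u N z).
rewrite (sq_add mD hF (l2Z mD _ (l2_pp 1 u N))) (sqZ mD _ (l2_pp 1 u N)) (ipZr mD _ hF (l2_pp 1 u N)).
rewrite (ip_conj mD (l2_pp 1 u N) hF) ip1 sq1 nmN nm1 expr1n mul1r cjN cj1 mulN1r cReN cReC /=.
by lra.
Qed.

Lemma pbd_syn x r : ell x r -> pbd (fun n => (sqn n)%:C%C * x n).
Proof.
move=> hx s s0 s1; have r0 := ell_ge0 hx.
exists (r * (1 - s)^-1); first by rewrite mulr_ge0// invr_ge0 subr_ge0 ltW.
move=> n; have -> : nm ((sqn n)%:C%C * x n) * s ^+ n = nm (x n) * (sqn n * s ^+ n).
  by rewrite nmM (nm_pos (ltW (sqn_gt0 _))) mulrCA mulrA.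
apply: ler_pM; [exact: nm_ge0|by rewrite mulr_ge0 ?exprn_ge0// ltW ?sqn_gt0|exact: ell_pt hx|].
rewrite (le_trans _ (succ_geom n s0 s1))// ler_wpM2r ?exprn_ge0//.
rewrite -sqn_sqr expr2 ler_peMr ?(ltW (sqn_gt0 _))//.
by rewrite -(@ler_pXn2r _ 2)// ?nnegrE ?(ltW (sqn_gt0 _))// sqn_sqr expr1n ler1n.
Qed.

(** Riesz-Fischer: the norms over smaller disks are bounded by that of the sequence, and
    [l2_exhaust] concludes. *)
Lemma syn_l2 x r : ell x r -> l2 D1 (syn x) /\ l2norm D1 (syn x) <= r.
Proof.
move=> hx; have r0 := ell_ge0 hx; have hu := pbd_syn hx.
have [|h1 h2] := @l2_exhaust R (syn x) (r ^+ 2) (cmeas_ps hu).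
  move=> s s0 s1; split.
    by apply: l2_bm; [exact: disk_measurable|exact: dA_disk_lty|exact: bm_ps (ltW s0) s1].
  rewrite -l2norm_sqr lerXn2r ?nnegrE ?l2norm_ge0//; apply: l2norm_ps => // N.
  have [_ /(_ N)] := hx; apply: le_trans; apply: ler_sum => n _.
  by rewrite nmM (nm_pos (ltW (sqn_gt0 _))) exprMn sqn_sqr mulrAC mulfV ?pnatr_eq0// mul1r lexx.
split=> //; rewrite -(@ler_pXn2r _ 2)// ?nnegrE ?l2norm_ge0//; by rewrite l2norm_sqr.
Qed.

Lemma coord_syn x r n : ell x r -> coord (syn x) n = x n.
Proof.
move=> hx; have hu := pbd_syn hx; have [h1 _] := syn_l2 hx.
by rewrite /coord (coef_ip n hu h1)// mulrA mulrA -rcM -expr2 sqn_sqr rc_nat mulrAC mulfV ?pnatr_eq0// mul1r.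
Qed.

Lemma syn_coord F z : hol F -> l2 D1 F -> nm z < 1 -> F z = syn (coord F) z.
Proof.
move=> hol_F hF z1; rewrite (hol_power_series hol_F z1) /syn; congr ps; apply/funext => n.
have FE w : nm w < 1 -> F w = ps (cf F) w by exact: hol_power_series.
by rewrite /coord (coef_ip n (cf_pbd hol_F) hF FE) mulrA -rcM -expr2 sqn_sqr rc_nat mulrC divfK ?pnatr_eq0.
Qed.

(** With [bessel], bounds on a Bergman function and on its coordinates become interchangeable. *)
Lemma l2norm_ell F r : hol F -> l2 D1 F -> ell (coord F) r -> l2norm D1 F <= r.
Proof.
move=> hF h2 /syn_l2 [_]; apply: le_trans; rewrite le_eqVlt; apply/orP; left; apply/eqP.
congr Num.sqrt; apply: sq_eq => p /(nm_disk _ ler01); exact: syn_coord.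
Qed.
End Coordinates.

(** * The Bergman projection in coordinates *)

Section Projection.
Context {R : realType}.
Local Notation C := R[i].
Local Notation dA := (@dA R).
Local Notation D1 := (@disk R 1).
Implicit Types (f g F G : C -> C) (u x : nat -> C) (r : R) (z w : C).

Let mD : measurable D1 := disk_measurable 1.
Let fD : (dA D1 < +oo)%E := dA_disk_lty 1.

Lemma kernel_sum (y : C) N : (1 - y) ^+ 2 * \sum_(n < N) n.+1%:R * y ^+ n =
  1 - N.+1%:R * y ^+ N + N%:R * y ^+ N.+1.
Proof.
elim: N => [|N IH]; first by rewrite big_ord0 expr0 expr1; ring.
by rewrite big_ord_recr /= mulrDr IH !exprS -!natr1; ring.
Qed.

(** The closed form of [kernel_sum] leaves a remainder with a factor N + 1, absorbed by passing from
    q to its square root. *)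
Lemma kernel_approx (q e : R) : 0 <= q -> q < 1 -> 0 < e ->
  exists N0, forall N (y : C), (N0 <= N)%N -> nm y <= q ->
    nm (((1 - y) ^+ 2)^-1 - \sum_(n < N) n.+1%:R * y ^+ n) <= e.
Proof.
move=> q0 q1 e0; pose s := Num.sqrt q.
have s0 : 0 <= s := sqrtr_ge0 _.
have ss : s ^+ 2 = q by rewrite sqr_sqrtr.
have s1 : s < 1 by rewrite -(@ltr_pXn2r _ 2)// ?nnegrE// ss expr1n.
pose K := 2 * (1 - s)^-1 * ((1 - q) ^+ 2)^-1 + 1.
have ks0 : 0 <= (1 - s)^-1 by rewrite invr_ge0 subr_ge0 ltW.
have q10 : 0 < (1 - q) ^+ 2 by rewrite exprn_gt0// subr_gt0.
have K0 : 0 < K.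
  by apply: ltr_wpDl => //; apply: mulr_ge0; [exact: mulr_ge0|rewrite invr_ge0 ltW].
have [N0 hN] := pow_small s0 s1 (divr_gt0 e0 K0); exists N0 => N y NN yq.
have y1 : 1 - y != 0.
  by rewrite subr_eq0; apply/eqP => E; move: yq; rewrite -E nm1 leNgt q1.
have ny : 1 - q <= nm (1 - y) by have := nm_sub_ge 1 y; rewrite nm1; lra.
have -> : ((1 - y) ^+ 2)^-1 - \sum_(n < N) n.+1%:R * y ^+ n =
    (N.+1%:R * y ^+ N - N%:R * y ^+ N.+1) * ((1 - y) ^+ 2)^-1.
  apply: (mulfI (_ : (1 - y) ^+ 2 != 0)); first by rewrite expf_neq0.
  by rewrite mulrBr kernel_sum mulrCA !mulfV ?expf_neq0//; ring.
have yN : nm y ^+ N <= q ^+ N by apply: lerXn2r; rewrite ?nnegrE ?nm_ge0.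
have b1 : nm (N.+1%:R * y ^+ N - N%:R * y ^+ N.+1) <= 2 * (N.+1%:R * q ^+ N).
  rewrite (le_trans (nmB _ _))// !nmM !nm_nat !nmX exprS.
  have a1 : N.+1%:R * nm y ^+ N <= N.+1%:R * q ^+ N by rewrite ler_wpM2l.
  have a2 : N%:R * (nm y * nm y ^+ N) <= N.+1%:R * q ^+ N.
    apply: ler_pM; rewrite ?mulr_ge0 ?exprn_ge0 ?nm_ge0 ?ler_nat//.
    rewrite -[leRHS]mul1r; apply: ler_pM; rewrite ?exprn_ge0 ?nm_ge0//.
    by rewrite (le_trans yq)// ltW.
  by lra.
have b2 : N.+1%:R * q ^+ N <= (1 - s)^-1 * s ^+ N.
  by rewrite -ss expr2 exprMn mulrA ler_wpM2r ?exprn_ge0// succ_geom.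
have b3 : nm ((1 - y) ^+ 2)^-1 <= ((1 - q) ^+ 2)^-1.
  rewrite nmV nmX lef_pV2 ?posrE ?exprn_gt0 ?nm_gt0//.
    by apply: lerXn2r; rewrite ?nnegrE ?nm_ge0 ?subr_ge0 ?(ltW q1).
  by rewrite subr_gt0.
rewrite nmM; apply: (@le_trans _ _ (2 * ((1 - s)^-1 * s ^+ N) * ((1 - q) ^+ 2)^-1)).
  apply: ler_pM; rewrite ?nm_ge0//; apply: le_trans b1 _.
  by rewrite ler_wpM2l.
have /ltW := hN N NN; rewrite ler_pdivlMr// => hh; apply: le_trans hh.
have -> : 2 * ((1 - s)^-1 * s ^+ N) * ((1 - q) ^+ 2)^-1 = s ^+ N * (2 * (1 - s)^-1 * ((1 - q) ^+ 2)^-1) by ring.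
by rewrite ler_wpM2l ?exprn_ge0// lerDl.
Qed.

(** For fixed [z] the kernel is the sum of (n + 1) (conj z * w)^n up to conjugation, uniformly in
    [w], so the Taylor coefficients of the projection are inner products of [F] with powers. [F] is
    any square-integrable function, as the product of a symbol with a Bergman function requires. *)
Lemma proj_syn F z : l2 D1 F -> nm z < 1 -> bergman_proj F z = syn (coord F) z.
Proof.
move=> hF z1; symmetry; apply: psE => e e0.
have nF : 0 < l2norm D1 F + 1 by rewrite ltr_wpDl// l2norm_ge0.
have [N0 hN] := kernel_approx (nm_ge0 z) z1 (divr_gt0 e0 nF).
exists N0 => N NN.
pose kN w := \sum_(n < N) (n.+1%:R * conjc z ^+ n) * w ^+ n.
pose k w := ((1 - conjc z * w) ^+ 2)^-1.
have kk w : kN w = \sum_(n < N) n.+1%:R * (conjc z * w) ^+ n.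
  by apply: eq_bigr => n _; rewrite exprMn mulrA.
have zw w : nm w <= 1 -> nm (conjc z * w) <= nm z.
  by move=> w1; rewrite nmM nm_conj ler_piMr// nm_ge0.
have hd w : nm w <= 1 -> nm (kN w - k w) <= e / (l2norm D1 F + 1).
  by move=> /zw h; rewrite kk nm_dist; exact: hN.
have bkN M : bm D1 (pp (fun n => n.+1%:R * conjc z ^+ n) M) by exact: bm_pp.
have lkN : l2 D1 kN := l2_pp 1 (fun n => n.+1%:R * conjc z ^+ n) N.
have lk : l2 D1 k.
  apply: l2_bm => //; split.
    apply: (@cmeas_lim R D1 (pp (fun n => n.+1%:R * conjc z ^+ n))) => [M|p /(nm_disk _ ler01) p1 e' e'0].
      by case: (bkN M).
    have [M0 hM] := kernel_approx (nm_ge0 z) z1 e'0; exists M0 => M MM.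
    rewrite /pp; under eq_bigr do rewrite -mulrA -exprMn.
    by apply: hM => //; apply: zw; exact: ltW.
  have [_ [B hB]] := bkN N; exists (B + e / (l2norm D1 F + 1)) => p Dp.
  have /(nm_disk _ ler01) /ltW p1 := Dp.
  rewrite -(subrK (kN (cplx p)) (k _)) (le_trans (nmD _ _))// addrC lerD//; first exact: hB.
  by rewrite nm_dist hd.
have -> : bergman_proj F z = ip D1 F k.
  transitivity (CI D1 (fun w => F w / (1 - conjc w * z) ^+ 2)).
    by rewrite /bergman_proj /disc_integral disc2E.
  apply: CI_eq => p _.
  by rewrite /k cjV cjX cjB cj1 cjM conjcK (mulrC z).
have -> : \sum_(n < N) (sqn n)%:C%C * coord F n * z ^+ n = ip D1 F kN.
  rewrite (ip_conj mD lkN hF) (ip_pp_r (fun n => n.+1%:R * conjc z ^+ n) N hF) cj_sum.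
  apply: eq_bigr => n _; rewrite /coord !mulrA -rcM -expr2 sqn_sqr rc_nat cjM.
  rewrite -(ip_conj mD (l2_pow 1 n) hF) cjM cjX conjcK -rc_nat /= oppr0.
  by rewrite mulrAC.
have E : ip D1 F kN = ip D1 F k + ip D1 F (fun w => kN w - k w).
  rewrite -(ipDr mD lk (l2B mD lkN lk) hF); apply: ip_eq => // p _.
  by rewrite addrC subrK.
rewrite E addrAC subrr add0r (le_trans (l2norm_ip mD hF (l2B mD lkN lk)))//.
have h1 := l2norm_cst_le ltr01 (ltW (divr_gt0 e0 nF)) (l2B mD lkN lk) hd.
rewrite (le_trans (ler_wpM2l (l2norm_ge0 _ _) h1))// mulr1 mulrA ler_pdivrMr//.
by rewrite mulrC ler_wpM2l ?(ltW e0)// lerDl.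
Qed.
End Projection.

(** * Toeplitz operators with symbol a conj z + b + c z in coordinates *)

Section Toeplitz.
Context {R : realType}.
Local Notation C := R[i].
Local Notation dA := (@dA R).
Local Notation D1 := (@disk R 1).
Implicit Types (f g F G : C -> C) (u x : nat -> C) (r : R) (z w a b c : C).

Let mD : measurable D1 := disk_measurable 1.
Let fD : (dA D1 < +oo)%E := dA_disk_lty 1.

Lemma sqr_integralE f : sqr_integral f = (\int[dA]_(p in D1) (nm (f (cplx p)) ^+ 2)%:E)%E.
Proof. by rewrite /sqr_integral disc2E. Qed.

Lemma L2_discE f : L2_disc f <-> l2 D1 f.
Proof.
rewrite /L2_disc /= sqr_integralE disc2E; split=> [[h1 h2 h3]|[[h1 h2] h3]].
  split=> //; apply/integrableP; split; first by apply/measurable_EFinP; exact: cmeas_nm2.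
  by under eq_integral do rewrite /= ger0_norm ?sqr_ge0//.
by split => //; exact: (integrable_lty mD h3).
Qed.

Lemma L2_normE f : L2_norm f = l2norm D1 f.
Proof. by rewrite /L2_norm sqr_integralE. Qed.

Lemma bergmanE f : bergman f <-> l2 D1 f /\ hol f.
Proof.
split=> [[/L2_discE h1 h2]|[h1 h2]]; split=> //; last 2 first.
- exact/L2_discE.
- by move=> z /discE; exact: h2.
by move=> z z1; apply: h2; apply/discE.
Qed.

Lemma hol_eq f g : (forall z, nm z < 1 -> f z = g z) -> hol g -> hol f.
Proof.
move=> fg hg z z1; apply/derivable_lin; have /derivable_lin[d hd] := hg z z1.
exists d => e e0; have [del del0 h] := hd e e0.
exists (Num.min del (1 - nm z)); first by rewrite lt_min del0 subr_gt0.
move=> y; rewrite lt_min => /andP[/h hy y1]; rewrite !fg//.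
by rewrite -(subrK z y) (le_lt_trans (nmD _ _))// -ltrBrDr.
Qed.

Lemma l2_eq_disc f g : (forall z, nm z < 1 -> f z = g z) -> l2 D1 g -> l2 D1 f.
Proof. by move=> fg; apply: (l2_eq mD) => p /(nm_disk _ ler01) /fg ->. Qed.

Lemma coord_eq f g n : (forall z, nm z < 1 -> f z = g z) -> coord f n = coord g n.
Proof. by move=> fg; rewrite /coord; congr (_ * _); apply: ip_eq => // p /(nm_disk _ ler01) /fg. Qed.

Lemma coordD f g n : l2 D1 f -> l2 D1 g -> coord (fun z => f z + g z) n = coord f n + coord g n.
Proof. by move=> hf hg; rewrite /coord (ipDl mD hf hg (l2_pow 1 n)) mulrDr. Qed.

Lemma coordZ f k n : l2 D1 f -> coord (fun z => k * f z) n = k * coord f n.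
Proof. by move=> hf; rewrite /coord (ipZl mD _ hf (l2_pow 1 n)) mulrCA. Qed.

Lemma l2_conjz f : l2 D1 f -> l2 D1 (fun z => conjc z * f z).
Proof. by apply: l2_bmM => //; apply: bmC; exact: bm_id. Qed.

Lemma l2_mulz f : l2 D1 f -> l2 D1 (fun z => z * f z).
Proof. by apply: l2_bmM => //; exact: bm_id. Qed.

(** The factor conj z moves to the other side of the inner product as z, raising the exponent by
    one. *)
Lemma coord_conjz f n : coord (fun z => conjc z * f z) n = (wt n)%:C%C * coord f n.+1.
Proof.
rewrite /coord mulrA wt_sqnS; congr (_ * _); apply: CI_eq => p _.
by rewrite !cjX exprS -!mulrA mulrCA.
Qed.

Lemma hol_mulz f : hol f -> hol (fun z => z * f z).
Proof. by move=> hf z z1; apply: cderM; [exact: cder_id|exact: hf]. Qed.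

(** Moving z across the inner product would produce conj(z) z^n, which is no power; instead the
    Taylor series of [f] is shifted by one place. *)
Lemma coord_mulz f n : hol f -> l2 D1 f ->
  coord (fun z => z * f z) n = if n is m.+1 then (wt m)%:C%C * coord f m else 0.
Proof.
move=> hf h2; pose u := cf f; pose v n := if n is m.+1 then u m else 0.
have hu : pbd u := cf_pbd hf.
have hv : pbd v.
  move=> r r0 r1; have [B B0 hB] := hu r r0 r1; exists B => // -[|m] /=; first by rewrite nm0 mul0r.
  by rewrite exprS mulrCA (le_trans _ (hB m))// ler_piMl ?mulr_ge0 ?nm_ge0 ?exprn_ge0// ltW.
have fu w : nm w < 1 -> f w = ps u w by exact: hol_power_series.
have zf w : nm w < 1 -> w * f w = ps v w.
  move=> w1; symmetry; apply: psE => e e0.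
  have [N0 hN] := ps_unif hu (nm_ge0 w) w1 e0; exists N0.+1 => -[//|N]; rewrite ltnS => NN.
  rewrite big_ord_recl /= mul0r add0r (_ : \sum_(_ < _) _ = w * pp u N w).
    rewrite -mulrBr nmM fu// nm_dist (le_trans _ (hN N w NN (lexx _)))//.
    by rewrite ler_piMl ?nm_ge0// ltW.
  by rewrite mulr_sumr; apply: eq_bigr => i _; rewrite exprS mulrCA.
rewrite /coord (coef_ip n hv (l2_mulz h2) zf); case: n => [|m] /=; first by rewrite mul0r mulr0.
rewrite (coef_ip m hu h2 fu) [in RHS]mulrA wt_sqn.
move: (u m) => um; rewrite -[RHS]mulrA; congr (_ * _).
by rewrite mulrAC mulrCA mulfV ?pnatr_eq0// mulr1.
Qed.

Definition psi a b c z : C := a * conjc z + b + c * z.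

Lemma bm_psi a b c : bm D1 (psi a b c).
Proof.
apply: (bmD (bmD (bmM (bm_cst _ _) (bmC (bm_id _))) (bm_cst _ _)) (bmM (bm_cst _ _) (bm_id _))).
Qed.

Lemma l2_psi a b c f : l2 D1 f -> l2 D1 (fun z => psi a b c z * f z).
Proof. by apply: l2_bmM => //; exact: bm_psi. Qed.

Lemma coord_psi a b c f n : hol f -> l2 D1 f ->
  coord (fun z => psi a b c z * f z) n = jac a b c (coord f) n.
Proof.
move=> hf h2; have h3 := l2_conjz h2; have h4 := l2_mulz h2.
have h5 := l2Z mD a h3; have h6 := l2Z mD b h2; have h7 := l2Z mD c h4.
rewrite (@coord_eq _ (fun z => (a * (conjc z * f z) + b * f z) + c * (z * f z))).
  rewrite (coordD n (l2D mD h5 h6) h7) (coordD n h5 h6) (coordZ _ _ h3) (coordZ _ _ h2) (coordZ _ _ h4).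
  by rewrite coord_conjz (coord_mulz n hf h2) /jac mulrA.
by move=> z _; rewrite /psi; ring.
Qed.

Lemma toeplitz_syn a b c f z : l2 D1 f -> nm z < 1 ->
  toeplitz (psi a b c) f z = syn (coord (fun z => psi a b c z * f z)) z.
Proof. by move=> h2 z1; apply: proj_syn => //; exact: l2_psi. Qed.

Lemma hol_syn x r : ell x r -> hol (syn x).
Proof. by move=> hx; apply: hol_ps; exact: pbd_syn hx. Qed.

Lemma toeplitz_hol a b c f : l2 D1 f -> hol (toeplitz (psi a b c) f).
Proof.
move=> h2; apply: (hol_eq (fun z => toeplitz_syn a b c h2 (z := z))).
by apply: hol_syn (bessel _); exact: l2_psi.
Qed.

Lemma toeplitz_l2 a b c f : l2 D1 f -> l2 D1 (toeplitz (psi a b c) f) /\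
  l2norm D1 (toeplitz (psi a b c) f) <= l2norm D1 (fun z => psi a b c z * f z).
Proof.
move=> h2; have [h3 h4] := syn_l2 (bessel (l2_psi a b c h2)); split.
  exact: (l2_eq_disc (fun z => toeplitz_syn a b c h2 (z := z))).
rewrite (_ : l2norm D1 (toeplitz _ _) = l2norm D1 (syn (coord (fun z => psi a b c z * f z))))//.
by congr Num.sqrt; apply: sq_eq => p /(nm_disk _ ler01) p1; exact: toeplitz_syn.
Qed.

Lemma coord_toeplitz a b c f n : hol f -> l2 D1 f -> coord (toeplitz (psi a b c) f) n = jac a b c (coord f) n.
Proof.
move=> hf h2; rewrite -coord_psi//.
rewrite (coord_eq n (fun z => toeplitz_syn a b c h2 (z := z))).
by apply: coord_syn; exact: (bessel (l2_psi a b c h2)).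
Qed.

Lemma hol_pp u N : hol (pp u N).
Proof.
move=> z _; apply: (@cder_sum R (fun n z => u n * z ^+ n)) => n.
by apply: cderM; [exact: cder_cst|apply: cderX; exact: cder_id].
Qed.

Lemma holB f g : hol f -> hol g -> hol (fun z => f z - g z).
Proof. by move=> hf hg z z1; apply: cderB; [exact: hf|exact: hg]. Qed.

Lemma coordB f g n : l2 D1 f -> l2 D1 g -> coord (fun z => f z - g z) n = coord f n - coord g n.
Proof.
move=> hf hg; rewrite -[- coord g n]mulN1r -(coordZ _ _ hg) -(coordD n hf (l2Z mD _ hg)).
by apply: coord_eq => z _; rewrite mulN1r.
Qed.

Lemma pp_dense g (e : R) : hol g -> l2 D1 g -> 0 < e ->
  exists u N, l2norm D1 (fun z => g z - pp u N z) <= e.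
Proof.
move=> hg h2 e0; have [N hN] := ell_tail (bessel h2) e0.
pose u n := (sqn n)%:C%C * coord g n; exists u, N.
have lp := l2_pp 1 u N.
have hh := holB hg (@hol_pp u N).
have lgp := l2B mD h2 lp.
apply: (l2norm_ell hh lgp).
apply: ell_mono hN => n; rewrite (coordB n h2 lp) {2}/coord ip_pp_pow// expr1n.
case: ifP => _; last by rewrite mulr0 subr0.
have -> : (sqn n)%:C%C * ((1 / n.+1%:R)%:C%C * u n) = coord g n.
  rewrite /u div1r; move: (coord g n) => y.
  transitivity ((sqn n)%:C%C ^+ 2 * (n.+1%:R^-1)%:C%C * y); first by ring.
  by rewrite sqn_sqrC rcV rc_nat mulfV ?pnatr_eq0// mul1r.
by rewrite subrr.
Qed.

(* [bergman_proj] only removes a part of the symbol times [f] orthogonal to the polynomials. *)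
Lemma ip_toeplitz a b c f g : hol f -> l2 D1 f -> hol g -> l2 D1 g ->
  ip D1 (toeplitz (psi a b c) f) g = ip D1 (fun z => psi a b c z * f z) g.
Proof.
move=> hf h2 hg g2; have [lT _] := toeplitz_l2 a b c h2; have lP := l2_psi a b c h2.
pose h z := toeplitz (psi a b c) f z - psi a b c z * f z.
have lh : l2 D1 h := l2B mD lT lP.
have Xh n : ip D1 h (fun z => z ^+ n) = 0.
  apply: (mulfI (sqn_neq0 n)); rewrite -/(coord h n) mulr0 (coordB n lT lP).
  by rewrite (coord_toeplitz a b c n hf h2) (coord_psi a b c n hf h2) subrr.
have E : ip D1 (toeplitz (psi a b c) f) g = ip D1 h g + ip D1 (fun z => psi a b c z * f z) g.
  by rewrite -(ipDl mD lh lP g2); apply: ip_eq => // p _; rewrite /h subrK.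
rewrite E (_ : ip D1 h g = 0) ?add0r//.
apply/eqP; rewrite -nm_eq0 eq_le nm_ge0 andbT; apply/ler_addgt0Pr => e e0; rewrite add0r.
have nh : 0 < l2norm D1 h + 1 by rewrite ltr_wpDl// l2norm_ge0.
have [u [N hN]] := pp_dense hg g2 (divr_gt0 e0 nh).
have lp := l2_pp 1 u N; have lgp := l2B mD g2 lp.
have -> : ip D1 h g = ip D1 h (fun z => g z - pp u N z).
  have -> : ip D1 h g = ip D1 h (fun z => g z - pp u N z) + ip D1 h (pp u N).
    by rewrite -(ipDr mD lgp lp lh); apply: ip_eq => // p _; rewrite subrK.
  rewrite (ip_conj mD lp lh) (ip_pp_r u N lh) big1 ?cj0 ?addr0// => n _.
  by rewrite (ip_conj mD lh (l2_pow 1 n)) Xh cj0 mulr0.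
rewrite (le_trans (l2norm_ip mD lh lgp))// (le_trans (ler_wpM2l (l2norm_ge0 _ _) hN))//.
by rewrite mulrA ler_pdivrMr// mulrC ler_wpM2l ?(ltW e0)// lerDl.
Qed.
End Toeplitz.

(** * Toeplitz operators *)

Section Operator.
Context {R : realType}.
Local Notation C := R[i].
Local Notation D1 := (@disk R 1).
Implicit Types (f g h : C -> C) (u x : nat -> C) (r : R) (z w a b c k : C).

Let mD : measurable D1 := disk_measurable 1.
Let fD : (dA D1 < +oo)%E := dA_disk_lty 1.

Lemma coord_inj f g z : hol f -> l2 D1 f -> hol g -> l2 D1 g -> (forall n, coord f n = coord g n) ->
  nm z < 1 -> f z = g z.
Proof.
move=> hf f2 hg g2 E z1; rewrite (syn_coord hf f2 z1) (syn_coord hg g2 z1).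
by congr (syn _ z); apply/funext.
Qed.

Lemma hol_lin k f g : hol f -> hol g -> hol (fun w => k * f w + g w).
Proof.
move=> hf hg z z1; apply: cderD; last exact: hg.
by apply: cderM; [exact: cder_cst|exact: hf].
Qed.

Lemma l2_lin k f g : l2 D1 f -> l2 D1 g -> l2 D1 (fun w => k * f w + g w).
Proof. by move=> hf hg; apply: l2D => //; exact: l2Z. Qed.

Lemma jac_linear a b c k x y n :
  jac a b c (fun m => k * x m + y m) n = k * jac a b c x n + jac a b c y n.
Proof. by rewrite /jac; case: n => [|n]; ring. Qed.

Lemma coord_lin k f g n : l2 D1 f -> l2 D1 g -> coord (fun w => k * f w + g w) n = k * coord f n + coord g n.
Proof. by move=> hf hg; rewrite (coordD n (l2Z mD k hf) hg) (coordZ _ _ hf). Qed.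

Lemma nm_psi a b c z : nm z < 1 -> nm (psi a b c z) <= nm a + nm b + nm c.
Proof.
move=> /ltW z1; rewrite /psi (le_trans (nmD _ _))// lerD//; last by rewrite nmM ler_piMr ?nm_ge0.
by rewrite (le_trans (nmD _ _))// lerD2r nmM nm_conj ler_piMr ?nm_ge0.
Qed.

Lemma l2norm_mul f (phi : C -> C) (M : R) : 0 <= M -> bm D1 phi -> l2 D1 f ->
  (forall z, nm z < 1 -> nm (phi z) <= M) -> l2norm D1 (fun z => phi z * f z) <= M * l2norm D1 f.
Proof.
move=> M0 bphi hf h; rewrite -(@ler_pXn2r _ 2)// ?nnegrE ?mulr_ge0 ?l2norm_ge0//.
rewrite exprMn !l2norm_sqr; apply: (sq_le mD (l2_bmM mD bphi hf) hf) => p /(nm_disk _ ler01) /h hp.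
by rewrite nmM exprMn ler_wpM2r ?sqr_ge0// lerXn2r ?nnegrE ?nm_ge0.
Qed.

Lemma toeplitz_l2norm a b c f (M : R) : 0 <= M -> l2 D1 f ->
  (forall z, nm z < 1 -> nm (psi a b c z) <= M) ->
  l2norm D1 (toeplitz (psi a b c) f) <= M * l2norm D1 f.
Proof.
move=> M0 hf h; have [_ h1] := toeplitz_l2 a b c hf.
by rewrite (le_trans h1)//; apply: l2norm_mul => //; exact: bm_psi.
Qed.

Lemma toeplitz_lin a b c k f g z : hol f -> l2 D1 f -> hol g -> l2 D1 g -> nm z < 1 ->
  toeplitz (psi a b c) (fun w => k * f w + g w) z =
  k * toeplitz (psi a b c) f z + toeplitz (psi a b c) g z.
Proof.
move=> hf f2 hg g2; have h2 := l2_lin k f2 g2.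
have [tf _] := toeplitz_l2 a b c f2; have [tg _] := toeplitz_l2 a b c g2.
have [th _] := toeplitz_l2 a b c h2.
apply: (@coord_inj _ (fun z => k * toeplitz (psi a b c) f z + toeplitz (psi a b c) g z)).
- exact: toeplitz_hol.
- exact: th.
- by apply: hol_lin; exact: toeplitz_hol.
- exact: l2_lin.
move=> n; rewrite (coord_lin k n tf tg) (coord_toeplitz a b c n (@hol_lin k _ _ hf hg) h2).
rewrite (coord_toeplitz a b c n hf f2) (coord_toeplitz a b c n hg g2) -jac_linear.
by congr (jac a b c _ n); apply/funext => m; exact: coord_lin.
Qed.

Lemma toeplitz_bounded a b c : bergman_bounded_operator (toeplitz (psi a b c)).
Proof.
split.
- move=> f /bergmanE[h1 h2]; apply/bergmanE; split; last exact: toeplitz_hol.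
  by have [] := toeplitz_l2 a b c h1.
- move=> k f g /bergmanE[h1 h2] /bergmanE[h3 h4] z /discE; exact: toeplitz_lin.
exists (nm a + nm b + nm c) => f /bergmanE[h1 h2]; rewrite !L2_normE.
by apply: toeplitz_l2norm => //; [rewrite !addr_ge0 ?nm_ge0|exact: nm_psi].
Qed.

Lemma iter_bergman a b c f n : bergman f -> bergman (iter n (toeplitz (psi a b c)) f).
Proof.
move=> hf; elim: n => [|n IH]; first exact: hf.
by rewrite iterS; have [h _ _] := toeplitz_bounded a b c; exact: (h _ IH).
Qed.

Lemma coord_iter a b c f n : bergman f ->
  coord (iter n (toeplitz (psi a b c)) f) = iter n (jac a b c) (coord f).
Proof.
move=> hf; elim: n => [|n IH]; first exact: erefl.
have /bergmanE[h1 h2] := iter_bergman a b c n hf.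
by rewrite !iterS -IH; apply/funext => m; exact: (coord_toeplitz a b c m h2 h1).
Qed.

(** Since |c| < |a|, the equation a * conj h + c * h = p is solvable for the value p at [z], and
    moving from [z] by t h multiplies the value by 1 + t. This turns modulus 1 into modulus above 1
    inside the disc. *)
Lemma strict_exterior a b c z : nm c < nm a -> nm z < 1 -> 1 <= nm (psi a b c z) ->
  exists2 w, nm w < 1 & 1 < nm (psi a b c w).
Proof.
move=> ca z1; rewrite le_eqVlt => /predU1P[p1|]; last by exists z.
set p := psi a b c z in p1.
pose d : C := (nm a ^+ 2 - nm c ^+ 2)%:C%C.
have d0 : d != 0.
  by rewrite rc_eq0 subr_eq0 gt_eqF// ltrXn2r ?nnegrE ?nm_ge0.
pose h := (a * conjc p - conjc c * p) / d.
have hE : a * conjc h + c * h = p.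
  have cd : conjc d = d by rewrite /d /= oppr0.
  rewrite /h cjM cjV cd cjB !cjM !conjcK; apply: (mulIf d0).
  have -> : d = a * conjc a - c * conjc c by rewrite /d rcB -!mul_conj.
  have d0' : a * conjc a - c * conjc c != 0 by rewrite !mul_conj -rcB.
  by field.
pose t : R := (1 - nm z) / (2 * (nm h + 1)).
have h0 := nm_ge0 h; have t0 : 0 < t by rewrite divr_gt0 ?subr_gt0// mulr_gt0// ltr_wpDl.
exists (z + t%:C%C * h).
  rewrite (le_lt_trans (nmD _ _))// nmM nm_pos ?(ltW t0)//.
  have : t * (nm h + 1) = (1 - nm z) / 2 by rewrite /t; field; rewrite gt_eqF// ltr_wpDl.
  by nra.
have -> : psi a b c (z + t%:C%C * h) = (1 + t)%:C%C * p.
  rewrite rcD mulrDl mul1r -{2}hE /p /psi cjD cjM (_ : conjc t%:C%C = t%:C%C) ?[conjc _]/= ?oppr0//.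
  by ring.
by rewrite nmM -p1 mulr1 nm_pos ?ltrDl// addr_ge0// ltW.
Qed.

Lemma toeplitz_hypercyclic a b c z1 z2 : a != 0 -> nm c < nm a ->
  nm z1 < 1 -> nm (psi a b c z1) < 1 -> nm z2 < 1 -> 1 <= nm (psi a b c z2) ->
  hypercyclic (toeplitz (psi a b c)).
Proof.
move=> a0 ca hz1 p1 hz2 p2; split; first exact: toeplitz_bounded.
have [w w1 pw] := strict_exterior ca hz2 p2.
have [x [r [hx hd]]] := seq_hypercyclic a0 ca hz1 w1 p1 pw.
have bx : bergman (syn x).
  by apply/bergmanE; split; [have [] := syn_l2 hx|exact: hol_syn hx].
exists (syn x) => // g /bergmanE[g1 g2] e e0.
have e2 : 0 < e / 2 by rewrite divr_gt0.
have [n hn] := hd _ _ (bessel g1) _ e2; exists n.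
have /bergmanE[h1 h2] := iter_bergman a b c n bx.
rewrite L2_normE; apply: (@le_lt_trans _ _ (e / 2)); last by lra.
apply: (l2norm_ell (holB h2 g2) (l2B mD h1 g1)).
apply: ell_mono hn => m; rewrite (coordB m h1 g1) coord_iter//.
by have -> : coord (syn x) = x by apply/funext => j; exact: coord_syn hx.
Qed.
End Operator.

(** * Norms along a dense orbit, and three obstructions to hypercyclicity *)

Section Orbit.
Context {R : realType}.
Local Notation C := R[i].
Local Notation D1 := (@disk R 1).
Implicit Types (f g h : C -> C) (r : R) (z w a b c k : C).

Let mD : measurable D1 := disk_measurable 1.
Let fD : (dA D1 < +oo)%E := dA_disk_lty 1.

Lemma seq_low (v : nat -> R) N : (forall n, 0 < v n) -> exists2 e : R, 0 < e &
  forall n, (n <= N)%N -> e <= v n.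
Proof.
move=> v0; elim: N => [|N [e e0 he]]; first by exists (v 0) => // -[|n].
exists (Num.min e (v N.+1)); first by rewrite lt_min e0 v0.
move=> n; rewrite leq_eqVlt => /predU1P[->|]; first by rewrite ge_min lexx orbT.
by rewrite ltnS => /he h; rewrite ge_min h.
Qed.

(** What the norms |T^n f| along a dense orbit of a bounded operator satisfy; the obstructions are
    then statements on real sequences. *)
Definition dense_norms (v : nat -> R) := [/\ forall n, 0 <= v n,
  forall n, v n = 0 -> v n.+1 = 0,
  forall e : R, 0 < e -> exists n, v n < e & forall M : R, exists n, M < v n].

Lemma dense_norms_gt0 (v : nat -> R) : dense_norms v -> forall n, 0 < v n.
Proof.
move=> [v0 vz _ vl] n; rewrite lt_neqAle v0 andbT eq_sym; apply/eqP => vn0.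
have vj j : v (j + n)%N = 0 by elim: j => [//|j IH]; rewrite addSn; exact: vz.
have [m] := vl (\sum_(i < n) v i); rewrite ltNge => /negP; apply.
have [mn|nm_] := ltnP m n; first by rewrite (bigD1 (Ordinal mn))//= lerDl sumr_ge0.
by rewrite -(subnK nm_) vj sumr_ge0.
Qed.

(** Norms up to index [m] have a positive minimum, and later ones are at least [v m], so none is
    arbitrarily small. *)
Lemma dense_norms_not_growing (v : nat -> R) (m : nat) : dense_norms v ->
  (forall j, v m <= v (m + j)%N) -> False.
Proof.
move=> dv up; have vp := dense_norms_gt0 dv; have [v0 vz vs vl] := dv.
have [e e0 he] := seq_low m vp; have [n] := vs e e0.
rewrite ltNge => /negP; apply; have [nk|kn] := leqP n m; first exact: he.
by rewrite (le_trans (he m (leqnn m)))// -(subnKC (ltnW kn)).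
Qed.

(** Unboundedness forces an increase somewhere; as log-convexity makes the ratios of consecutive
    terms nondecreasing, the sequence increases from there on. *)
Lemma dense_norms_not_log_convex (v : nat -> R) : dense_norms v ->
  (forall n, v n.+1 ^+ 2 <= v n * v n.+2) -> False.
Proof.
move=> dv lc; have vp := dense_norms_gt0 dv; have [v0 vz vs vl] := dv.
have [m vm] : exists m, v m < v m.+1.
  apply: contrapT => /forallNP h.
  have vn n : v n <= v 0.
    elim: n => [//|n]; apply: le_trans; rewrite leNgt; apply/negP; exact: h.
  by have [n] := vl (v 0); rewrite ltNge vn.
have up j : v (m + j)%N < v (m + j).+1.
  elim: j => [|j IH]; first by rewrite addn0.
  rewrite addnS ltNge; apply/negP => h.
  have := lc (m + j)%N; rewrite leNgt => /negP; apply.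
  by rewrite expr2 (le_lt_trans (ler_wpM2l (ltW (vp _)) h))// ltr_pM2r.
apply: (dense_norms_not_growing dv (m := m)) => j.
by elim: j => [|j IH]; rewrite ?addn0// addnS (le_trans IH)// ltW.
Qed.

Context (a b c : C).
Local Notation T := (toeplitz (psi a b c)).

Lemma l2norm_cst (K : R) : 0 <= K -> l2norm D1 (fun=> K%:C%C) = K.
Proof.
move=> K0; have l0 : l2 D1 (fun z : C => z ^+ 0) by exact: l2_pow.
have E : sq D1 (fun z : C => K%:C%C * z ^+ 0) = K ^+ 2.
  by rewrite (sqZ mD _ l0) (sq_disk_pow 0 ltr01) expr1n divr1 mulr1 nm_pos.
rewrite /l2norm (_ : sq D1 _ = K ^+ 2) ?sqrtr_sqr ?ger0_norm//.
by rewrite -E; apply: sq_eq => p _; rewrite expr0 mulr1.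
Qed.

Lemma bergman_cst k : bergman (fun _ : C => k).
Proof.
apply/bergmanE; split; first by apply: l2_bm => //; exact: bm_cst.
by move=> z _; exact: cder_cst.
Qed.

(** Density is tested on constants: 0 for small norms, and |M| + 1, approached within distance 1,
    for large ones. *)
Lemma hypercyclic_orbit : hypercyclic T -> exists2 f, bergman f &
  dense_norms (fun n => l2norm D1 (iter n T f)).
Proof.
move=> [_ [f bf hd]]; exists f => //; split=> [n|n n0|e e0|M]; first exact: l2norm_ge0.
- have /bergmanE[k1 k2] := iter_bergman a b c n bf.
  have M0 : 0 <= nm a + nm b + nm c by rewrite !addr_ge0 ?nm_ge0.
  have := toeplitz_l2norm M0 k1 (@nm_psi R a b c); rewrite n0 mulr0 => h.
  by apply/eqP; rewrite eq_le l2norm_ge0 andbT iterS.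
- have [n] := hd _ (bergman_cst 0) e e0; rewrite L2_normE => hn; exists n.
  rewrite (_ : l2norm D1 _ = l2norm D1 (fun w => iter n T f w - 0))//.
  by congr Num.sqrt; apply: sq_eq => p _; rewrite subr0.
pose K := `|M| + 1; have K0 : 0 <= K by rewrite addr_ge0.
have [n] := hd _ (bergman_cst K%:C%C) 1 ltr01; rewrite L2_normE => hn; exists n.
have /bergmanE[h1 h2] := iter_bergman a b c n bf.
have /bergmanE[k1 k2] := bergman_cst K%:C%C.
have h3 := l2B mD h1 k1.
have : l2norm D1 (fun=> K%:C%C) <= l2norm D1 (iter n T f) + l2norm D1 (fun w => -1 * (iter n T f w - K%:C%C)).
  rewrite (le_trans _ (l2normD mD h1 (l2Z mD _ h3)))// le_eqVlt; apply/orP; left; apply/eqP.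
  by congr Num.sqrt; apply: sq_eq => p _; ring.
by rewrite (l2normZ mD _ h3) nmN nm1 mul1r l2norm_cst// /K; have := ler_norm M; lra.
Qed.

Lemma log_convex_not_hypercyclic :
  (forall h, bergman h -> l2norm D1 (T h) ^+ 2 <= l2norm D1 h * l2norm D1 (T (T h))) -> ~ hypercyclic T.
Proof.
move=> lc /hypercyclic_orbit[f bf /dense_norms_not_log_convex]; apply => n.
by rewrite !iterS; apply: lc; exact: iter_bergman.
Qed.

Lemma contraction_not_hypercyclic :
  (forall z, nm z < 1 -> nm (psi a b c z) <= 1) -> ~ hypercyclic T.
Proof.
move=> h /hypercyclic_orbit[f bf [_ _ _ h2]].
have le n : l2norm D1 (iter n T f) <= l2norm D1 f.
  elim: n => [//|n]; apply: le_trans; have /bergmanE[k1 k2] := iter_bergman a b c n bf.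
  by rewrite iterS; have := toeplitz_l2norm ler01 k1 h; rewrite mul1r.
by have [n] := h2 (l2norm D1 f); rewrite ltNge le.
Qed.

Lemma expansion_not_hypercyclic :
  (forall h, bergman h -> l2norm D1 h <= l2norm D1 (T h)) -> ~ hypercyclic T.
Proof.
move=> hx /hypercyclic_orbit[f bf /(@dense_norms_not_growing _ 0)]; apply; elim=> [//|j IH].
by rewrite addnS iterS (le_trans IH)//; apply: hx; exact: iter_bergman.
Qed.
End Orbit.

(** * The case |a| <= |c| *)

Section Hyponormal.
Context {R : realType}.
Local Notation C := R[i].
Local Notation D1 := (@disk R 1).
Implicit Types (f g h p s : C -> C) (r : R) (z w k : C).

Let mD : measurable D1 := disk_measurable 1.

Lemma sq_lin3 k1 k2 k3 f g h : l2 D1 f -> l2 D1 g -> l2 D1 h ->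
  sq D1 (fun z => k1 * f z + k2 * g z + k3 * h z) =
  nm k1 ^+ 2 * sq D1 f + nm k2 ^+ 2 * sq D1 g + nm k3 ^+ 2 * sq D1 h +
  2 * complex.Re (k1 * conjc k2 * ip D1 f g + k1 * conjc k3 * ip D1 f h + k2 * conjc k3 * ip D1 g h).
Proof.
move=> hf hg hh; have kf := l2Z mD k1 hf; have kg := l2Z mD k2 hg; have kh := l2Z mD k3 hh.
rewrite (sq_add mD (l2D mD kf kg) kh) (sq_add mD kf kg) !(sqZ mD)//.
rewrite (ipDl mD kf kg kh) (ipZl mD _ hf kg) (ipZr mD _ hf hg) (ipZl mD _ hf kh) (ipZr mD _ hf hh).
rewrite (ipZl mD _ hg kh) (ipZr mD _ hg hh) !cReD !mulrA; ring.
Qed.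

Context (a b c : C).
Local Notation T := (toeplitz (psi a b c)).
Local Notation Tadj := (toeplitz (psi (conjc c) (conjc b) (conjc a))).

(** The operator is a combination of S, whose symbol is conj z, the identity, and multiplication by
    z, which preserves holomorphy. *)
Lemma toeplitz_decomp a' b' c' g z : hol g -> l2 D1 g -> nm z < 1 ->
  toeplitz (psi a' b' c') g z = a' * toeplitz (psi 1 0 0) g z + b' * g z + c' * (z * g z).
Proof.
move=> hg g2; have [s2 _] := toeplitz_l2 1 0 0 g2; have z2 := l2_mulz g2.
have hs := @toeplitz_hol R 1 0 0 _ g2; have [t2 _] := toeplitz_l2 a' b' c' g2.
apply: (@coord_inj R _ (fun z => a' * toeplitz (psi 1 0 0) g z + b' * g z + c' * (z * g z))).
- exact: toeplitz_hol.
- exact: t2.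
- move=> y y1; apply: cderD; last by apply: cderM; [exact: cder_cst|exact: (hol_mulz hg y1)].
  apply: cderD; first by apply: cderM; [exact: cder_cst|exact: (hs _ y1)].
  by apply: cderM; [exact: cder_cst|exact: (hg _ y1)].
- exact: (l2D mD (l2D mD (l2Z mD a' s2) (l2Z mD b' g2)) (l2Z mD c' z2)).
move=> n; rewrite (coordD n (l2D mD (l2Z mD a' s2) (l2Z mD b' g2)) (l2Z mD c' z2)).
rewrite (coordD n (l2Z mD a' s2) (l2Z mD b' g2)) (coordZ _ _ s2) (coordZ _ _ g2) (coordZ _ _ z2).
rewrite !(coord_toeplitz _ _ _ n hg g2) (coord_mulz n hg g2); move: (coord g) => x.
by case: n => [|n]; rewrite /jac; ring.
Qed.

(** Expand both squared norms by [toeplitz_decomp]. As S is adjoint to multiplication by z, <S g, g>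
    = <g, z g>, and the cross terms agree. The difference is (|c|^2 - |a|^2)(|z g|^2 - |S g|^2), and
    |S g| <= |z g| because projecting conj z * g does not increase its norm. *)
Lemma toeplitz_adj_le g : nm a <= nm c -> bergman g -> l2norm D1 (Tadj g) <= l2norm D1 (T g).
Proof.
move=> ac /bergmanE[g2 hg]; have [s2 s2le] := toeplitz_l2 1 0 0 g2; have z2 := l2_mulz g2.
set S := toeplitz (psi 1 0 0) g in s2 s2le.
have E a' b' c' : sq D1 (toeplitz (psi a' b' c') g) =
    sq D1 (fun z => a' * S z + b' * g z + c' * (z * g z)).
  by apply: sq_eq => p /(nm_disk _ ler01) p1; exact: toeplitz_decomp.
have SZ : sq D1 S <= sq D1 (fun z => z * g z).
  rewrite -!l2norm_sqr lerXn2r ?nnegrE ?l2norm_ge0// (le_trans s2le)// le_eqVlt; apply/orP; left; apply/eqP.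
  congr Num.sqrt; apply: eq_Rintegral => p _.
  by rewrite /psi !nmM mul1r addr0 mul0r addr0 nm_conj.
have ipE : ip D1 S g = ip D1 g (fun z => z * g z).
  rewrite (ip_toeplitz 1 0 0 hg g2 hg g2); apply: CI_eq => p _.
  by rewrite /psi mul1r addr0 mul0r addr0 cjM; ring.
have h : nm a ^+ 2 <= nm c ^+ 2 by rewrite lerXn2r ?nnegrE ?nm_ge0.
have S0 := sq_ge0 D1 S.
apply: ler_wsqrtr; rewrite (E (conjc c) (conjc b) (conjc a)) (E a b c) !(sq_lin3 _ _ _ s2 g2 z2).
rewrite !nm_conj !conjcK ipE; move: (ip D1 g _) (ip D1 S _) => q v.
have -> : conjc c * b * q + conjc c * a * v + conjc b * a * q =
  a * conjc b * q + a * conjc c * v + b * conjc c * q by ring.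
by rewrite lerD2r; move: S0 SZ h; move: (nm a ^+ 2) (nm c ^+ 2) (sq D1 S) (sq D1 _) => A K P Q; nra.
Qed.

Lemma ip_adj f g : bergman f -> bergman g -> ip D1 (T f) g = ip D1 f (Tadj g).
Proof.
move=> /bergmanE[f2 hf] /bergmanE[g2 hg].
have [t2 _] := toeplitz_l2 (conjc c) (conjc b) (conjc a) g2.
rewrite (ip_toeplitz a b c hf f2 hg g2) (ip_conj mD t2 f2) (ip_toeplitz _ _ _ hg g2 hf f2).
rewrite -(ip_conj mD (l2_psi _ _ _ g2) f2); apply: CI_eq => p _.
by rewrite /psi !cjM !cjD !cjM !conjcK; ring.
Qed.

(** |T h|^2 = <h, T' T h> <= |h| |T' T h| <= |h| |T T h| for the adjoint T', which is log-convexity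
    of the norms. *)
Lemma hyponormal_not_hypercyclic : nm a <= nm c -> ~ hypercyclic T.
Proof.
move=> ac; apply: log_convex_not_hypercyclic => h bh.
have bT : bergman (T h) := iter_bergman a b c 1 bh.
have /bergmanE[h2 _] := bh; have /bergmanE[t2 _] := bT.
have [ta2 _] := toeplitz_l2 (conjc c) (conjc b) (conjc a) t2.
have n2 : 0 <= sq D1 (T h) := sq_ge0 _ _.
have := l2norm_ip mD h2 ta2; rewrite -(ip_adj bh bT) ip_self (nm_pos n2) -l2norm_sqr => h1.
apply: (le_trans h1).
exact: (ler_wpM2l (l2norm_ge0 _ _) (toeplitz_adj_le ac bT)).
Qed.
End Hyponormal.

Lemma exterior_discE (R : realType) (z : R[i]) : exterior_disc z <-> 1 <= nm z.
Proof. by rewrite /exterior_disc /= nmE -(lecR 1 (nm z)). Qed.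

(** * Symbols of modulus at least 1, and the criterion *)

Section Separation.
Context {R : realType}.
Local Notation C := R[i].
Local Notation D1 := (@disk R 1).
Implicit Types (f g h : C -> C) (r : R) (z w k : C).
Context (a b c : C).
Local Notation T := (toeplitz (psi a b c)).

Let mD : measurable D1 := disk_measurable 1.

Lemma psi_segment (t : R) z w :
  psi a b c (w + t%:C%C * (z - w)) = psi a b c w + t%:C%C * (psi a b c z - psi a b c w).
Proof.
by rewrite /psi cjD cjM cjB (_ : conjc t%:C%C = t%:C%C) ?[conjc _]/= ?oppr0//; ring.
Qed.

Lemma nm_sqrD (x y : C) : nm (x + y) ^+ 2 = nm x ^+ 2 + nm y ^+ 2 + 2 * complex.Re (conjc x * y).
Proof. by case: x => x1 x2; case: y => y1 y2; rewrite !nm_sqr /=; ring. Qed.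

(* Supporting half-plane: a near-minimiser [p] of the modulus over the convex set
   [psi @` disc] almost satisfies [Re (conj p * (q - p)) >= 0] there. *)
Lemma supporting_line (e : R) : 0 < e ->
  (forall z, nm z < 1 -> 1 <= nm (psi a b c z)) ->
  exists2 k, nm k = 1 & forall z, nm z < 1 -> 1 - e <= complex.Re (k * psi a b c z).
Proof.
move=> e0 h1; pose K : R := nm a + nm b + nm c.
have K0 : 0 <= K by rewrite !addr_ge0 ?nm_ge0.
pose L := 1 + (2 * K) ^+ 2; have L1 : 1 <= L by rewrite lerDl sqr_ge0.
(* The minimum of |psi|^2 is approached within t^2, and |q - p| <= 2 K. Comparing with the point at
   parameter t on the segment gives Re(conj p * q) >= |p|^2 - t L / 2 >= |p|^2 - e, and |p| >= 1
   permits division by |p|. *)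
pose t := Num.min 1 (2 * e / L).
have t0 : 0 < t by rewrite lt_min ltr01 divr_gt0 ?mulr_gt0// (lt_le_trans ltr01).
have t1 : t <= 1 by rewrite ge_min lexx.
have tL : t * L <= 2 * e by rewrite -ler_pdivlMr ?ge_min ?lexx ?orbT// (lt_le_trans ltr01).
pose E := [set r : R | exists2 z, nm z < 1 & r = nm (psi a b c z) ^+ 2].
have E0 : has_inf E.
  split; first by exists (nm (psi a b c 0) ^+ 2); exists 0 => //; rewrite nm0.
  by exists 0 => _ [z _ ->]; exact: sqr_ge0.
have t20 : 0 < t ^+ 2 by rewrite exprn_gt0.
have [_ [w w1 ->] hw] := inf_adherent t20 E0.
set p := psi a b c w in hw; have p1 : 1 <= nm p := h1 w w1.
have p0 : nm p != 0 by rewrite gt_eqF// (lt_le_trans ltr01).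
exists (conjc p / (nm p)%:C%C).
  by rewrite nmM nmV nm_conj nm_pos ?nm_ge0// divff.
move=> z z1; set q := psi a b c z.
have wz : nm (w + t%:C%C * (z - w)) < 1.
  have -> : w + t%:C%C * (z - w) = (1 - t)%:C%C * w + t%:C%C * z by rewrite rcB; ring.
  rewrite (le_lt_trans (nmD _ _))// !nmM !nm_pos ?(ltW t0) ?subr_ge0//.
  by have := nm_ge0 w; have := nm_ge0 z; nra.
have : nm p ^+ 2 - t ^+ 2 <= nm (psi a b c (w + t%:C%C * (z - w))) ^+ 2.
  have : inf E <= nm (psi a b c (w + t%:C%C * (z - w))) ^+ 2.
    by apply: ge_inf; [case: E0|exists (w + t%:C%C * (z - w))].
  by lra.
rewrite psi_segment -/p -/q nm_sqrD nmM nm_pos ?(ltW t0)// exprMn.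
have qp : nm (q - p) ^+ 2 <= (2 * K) ^+ 2.
  rewrite lerXn2r ?nnegrE ?nm_ge0 ?mulr_ge0// (le_trans (nmB _ _))// mulr_natl mulr2n.
  by rewrite lerD//; exact: nm_psi.
have -> : complex.Re (conjc p * (t%:C%C * (q - p))) =
    t * (complex.Re (conjc p * q) - nm p ^+ 2).
  by move: p q {qp hw p1 p0} => [p1 p2] [q1 q2]; rewrite nm_sqr /=; ring.
have -> : conjc p / (nm p)%:C%C * q = ((nm p)^-1)%:C%C * (conjc p * q) by rewrite rcV; ring.
have -> x y : complex.Re (x%:C%C * y) = x * complex.Re y by case: y => y1 y2 /=; rewrite mul0r subr0.
set s := complex.Re (conjc p * q) => hq.
have hs : nm p ^+ 2 - t * L / 2 <= s.
  rewrite -(@ler_pM2l _ t)// /L; nra.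
rewrite mulrC ler_pdivlMr ?(lt_le_trans ltr01)//; nra.
Qed.

(** By [ip_toeplitz] the projection may be dropped when pairing with [f]: |T f| |f| >= |<k psi f,
    f>|, at least the integral of Re(k psi) |f|^2, hence at least (1 - e) |f|^2 for the k of
    [supporting_line]. *)
Lemma away_expansion f : (forall z, nm z < 1 -> 1 <= nm (psi a b c z)) -> bergman f ->
  l2norm D1 f <= l2norm D1 (T f).
Proof.
move=> h1 /bergmanE[f2 hf]; have [t2 _] := toeplitz_l2 a b c f2; have p2 := l2_psi a b c f2.
have [f0|fn0] := eqVneq (l2norm D1 f) 0; first by rewrite f0 l2norm_ge0.
have fp : 0 < l2norm D1 f by rewrite lt_neqAle eq_sym fn0 l2norm_ge0.
suff key (e : R) : 0 < e -> (1 - e) * l2norm D1 f <= l2norm D1 (T f).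
  apply/ler_addgt0Pr => e e0; have := key (e / l2norm D1 f) (divr_gt0 e0 fp).
  by rewrite mulrBl mul1r divfK// lerBlDr.
move=> e0; have [k k1 hk] := supporting_line e0 h1.
rewrite -(ler_pM2r fp).
apply: (@le_trans _ _ (nm (k * ip D1 (T f) f))); last by rewrite nmM k1 mul1r (l2norm_ip mD t2 f2).
rewrite (ip_toeplitz a b c hf f2 hf f2); apply: (le_trans _ (Re_le_nm _)).
apply: (le_trans _ (ler_norm _)).
rewrite /ip -(CIZ _ mD (l2_cinteg mD p2 f2)) -mulrA -expr2 l2norm_sqr.
have [i1 _] := cintegZ k mD (l2_cinteg mD p2 f2); have [_ i2] := f2.
rewrite /CI /sq [leRHS]/= -(RintegralZl _ mD i2).
apply: (Rint_le mD (rintegZ (1 - e) mD i2) i1) => p /(nm_disk _ ler01) /hk hp.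
rewrite -!mulrA mul_conj mulrA.
have -> (x : R) y : complex.Re (y * x%:C%C) = complex.Re y * x by case: y => y1 y2 /=; rewrite mulr0 subr0.
by rewrite ler_wpM2r ?sqr_ge0.
Qed.

Lemma psi_criterion : a != 0 ->
  hypercyclic T <-> nm c < nm a /\
    ((exists2 z, nm z < 1 & nm (psi a b c z) < 1) /\
     (exists2 z, nm z < 1 & 1 <= nm (psi a b c z))).
Proof.
move=> a0; split; last first.
  by move=> [ca [[z1 hz1 p1] [z2 hz2 p2]]]; exact: (toeplitz_hypercyclic a0 ca hz1 p1 hz2 p2).
move=> hT; split.
  by rewrite ltNge; apply/negP => ac; exact: (hyponormal_not_hypercyclic ac hT).
split; apply: contrapT => no.
  apply: (@expansion_not_hypercyclic R a b c) hT => h; apply: away_expansion => z z1.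
  by rewrite leNgt; apply/negP => p1; apply: no; exists z.
apply: (@contraction_not_hypercyclic R a b c) hT => z z1.
by rewrite leNgt; apply/negP => p1; apply: no; exists z => //; exact: ltW.
Qed.
End Separation.

Unset Implicit Arguments.

Theorem theorem3p6 (R : realType) (a b c : R[i]) (ha : a != 0) :
  let Psi := (fun z : R[i] => a * conjc z + b + c * z) in
  hypercyclic (toeplitz Psi) <->
    `|c| < `|a| /\
    ((disc `&` (Psi @` disc)) !=set0 /\
     (exterior_disc `&` (Psi @` disc)) !=set0).
Proof.
move=> Psi; have -> : (`|c| < `|a|) = (nm c < nm a) by rewrite !nmE ltcR.
apply: (iff_trans (psi_criterion b c ha)); split=> -[ca [h1 h2]]; split=> //; split.
- have [z z1 p1] := h1; exists (Psi z); split; first exact/discE.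
  by exists z => //; exact/discE.
- have [z z1 p1] := h2; exists (Psi z); split; first exact/exterior_discE.
  by exists z => //; exact/discE.
- by have [y [/discE p1 [z /discE z1 E]]] := h1; exists z => //; move: p1; rewrite -E.
- by have [y [/exterior_discE p1 [z /discE z1 E]]] := h2; exists z => //; move: p1; rewrite -E.
Qed.
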